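(* Let $K \subset \mathbb{R}^2$ be a self-similar set with $\mathcal{H}^1(K) > 0$, where $\mathcal{H}^1$ is one-dimensional Hausdorff measure. Then the distance set $D(K) = \{|x-y| : x,y \in K\}$ satisfies $\dim D(K) = 1$.
   Context: $\dim$ denotes Hausdorff dimension. A (contractive) similitude on $\mathbb{R}^2$ is a map $\psi : \mathbb{R}^2 \to \mathbb{R}^2$ for which there is $r \in (0,1)$ with $|\psi(x)-\psi(y)| = r|x-y|$ for all $x,y \in \mathbb{R}^2$ (reflections and rotations are allowed). A self-similar set in the plane is the unique non-empty compact set $K \subset \mathbb{R}^2$ satisfying $K = \bigcup_{j=1}^{q} \psi_j(K)$ for some finite collection $\{\psi_1,\ldots,\psi_q\}$ of contractive similitudes on $\mathbb{R}^2$. No separation condition is assumed. *)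

(* Defs.v *)
From HB Require Import structures.
From mathcomp Require Import all_boot all_order all_algebra.
From mathcomp Require Import all_classical all_reals all_analysis.

Set Implicit Arguments.
Unset Strict Implicit.
Unset Printing Implicit Defensive.

Import Order.TTheory GRing.Theory Num.Theory.
Import numFieldNormedType.Exports.

Local Open Scope classical_set_scope.
Local Open Scope ring_scope.

(* The library norm on 'rV[R]_n is the sup norm, hence this definition. The
   library topology on 'rV[R]_n, used for compactness, is the Euclidean one. *)
Definition eucl_dist (R : realType) (n : nat) (x y : 'rV[R]_n) : R :=
  Num.sqrt (\sum_(i < n) (x 0 i - y 0 i) ^+ 2).

Section Hausdorff.
Context (R : realType) (T : Type) (d : T -> T -> R).
Local Open Scope ereal_scope.

(* The added element 0 only matters for set0, whose diameter is 0 and not -oo. *)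
Definition diam (A : set T) : \bar R :=
  ereal_sup (0 |` [set (d x y)%:E | x in A & y in A]).

(* Since 0 `^ 0 = 1 in the library, set0 has to be singled out when s = 0. *)
Definition diam_pow (s : R) (A : set T) : \bar R :=
  if A == set0 then 0 else diam A `^ s.

Definition delta_cover (delta : R) (A : set T) (F : (set T)^nat) : Prop :=
  A `<=` \bigcup_k F k /\ forall k, diam (F k) <= delta%:E.

Definition hausdorff_content (s delta : R) (A : set T) : \bar R :=
  ereal_inf [set \sum_(0 <= k <oo) diam_pow s (F k)
            | F in delta_cover delta A].

(* The content is nonincreasing in delta, so that this supremum is also its
   limit as delta tends to 0. *)
Definition hausdorff_measure (s : R) (A : set T) : \bar R :=
  ereal_sup [set hausdorff_content s delta A | delta in [set t : R | 0 < t]%R].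

Definition hausdorff_dim (A : set T) : \bar R :=
  ereal_inf [set s%:E | s in [set s : R | (0 <= s)%R /\
                                          hausdorff_measure s A = 0]].

End Hausdorff.

Definition similitude (R : realType) (n : nat) (psi : 'rV[R]_n -> 'rV[R]_n) :
    Prop :=
  exists r : R, 0 < r < 1 /\
    forall x y, eucl_dist (psi x) (psi y) = r * eucl_dist x y.

Definition self_similar (R : realType) (n : nat) (K : set 'rV[R]_n) : Prop :=
  [/\ K !=set0, compact K &
      exists (q : nat) (psi : 'I_q -> 'rV[R]_n -> 'rV[R]_n),
        (forall j, similitude (psi j)) /\
        K = \bigcup_(j in [set: 'I_q]) (psi j @` K)].

Definition distance_set (R : realType) (n : nat) (K : set 'rV[R]_n) : set R :=
  [set eucl_dist x y | x in K & y in K].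

(* Main.v *)
Require Import Defs.
From HB Require Import structures.
From mathcomp Require Import all_boot all_order all_algebra.
From mathcomp Require Import all_classical all_reals all_analysis.
From mathcomp Require Import complex zify ring lra.

Set Implicit Arguments.
Unset Strict Implicit.
Unset Printing Implicit Defensive.

Import Order.TTheory GRing.Theory Num.Theory Normc.
Import numFieldNormedType.Exports.

Local Open Scope ring_scope.
Local Notation Re := complex.Re.
Local Notation Im := complex.Im.

(* Fix t < 1; it suffices to bound sum d_k^t from below over all covers of the
   distance set. Identify the plane with C. The linear part of a word in the
   similitudes depends only on its letter counts, so among the words of length
   n only polynomially many linear parts occur; as H^1(K) > 0, some of them is
   shared by N words with rho-separated images, where rho is the common ratio
   and N rho^t is as large as we like. Averaging over an arc of directions e,
   the projections onto e of the images of the length-n words of this family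
   are, for most e, separated at scale rho^n up to a factor O(n). Choosing
   separated digits level by level gives a tree of points of K on which
   x |-> |x - y| is expanding as soon as x - y is parallel to the good
   direction, and a weighted Koenig argument bounds the covers of the image.
   - If some rotation part has infinite order, the direction seen at level k
     rotates with k; its returns close to the identity provide the arcs, so the
     average over the levels is good for every e.
   - Otherwise the family can be taken homothetic, and a good e must be a limit
     direction of K. Unless K is collinear, limit directions contain an arc:
     otherwise K is a Lipschitz graph whose slopes have gaps everywhere, a
     member of a nearly optimal cover of K cannot be split and so has no large
     gap, the slopes seen from one of its ends cannot jump, and therefore an
     arbitrarily flat copy of K exists. *)

(** * The complex plane *)

(** No separation condition is available; positivity of H^1 replaces it, since too few separated
    images would give covers of K of small total length. Words of length n with common ratio rho
    thus satisfy N rho >= 1/poly(n), and rho^(t-1) is exponentially large in n. The family is also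
    cut down to N rho <= 1: at this critical value the discrete 1-energy of the level-n points grows
    only by a factor n, and N rho^t >= 2 supplies 2^n to pay for it. Projections enter through |x -
    y|^2 - |x' - y|^2 = <x + x' - 2y, x - x'>: when x and x' run over a small copy of K far from y,
    the left factor is almost constant. The direction is then not free: it is prescribed by the pair
    of points and by the rotations accumulated along the tree, so knowing that most directions are
    good is not enough by itself. This is the obstacle behind the two cases. All averages over
    directions are finite sums over powers of one small rotation, so no integration occurs. *)

Section ComplexPlane.
Context (R : realType).
Implicit Types z w e v : R[i].

Lemma ReM z w : Re (z * w) = Re z * Re w - Im z * Im w.
Proof. by case: z; case: w. Qed.

Lemma ImM z w : Im (z * w) = Re z * Im w + Im z * Re w.
Proof. by case: z; case: w. Qed.

Lemma ReD z w : Re (z + w) = Re z + Re w.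
Proof. by case: z; case: w. Qed.

Lemma ImD z w : Im (z + w) = Im z + Im w.
Proof. by case: z; case: w. Qed.

Lemma ReN z : Re (- z) = - Re z.
Proof. by case: z. Qed.

Lemma ImN z : Im (- z) = - Im z.
Proof. by case: z. Qed.

Lemma ReJ z : Re (conjc z) = Re z.
Proof. by case: z. Qed.

Lemma ImJ z : Im (conjc z) = - Im z.
Proof. by case: z. Qed.

Lemma Re1 : Re (1 : R[i]) = 1. Proof. by []. Qed.
Lemma Im1 : Im (1 : R[i]) = 0. Proof. by []. Qed.
Lemma Re0 : Re (0 : R[i]) = 0. Proof. by []. Qed.
Lemma Im0 : Im (0 : R[i]) = 0. Proof. by []. Qed.

Lemma Re_nat n : Re (n%:R : R[i]) = n%:R.
Proof. by elim: n => // n IH; rewrite -!natr1 ReD IH. Qed.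

Lemma Im_nat n : Im (n%:R : R[i]) = 0.
Proof. by elim: n => // n IH; rewrite -natr1 ImD IH addr0. Qed.

Definition ReImE := (ReM, ImM, ReD, ImD, ReN, ImN, ReJ, ImJ, Re1, Im1, Re0, Im0, Re_nat, Im_nat).

Lemma complex_eqP z w : Re z = Re w -> Im z = Im w -> z = w.
Proof. by case: z w => a b [c d] /= -> ->. Qed.

Lemma sqr_normc z : normc z ^+ 2 = Re z ^+ 2 + Im z ^+ 2.
Proof. by case: z => a b /=; rewrite sqr_sqrtr // addr_ge0 ?sqr_ge0. Qed.

Lemma normc_ge0 z : 0 <= normc z.
Proof. by case: z => a b; exact: sqrtr_ge0. Qed.

Lemma normc_eq0 z : (normc z == 0) = (z == 0).
Proof.
by apply/eqP/eqP => [|->]; [exact: eq0_normc|exact: normc0].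
Qed.

Lemma normc_gt0 z : (0 < normc z) = (z != 0).
Proof. by rewrite lt_neqAle normc_ge0 andbT eq_sym normc_eq0. Qed.

Lemma normcJ z : normc (conjc z) = normc z.
Proof. by case: z => a b /=; rewrite sqrrN. Qed.

Lemma normcX z n : normc (z ^+ n) = normc z ^+ n.
Proof.
by elim: n => [|n IH]; [exact: normc1|rewrite !exprS normcM IH].
Qed.

Lemma normc_real (x : R) : normc (real_complex R x) = `|x|.
Proof. by rewrite /= expr0n /= addr0 sqrtr_sqr. Qed.

Lemma normcB z w : normc (z - w) = normc (w - z).
Proof. by rewrite -normcN opprB. Qed.

Lemma normc_trans w z z' : normc (z - z') <= normc (z - w) + normc (w - z').
Proof. by rewrite -{1}(subrKA w z (- z')); exact: le_normcD. Qed.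

Lemma normRe_le z : `|Re z| <= normc z.
Proof.
rewrite -(@ler_pXn2r _ 2) ?nnegrE ?normc_ge0 // sqr_normc real_normK ?num_real //.
by rewrite lerDl sqr_ge0.
Qed.

Lemma normIm_le z : `|Im z| <= normc z.
Proof.
rewrite -(@ler_pXn2r _ 2) ?nnegrE ?normc_ge0 // sqr_normc real_normK ?num_real //.
by rewrite lerDr sqr_ge0.
Qed.

Lemma normc_le_ReIm z : normc z <= `|Re z| + `|Im z|.
Proof.
rewrite -(@ler_pXn2r _ 2) ?nnegrE ?normc_ge0 ?addr_ge0 // sqr_normc sqrrD.
rewrite !real_normK ?num_real //.
by have := mulr_ge0 (normr_ge0 (Re z)) (normr_ge0 (Im z)); lra.
Qed.

Definition proj e z : R := Re (conjc e * z).

Lemma projE e z : proj e z = Re e * Re z + Im e * Im z.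
Proof. by rewrite /proj !ReImE; ring. Qed.

Lemma projB e z w : proj e (z - w) = proj e z - proj e w.
Proof. by rewrite !projE !ReImE; ring. Qed.

Lemma projD e z w : proj e (z + w) = proj e z + proj e w.
Proof. by rewrite !projE !ReImE; ring. Qed.

Lemma projM e a z : proj e (a * z) = proj (conjc a * e) z.
Proof. by rewrite !projE !ReImE; ring. Qed.

Lemma normr_proj_le e z : `|proj e z| <= normc e * normc z.
Proof. by rewrite -(normcJ e) -normcM normRe_le. Qed.

Lemma card_window J (A : {set 'I_J}) (X : R) : 0 <= X ->
  (forall i j, i \in A -> j \in A -> (i <= j)%N -> (j - i)%:R <= X) ->
  #|A|%:R <= X + 1.
Proof.
move=> X0 hA; have [->|[i0 i0A]] := set_0Vmem A.
  by rewrite cards0 addr_ge0.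
have [i iA imin] := @arg_minnP _ i0 (mem A) (@nat_of_ord J) i0A.
have hj j : j \in A -> (j - i < (Num.truncn X).+1)%N.
  by move=> jA; rewrite ltnS truncn_ge_nat // hA // imin.
pose f (j : 'I_J) : 'I_(Num.truncn X).+1 := inord (j - i).
have finj : {in A &, injective f}.
  move=> j k jA kA /(congr1 val); rewrite /= !inordK ?hj //.
  move=> e; apply: val_inj; rewrite /=.
  by rewrite -(subnK (imin j jA)) -(subnK (imin k kA)) e.
rewrite -(card_in_imset finj); apply: (@le_trans _ _ (Num.truncn X).+1%:R).
  by rewrite ler_nat (leq_trans (max_card _)) ?card_ord.
by rewrite -natr1 lerD2r truncn_le.
Qed.

Lemma normc_expB1 v n : normc v = 1 -> normc (v ^+ n - 1) <= n%:R * normc (v - 1).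
Proof.
move=> v1; elim: n => [|n IH]; first by rewrite expr0 subrr normc0 mul0r.
rewrite exprS (_ : v * _ - 1 = v * (v ^+ n - 1) + (v - 1)); last by ring.
apply: le_trans (le_normcD _ _) _.
by rewrite normcM v1 mul1r -natr1 mulrDl mul1r lerD2r.
Qed.

(** First-order expansion of the power at 1 with an explicit quadratic error; it stands in for
    angles and trigonometric functions. *)
Lemma normc_expB1_approx v n : normc v = 1 ->
  normc (v ^+ n - 1 - n%:R * (v - 1)) <= (n%:R * normc (v - 1)) * (n%:R * normc (v - 1)).
Proof.
move=> v1; elim: n => [|n IH].
  by rewrite expr0 subrr !mul0r subrr normc0.
rewrite exprS (_ : v * _ - 1 - _ = (v ^+ n - 1 - n%:R * (v - 1)) + (v ^+ n - 1) * (v - 1));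
  last by rewrite -natr1; ring.
apply: le_trans (le_normcD _ _) _; rewrite normcM.
have := normc_expB1 n v1; move: IH (normc_ge0 (v - 1)).
rewrite -natr1; set b := normc (v - 1); set X := normc _; set Y := normc _.
have : 0 <= n%:R :> R by [].
set k : R := n%:R => k0 h b0 hY.
have := ler_wpM2r b0 hY; nra.
Qed.

End ComplexPlane.

(** * Small projections along an arc of directions *)

Section Arc.
Context (R : realType).
Implicit Types z w e v : R[i].

(* The arc [v ^+ j * e] turns by less than [1/8] radian, hence
   [proj (v ^+ j * e) w] is monotone in [j] wherever it is small. *)
Lemma arc_step v (zeta : R[i]) (k : nat) :
  normc v = 1 -> k%:R * normc (v - 1) <= 1 / 8 -> (0 < k)%N ->
  8 * `|Re zeta| <= normc zeta ->
  k%:R * (normc (v - 1) * normc zeta) <= 2 * `|Re (v ^+ k * zeta) - Re zeta|.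
Proof.
move=> v1 hk k0 hz.
have kR : 1 <= k%:R :> R by rewrite ler1n.
have b0 := normc_ge0 (v - 1); have z0 := normc_ge0 zeta.
(* On the unit circle the real part of [v - 1] is of second order, and [zeta] is almost imaginary by
   hypothesis. The main term of [Re ((v - 1) * zeta)] is therefore [- Im (v - 1) * Im zeta], of size
   close to [normc (v - 1) * normc zeta]. *)
have hv : 2 * Re (v - 1) = - normc (v - 1) ^+ 2.
  have := sqr_normc v; rewrite v1 sqr_normc !ReImE; nra.
have hb := sqr_normc (v - 1); have hn := sqr_normc zeta.
have h3 : `|Re ((v ^+ k - 1 - k%:R * (v - 1)) * zeta)| <=
    k%:R * (normc (v - 1) * normc zeta) / 8.
  apply: le_trans (normRe_le _) _; rewrite normcM.
  rewrite (_ : _ / 8 = k%:R * normc (v - 1) / 8 * normc zeta); last by ring.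
  rewrite ler_wpM2r //; apply: le_trans (normc_expB1_approx k v1) _.
  by rewrite ler_wpM2l ?mulr_ge0 //; lra.
have -> : Re (v ^+ k * zeta) - Re zeta =
   k%:R * (Re (v - 1) * Re zeta - Im (v - 1) * Im zeta) +
   Re ((v ^+ k - 1 - k%:R * (v - 1)) * zeta).
  by rewrite !ReImE; ring.
move: h3 hv hb hn hk hz; set b := normc (v - 1); set x := Re zeta; set y := Im zeta.
set n := normc zeta; set E := Re (_ * zeta); set a := Re _; set c := Im _.
rewrite -/b -/n in b0 z0 *.
set K : R := k%:R => h3 hv hb hn hk hz.
have b8 : b <= 1 / 8.
  by apply: le_trans hk; rewrite -{1}[b]mul1r ler_wpM2r.
have bb : b ^+ 2 <= b / 8 by rewrite expr2; have := ler_wpM2l b0 b8; rewrite [b * (1 / 8)]mulrC; lra.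
have b2 := sqr_ge0 b.
have n2 := sqr_ge0 n.
have ha : `|a| <= b / 16 by rewrite ler_norml; apply/andP; split; lra.
have hc : 9 / 10 * b <= `|c|.
  rewrite -(@ler_pXn2r _ 2) ?nnegrE ?mulr_ge0 ?real_normK ?num_real //.
  move: (ha); rewrite ler_norml => /andP[ha1 ha2].
  have : 0 <= (b / 16 - a) * (b / 16 + a) by rewrite mulr_ge0; lra.
  lra.
have hy : 9 / 10 * n <= `|y|.
  rewrite -(@ler_pXn2r _ 2) ?nnegrE ?mulr_ge0 ?real_normK ?num_real //.
  have : `|x| <= n / 8 by lra.
  rewrite ler_norml => /andP[hx1 hx2].
  have : 0 <= (n / 8 - x) * (n / 8 + x) by rewrite mulr_ge0; lra.
  lra.
have bn0 : 0 <= b * n by rewrite mulr_ge0.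
have hcy : 81 / 100 * (b * n) <= `|c * y|.
  rewrite normrM.
  rewrite (_ : 81 / 100 * _ = (9 / 10 * b) * (9 / 10 * n)); last by field.
  by apply: ler_pM => //; lra.
have hax : `|a * x| <= 1 / 128 * (b * n).
  rewrite normrM (_ : 1 / 128 * _ = (b / 16) * (n / 8)); last by field.
  by apply: ler_pM => //; lra.
have hkk : 8 / 10 * (b * n) <= `|a * x - c * y|.
  have := lerB_dist (c * y) (a * x); rewrite distrC; lra.
have hk2 : K * (8 / 10 * (b * n)) <= `|K * (a * x - c * y)|.
  by rewrite normrM ger0_norm ?ler_wpM2l //; lra.
have := lerB_dist (K * (a * x - c * y)) (- E); rewrite opprK normrN.
have : 0 <= K * (b * n) by rewrite mulr_ge0 ?mulr_ge0; lra.
lra.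
Qed.

(** Discrete form of the fact that the directions along which [w] projects to length at most [d]
    have measure O(d / |w|). By [arc_step] the projection moves at a definite speed where it is
    small, so the indices counted lie in a short window. *)
Lemma arc_count v e w (J : nat) (d : R) :
  normc v = 1 -> v != 1 -> normc e = 1 -> J%:R * normc (v - 1) <= 1 / 8 ->
  w != 0 -> 0 <= d ->
  #|[set j : 'I_J | `|proj (v ^+ j * e) w| <= d]|%:R <=
    4 * d / (normc (v - 1) * normc w) + 1.
Proof.
move=> v1 vn1 e1 hJ w0 d0.
have b0 : 0 < normc (v - 1) by rewrite normc_gt0 subr_eq0.
have n0 : 0 < normc w by rewrite normc_gt0.
have bn0 : 0 < normc (v - 1) * normc w by rewrite mulr_gt0.
(* If [d] is not small compared with [normc w], the bound already exceeds [J], the whole arc having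
   length at most 1/8. *)
have [hd|hd] := lerP (8 * d) (normc w); last first.
  apply: (@le_trans _ _ J%:R); first by rewrite ler_nat (leq_trans (max_card _)) ?card_ord.
  rewrite -[J%:R]addr0 lerD // ler_pdivlMr // mulrA.
  apply: le_trans (ler_wpM2r (ltW n0) hJ) _; lra.
have X0 : 0 <= 4 * d / (normc (v - 1) * normc w).
  by apply: divr_ge0; [apply: mulr_ge0|exact: ltW].
apply: card_window => //.
move=> i j; rewrite !inE => hi hj ij.
move: ij; rewrite leq_eqVlt => /orP[/eqP ->|ij].
  by rewrite subnn.
have cv1 : normc (conjc v) = 1 by rewrite normcJ.
have cvB : normc (conjc v - 1) = normc (v - 1).
  by rewrite -(normcJ (v - 1)) rmorphB rmorph1.
pose zeta := conjc (v ^+ i * e) * w.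
have nz : normc zeta = normc w by rewrite /zeta normcM normcJ normcM normcX v1 expr1n e1 !mul1r.
have hzi : Re zeta = proj (v ^+ i * e) w by [].
have hzj : Re (conjc v ^+ (j - i) * zeta) = proj (v ^+ j * e) w.
  rewrite /proj /zeta -{2}(subnK (ltnW ij)) exprD !rmorphM !rmorphXn /=.
  by rewrite !mulrA.
have := @arc_step (conjc v) zeta (j - i) cv1.
rewrite cvB nz hzi hzj subn_gt0 ij => /(_ _ isT) h.
rewrite ler_pdivlMr //; apply: le_trans (h _ _) _.
- apply: le_trans hJ; rewrite ler_wpM2r ?normc_ge0 // ler_nat.
  by rewrite (leq_trans (leq_subr _ _)) // ltnW.
- by lra.
- rewrite (_ : 4 * d = 2 * (d + d)) ?ler_pM2l //; last by ring.
  by apply: le_trans (ler_normB _ _) _; apply: lerD.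
Qed.

End Arc.

(** * Separated families and close pairs *)

Lemma sqr_sum_leq (I : finType) (B : {set I}) (f : I -> nat) :
  ((\sum_(b in B) f b) ^ 2 <= #|B| * \sum_(b in B) f b ^ 2)%N.
Proof.
rewrite -(@leq_pmul2l 2) //.
have -> : (2 * (\sum_(b in B) f b) ^ 2 =
    \sum_(b in B) \sum_(b' in B) 2 * (f b * f b'))%N.
  rewrite expnS expn1 big_distrlr /= big_distrr /=.
  by apply: eq_bigr => b _; rewrite big_distrr.
have -> : (2 * (#|B| * \sum_(b in B) f b ^ 2) =
    \sum_(b in B) \sum_(b' in B) (f b ^ 2 + f b' ^ 2))%N.
  under [RHS]eq_bigr do rewrite big_split /= sum_nat_const.
  by rewrite big_split /= sum_nat_const -big_distrr /= mul2n addnn.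
apply: leq_sum => b _; apply: leq_sum => b' _; exact: nat_Cauchy.
Qed.

(** Each index is attached to a member of a maximal [D]-separated set [B], and two indices in one
    fibre have values within [2 * D]. Cauchy-Schwarz over the [#|B|] fibres then shows that few
    close pairs force a large separated set. *)
Lemma separated_subset (R : realType) (T : finType) (f : T -> R) (D : R) :
  0 <= D ->
  exists B : {set T},
    (forall i j, i \in B -> j \in B -> i != j -> D < `|f i - f j|) /\
    (#|T| ^ 2 <= #|B| * #|[set p : T * T | (`|f p.1 - f p.2| <= 2 * D)%R]|)%N.
Proof.
move=> D0.
pose P (B : {set T}) :=
  [forall i in B, forall j in B, (i != j) ==> (D < `|f i - f j|)].
have P0 : P finset.set0 by apply/forallP => i; rewrite inE.
have [B /maxsetP[PB Bmax] _] := maxset_exists P0.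
have sepB i j : i \in B -> j \in B -> i != j -> D < `|f i - f j|.
  by move=> iB jB ij; move/forall_inP: PB => /(_ i iB)/forall_inP/(_ j jB)/implyP; exact.
exists B; split => //.
have cov i : exists b, (b \in B) && (`|f i - f b| <= D).
  have [iB|iB] := boolP (i \in B).
    by exists i; rewrite iB subrr normr0.
  apply/existsP; apply: contraT; rewrite negb_exists => /forallP h.
  have h' b : b \in B -> D < `|f i - f b|.
    by move=> bB; move: (h b); rewrite bB /= -ltNge.
  have : P (i |: B).
    apply/forall_inP => j /finset.setU1P[->|jB]; apply/forall_inP => k /finset.setU1P[->|kB].
    - by rewrite eqxx.
    - by rewrite h' // implybT.
    - by rewrite distrC h' // implybT.
    - by apply/implyP; exact: sepB.
  move=> /Bmax /(_ (finset.subsetUr _ _)) e; case/negP: iB.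
  by rewrite -e finset.setU11.
pose g i := xchoose (cov i).
have gB i : g i \in B by have /andP[] := xchooseP (cov i).
have gD i : `|f i - f (g i)| <= D by have /andP[] := xchooseP (cov i).
have -> : #|T| = (\sum_(b in B) #|[set i | g i == b]|)%N.
  rewrite -sum1_card (partition_big g (mem B)) //=.
  by apply: eq_bigr => b _; rewrite -sum1_card; apply: eq_bigl => i; rewrite inE.
apply: leq_trans (sqr_sum_leq _ _) _; rewrite leq_mul2l; apply/orP; right.
apply: (@leq_trans #|[set p : T * T | g p.1 == g p.2]|).
  have -> : #|[set p : T * T | g p.1 == g p.2]| =
      (\sum_(b in B) #|[set p : T * T | (g p.1 == b) && (g p.2 == b)]|)%N.
    rewrite -sum1_card (partition_big (fun p => g p.1) (mem B)) //=.
    apply: eq_bigr => b _; rewrite -sum1_card; apply: eq_bigl => p.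
    by rewrite !inE andbC; case: eqP => //= ->; rewrite eq_sym.
  apply: leq_sum => b _; rewrite -mulnn -cardsX; apply: subset_leq_card.
  by apply/fintype.subsetP => -[i j]; rewrite !inE.
apply: subset_leq_card; apply/fintype.subsetP => -[i j]; rewrite !inE /= => /eqP e.
have := gD i; have := gD j; rewrite e => h1 h2.
apply: le_trans (ler_distD (f (g j)) _ _) _.
by rewrite (distrC _ (f j)); lra.
Qed.

Lemma natr_card (R : realType) (T : finType) (P : pred T) :
  #|[set p | P p]|%:R = \sum_p (P p)%:R :> R.
Proof.
rewrite -sum1_card natr_sum big_mkcond /=; apply: eq_bigr => p _.
by rewrite inE; case: (P p).
Qed.

Lemma sum_cst (R : realType) (T : finType) (x : R) :
  \sum_(i : T) x = #|T|%:R * x.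
Proof. by rewrite sumr_const mulr_natl. Qed.

(** * Powers of a separated family and their energy *)

Section FamilyPowers.
Context (R : realType) (K : set R[i]) (I : finType) (a : R[i]) (c : I -> R[i]) (rho : R).
Implicit Types (z w : R[i]) (n : nat).

(** Separation is asked for two independent points [z] and [w], that is, between whole images of
    [K]; this is what lets it pass to words, whose tails differ. *)
Definition separated_family :=
  [/\ normc a = rho, 0 < rho < 1,
      forall i z, K z -> K (a * z + c i) &
      forall i j z w, i != j -> K z -> K w ->
        rho <= normc ((a * z + c i) - (a * w + c j))].

Fixpoint word n : finType := if n is n'.+1 then (I * word n')%type else unit.

Fixpoint wordc n : word n -> R[i] :=
  match n return word n -> R[i] with
  | 0%N => fun _ => 0
  | n'.+1 => fun w : I * word n' => a * wordc w.2 + c w.1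
  end.

Lemma card_word n : #|word n| = (#|I| ^ n)%N.
Proof.
by elim: n => [|n IH]; rewrite /= ?card_unit // card_prod IH expnS.
Qed.

Lemma big_word n (F : word n.+1 -> R) :
  \sum_(p : word n.+1) F p = \sum_(i : I) \sum_(w : word n) F (i, w).
Proof. by rewrite pair_bigA /=; apply: eq_bigr => -[]. Qed.

Definition wordp n (z : R[i]) (w : word n) := a ^+ n * z + wordc w.

Lemma wordpS n z i (w : word n) : @wordp n.+1 z (i, w) = a * wordp z w + c i.
Proof. by rewrite /wordp /= exprS; ring. Qed.

Context (fam : separated_family).

Lemma wordp_in n z (w : word n) : K z -> K (wordp z w).
Proof.
case: fam => _ _ hK _ Kz; elim: n w => [[]|n IH [i w]].
  by rewrite /wordp expr0 mul1r addr0.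
by rewrite wordpS; apply: hK.
Qed.

Lemma wordp_neq n z (w w' : word n) : K z -> w != w' -> wordp z w != wordp z w'.
Proof.
move=> Kz; case: fam => a1 /andP[r0 _] _ hs.
elim: n w w' => [[] []//|n IH [i w] [j w']] h; rewrite !wordpS.
have [ij|ij] := eqVneq i j.
  subst j; rewrite (inj_eq (addIr _)) (inj_eq (mulfI _)) ?IH //.
    by apply: contraNneq h => ->.
  by rewrite -normc_eq0 a1 gt_eqF.
rewrite -subr_eq0 -normc_gt0; apply: lt_le_trans r0 _.
by apply: hs => //; exact: wordp_in.
Qed.

(** Pairs of words with distinct first letters are at distance at least [rho]; the others reproduce
    the energy of the previous level multiplied by [rho^-1]. As [#|I|%:R * rho <= 1], each level
    adds at most the same normalised amount, whence the linear factor [n]. Diagonal terms vanish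
    because the inverse of 0 is 0. *)
Lemma energy_bound n z : K z -> #|I|%:R * rho <= 1 ->
  \sum_(w : word n) \sum_(w' : word n) (normc (wordp z w - wordp z w'))^-1
    <= n%:R * #|I|%:R ^+ n / (rho ^+ n * rho).
Proof.
move=> Kz hN; case: (fam) => a1 /andP[r0 r1] _ hs.
elim: n => [|n IH].
  by rewrite big1 ?mul0r // => -[] _; rewrite big1 // => -[] _; rewrite subrr normc0 invr0.
set N : R := #|I|%:R in hN IH *.
have N0 : 0 <= N by [].
set S := (X in X <= _) in IH.
have hS : \sum_(p : word n.+1) \sum_(p' : word n.+1) (normc (wordp z p - wordp z p'))^-1
   <= \sum_(i : I) \sum_(j : I) (rho^-1 * #|word n|%:R ^+ 2 + (i == j)%:R * (rho^-1 * S)).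
  rewrite big_word; apply: ler_sum => i _.
  under eq_bigr => w _ do rewrite big_word.
  rewrite exchange_big /=; apply: ler_sum => j _.
  have [<-|ij] := eqVneq i j.
    rewrite mul1r -[X in X <= _]add0r lerD ?mulr_ge0 ?invr_ge0 ?exprn_ge0 ?(ltW r0) //.
    rewrite /S mulr_sumr; apply: ler_sum => w _; rewrite mulr_sumr; apply: ler_sum => w' _.
    rewrite !wordpS opprD addrACA subrr addr0 -mulrBr normcM a1 invfM.
    by [].
  rewrite mul0r addr0.
  apply: (@le_trans _ _ (\sum_(w : word n) \sum_(w' : word n) rho^-1)).
    apply: ler_sum => w _; apply: ler_sum => w' _; rewrite lef_pV2 ?posrE ?normc_gt0.
    - by rewrite !wordpS; apply: hs => //; exact: wordp_in.
    - rewrite subr_eq0; apply: wordp_neq => //.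
      by apply: contraNneq ij => -[->].
    - by [].
  by rewrite !sum_cst expr2 mulrA mulrC.
apply: le_trans hS _.
under eq_bigr => i _.
  rewrite big_split /= sum_cst -mulr_suml (bigD1 i) //= eqxx big1; last first.
    by move=> j; rewrite eq_sym => /negbTE ->.
  over.
rewrite big_split /= !sum_cst addr0 mul1r card_word natrX -/N.
have rn : 0 < rho ^+ n by rewrite exprn_gt0.
have -> : n.+1%:R * N ^+ n.+1 / (rho ^+ n.+1 * rho) =
   N ^+ n.+1 / (rho ^+ n.+1 * rho) + N * (rho^-1 * (n%:R * N ^+ n / (rho ^+ n * rho))).
  by rewrite -natr1 !exprS; field; rewrite !gt_eqF.
apply: lerD; last by rewrite !ler_wpM2l ?invr_ge0 ?(ltW r0).
rewrite ler_pdivlMr ?mulr_gt0 ?exprn_gt0 //.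
have -> : N * (N * (rho^-1 * (N ^+ n) ^+ 2)) * (rho ^+ n.+1 * rho) =
   N ^+ n.+1 * (N * rho) ^+ n.+1.
  by rewrite exprMn !exprS; field; rewrite !gt_eqF.
by rewrite ler_piMr ?exprn_ge0 // exprn_ile1 ?mulr_ge0 ?(ltW r0).
Qed.

(** After exchanging the sums, a pair of distinct words is close for few directions of the arc,
    inversely to its distance, and the energy bounds the total. The term [J] comes from the
    diagonal, the second [#|I|%:R ^+ n] from the additive 1 in [arc_count]. *)
Lemma sum_close_pairs n J (z v e : R[i]) (D : R) :
  K z -> #|I|%:R * rho <= 1 -> 0 <= D ->
  normc v = 1 -> v != 1 -> normc e = 1 -> J%:R * normc (v - 1) <= 1 / 8 ->
  \sum_(j < J) #|[set p : word n * word n |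
      `|proj (v ^+ j * e) (wordp z p.1) - proj (v ^+ j * e) (wordp z p.2)| <= D * rho ^+ n]|%:R
    <= #|I|%:R ^+ n * (J%:R + #|I|%:R ^+ n + 4 * D * n%:R / (normc (v - 1) * rho)).
Proof.
move=> Kz hN D0 v1 vn1 e1 hJ; case: (fam) => _ /andP[r0 _] _ _.
have b0 : 0 < normc (v - 1) by rewrite normc_gt0 subr_eq0.
set d := D * rho ^+ n; have d0 : 0 <= d by rewrite mulr_ge0 ?exprn_ge0 ?(ltW r0).
under eq_bigr do rewrite natr_card.
rewrite exchange_big /= -(pair_bigA _ (fun w w' : word n => \sum_(j < J)
  (`|proj (v ^+ j * e) (wordp z w) - proj (v ^+ j * e) (wordp z w')| <= d)%R%:R)) /=.
set b := normc (v - 1) in b0 hJ *.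
apply: (@le_trans _ _ (\sum_(w : word n) \sum_(w' : word n)
    ((w == w')%:R * J%:R + (4 * d / b * (normc (wordp z w - wordp z w'))^-1 + 1)))).
  apply: ler_sum => w _; apply: ler_sum => w' _.
  have [<-|ww'] := eqVneq w w'.
    rewrite mul1r subrr normc0 invr0 mulr0 add0r.
    under eq_bigr => j _ do rewrite subrr normr0 d0.
    by rewrite sum_cst card_ord mulr1 lerDl.
  rewrite mul0r add0r.
  under eq_bigr => j _ do rewrite -projB.
  rewrite -natr_card -mulrA -invfM; apply: arc_count => //.
  by rewrite subr_eq0; exact: wordp_neq.
under eq_bigr => w _.
  rewrite big_split /= -mulr_suml (bigD1 w) //= eqxx big1; last first.
    by move=> j; rewrite eq_sym => /negbTE ->.
  rewrite addr0 mul1r big_split /= sum_cst -mulr_sumr.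
  over.
rewrite !big_split /= !sum_cst -mulr_sumr.
have := energy_bound n Kz hN; set S := \sum_w _ => hS.
rewrite card_word natrX mulr1.
set M := #|I|%:R ^+ n in hS *.
rewrite !mulrDr -addrA lerD2l addrC lerD2l.
have hb : 0 <= 4 * d / b by apply: divr_ge0; [apply: mulr_ge0|exact: ltW].
apply: le_trans (ler_wpM2l hb hS) _.
rewrite le_eqVlt; apply/orP; left; apply/eqP; rewrite /d -/M.
by field; apply/and3P; split; rewrite gt_eqF ?exprn_gt0.
Qed.
End FamilyPowers.

(** * Covers of a tree *)

Section WeightedKoenig.
Context (R : realType) (T : finType) (B : nat -> {set T}).
Local Open Scope ereal_scope.

Let W n : R := (\prod_(j < n) #|B j|%:R)%R.

(** [om i] and [lev i] describe a forbidden cylinder, of uniform mass [(W (lev i))^-1]. The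
    forbidden mass is less than the total mass 1, so by averaging a child can be chosen at each node
    that again has less forbidden mass than mass. Carrying the whole series along avoids a reduction
    to finitely many cylinders. *)
Lemma weighted_koenig (om : nat -> nat -> T) (lev : nat -> nat) (q : R) :
  (forall j, (0 < #|B j|)%N) -> (q < 1)%R ->
  (forall n, (\sum_(i < n) (W (lev i))^-1 <= q)%R) ->
  exists p : nat -> T, (forall j, p j \in B j) /\
    forall i, exists2 j, (j < lev i)%N & p j <> om i j.
Proof.
move=> Bpos q1 hq.
have Wpos n : (0 < W n)%R.
  by apply: prodr_gt0 => j _; rewrite ltr0n.
have [t0 _] := card_gt0P (Bpos 0%N).
pose inside (p : nat -> T) m i := (m <= lev i)%N && [forall j : 'I_m, p j == om i j].
pose term p m i : \bar R := if inside p m i then ((W (lev i))^-1)%:E else 0.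
have term_ge0 p m i : 0 <= term p m i.
  by rewrite /term; case: ifP => // _; rewrite lee_fin invr_ge0 ltW.
(* Forbidden mass inside the cylinder of [p] at level [m]. The invariant [S p m < (W m)^-1] must be
   strict: a forbidden cylinder equal to that of [p] would alone contribute [(W m)^-1]. *)
pose S p m := \sum_(0 <= i <oo) term p m i.
pose upd (p : nat -> T) m t j := if j == m then t else p j.
have step p m : S p m < ((W m)^-1)%:E ->
    exists t, (t \in B m) && (S (upd p m t) m.+1 < ((W m.+1)^-1)%:E).
  move=> hS; apply/existsP; apply: contraT; rewrite negb_exists => /forallP h.
  have {}h t : t \in B m -> ((W m.+1)^-1)%:E <= S (upd p m t) m.+1.
    by move=> tB; have := h t; rewrite tB /= -leNgt.
  move: hS; rewrite ltNge => /negP[].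
  apply: (@le_trans _ _ (\sum_(t in B m) S (upd p m t) m.+1)).
    apply: (@le_trans _ _ (\sum_(t in B m) ((W m.+1)^-1)%:E)); last exact: lee_sum.
    rewrite sumEFin lee_fin sumr_const /W big_ord_recr /= invfM -[(_ *+ _)%R]mulr_natr -mulrA.
    by rewrite mulVf ?mulr1 // pnatr_eq0 -lt0n.
  rewrite /S -nneseries_sum //; apply: lee_nneseries => [i _ _|i _].
    exact: sume_ge0.
  have [->|ti] := eqVneq (\sum_(t in B m) term (upd p m t) m.+1 i) 0 => //.
  have hin t : inside (upd p m t) m.+1 i -> inside p m i && (t == om i m).
    move=> /andP[mi /forallP hj]; apply/andP; split.
      rewrite /inside (ltnW mi); apply/forallP => j.
      by have := hj (widen_ord (leqnSn m) j); rewrite /upd /= ltn_eqF.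
    by have := hj ord_max; rewrite /upd /= eqxx.
  apply: (@le_trans _ _ (term (upd p m (om i m)) m.+1 i)).
    rewrite [leLHS]big_mkcond (bigD1 (om i m)) //= big1 ?adde0.
      by case: ifP.
    move=> t ht; case: ifP => // _; rewrite /term; case: ifP => // /hin.
    by rewrite (negbTE ht) andbF.
  rewrite /term; case: ifP => [/hin/andP[-> _]//|_].
  by case: ifP => // _; rewrite lee_fin invr_ge0 ltW.
pose nxt p m := odflt t0 [pick t | (t \in B m) && (S (upd p m t) m.+1 < ((W m.+1)^-1)%:E)].
have nxtP p m : S p m < ((W m)^-1)%:E ->
    (nxt p m \in B m) && (S (upd p m (nxt p m)) m.+1 < ((W m.+1)^-1)%:E).
  move=> /step[t ht]; rewrite /nxt; case: pickP => [//|/(_ t)]; by rewrite ht.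
pose F := fix F m := if m is m'.+1 then upd (F m') m' (nxt (F m') m') else fun=> t0.
have FS m : S (F m) m < ((W m)^-1)%:E.
  elim: m => [|m IH]; last by have /andP[] := nxtP _ _ IH.
  rewrite /W big_ord0 invr1; apply: (@le_lt_trans _ _ q%:E); last by rewrite lte_fin.
  apply: lime_le; first by apply: is_cvg_nneseries => *; exact: term_ge0.
  apply: nearW => n; rewrite big_mkord.
  apply: le_trans (_ : (\sum_(i < n) (W (lev i))^-1)%:E <= _); last by rewrite lee_fin.
  rewrite -sumEFin; apply: lee_sum => i _; rewrite /term; case: ifP => // _.
  by rewrite lee_fin invr_ge0 ltW.
have Fagree m n j : (j < m)%N -> (m <= n)%N -> F n j = F m j.
  move=> jm; elim: n => [|n IH]; first by rewrite leqn0 => /eqP ->.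
  rewrite leq_eqVlt => /orP[/eqP ->//|]; rewrite ltnS => mn.
  by rewrite /= {1}/upd ltn_eqF ?IH // (leq_trans jm).
exists (fun j => F j.+1 j); split => [j|i].
  by rewrite /= /upd eqxx; have /andP[] := nxtP _ _ (FS j).
apply: contrapT => hno.
have hin : inside (F (lev i)) (lev i) i.
  rewrite /inside leqnn; apply/forallP => -[j ji] /=; apply/eqP.
  rewrite (Fagree j.+1) //; apply: contrapT => e; apply: hno.
  by exists j.
have := FS (lev i); rewrite ltNge => /negP[].
have : term (F (lev i)) (lev i) i = ((W (lev i))^-1)%:E by rewrite /term hin.
move=> <-; apply: le_trans (nneseries_lim_ge i.+1 _); last by move=> *; exact: term_ge0.
by rewrite big_nat_recr //= leeDr // sume_ge0.
Qed.

End WeightedKoenig.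

Lemma exprn_small (R : realType) (th e : R) :
  0 <= th < 1 -> 0 < e -> exists k, th ^+ k < e.
Proof.
move=> /andP[th0 th1] e0.
have h : `|th| < 1 by rewrite ger0_norm.
have /cvgrPdist_lt/(_ _ e0)[k _ /(_ k (leqnn k))] := cvg_expr h.
by rewrite /= sub0r normrN ger0_norm ?exprn_ge0 // => ?; exists k.
Qed.

Lemma powR_gt_inj (R : realType) (x y t : R) :
  0 <= x -> 0 <= y -> 0 < t -> x `^ t < y `^ t -> x < y.
Proof.
move=> x0 y0 t0; apply: contraTT; rewrite -!leNgt => yx.
by rewrite ge0_ler_powR ?nnegrE // ltW.
Qed.

Lemma geometric_powR_small (R : realType) (th c t d : R) :
  0 < th < 1 -> 0 < c -> 0 < t -> 0 < d -> exists k, (c * th ^+ k) `^ t <= d.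
Proof.
move=> /andP[th0 th1] c0 t0 d0.
have [|k hk] := @exprn_small R th (d `^ t^-1 / c) _ (divr_gt0 (powR_gt0 _ d0) c0).
  by rewrite ltW.
exists k; move: hk; rewrite ltr_pdivlMr // mulrC => h.
have -> : d = (d `^ t^-1) `^ t by rewrite -powRrM mulVf ?lt0r_neq0 // powRr1 // ltW.
by rewrite ge0_ler_powR ?nnegrE ?powR_ge0 ?mulr_ge0 ?exprn_ge0 // ltW.
Qed.

Lemma sum_half (R : realType) n : \sum_(i < n) (2^-1 : R) ^+ i.+1 <= 1.
Proof.
have -> : \sum_(i < n) (2^-1 : R) ^+ i.+1 = 1 - 2^-1 ^+ n.
  elim: n => [|n IH]; first by rewrite big_ord0 expr0 subrr.
  by rewrite big_ord_recr /= IH !exprS; field.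
by rewrite gerBl exprn_ge0.
Qed.

(* A mass distribution principle: the uniform mass on the branches gives a
   cylinder of level [k] mass at most [(th ^+ k) `^ t / c2]. *)
Lemma tree_cover (R : realType) (T : finType) (B : nat -> {set T})
    (G : (nat -> T) -> R) (th c1 c2 t : R) :
  0 < th < 1 -> 0 < c1 -> 0 < c2 -> 0 < t ->
  (forall k, (0 < #|B k|)%N) ->
  (forall k, c2 <= \prod_(i < k) #|B i|%:R * (th ^+ k) `^ t) ->
  (forall p p' k, (forall i, p i \in B i) -> (forall i, p' i \in B i) ->
     (forall i, (i < k)%N -> p i = p' i) -> p k <> p' k ->
     c1 * th ^+ k <= `|G p - G p'|) ->
  exists2 c : R, 0 < c & forall (U : nat -> set R) (d : nat -> R) (M : R),
    (forall k, 0 <= d k) ->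
    (forall k x y, U k x -> U k y -> `|x - y| <= d k) ->
    (forall p, (forall i, p i \in B i) -> exists k, U k (G p)) ->
    (forall n, \sum_(k < n) d k `^ t <= M) -> c <= M.
Proof.
move=> th01 c10 c20 t0 Bpos hW hG; have /andP[th0 th1] := th01.
exists (c1 `^ t * c2); first by rewrite mulr_gt0 ?powR_gt0.
move=> U d M d0 hU cov hM; set c := c1 `^ t * c2; rewrite leNgt; apply/negP => Mc.
have c0 : 0 < c by rewrite mulr_gt0 ?powR_gt0.
have sg0 : 0 < (c - M) / 2 by rewrite divr_gt0 // subr_gt0.
(* The padding, of total at most [(c - M) / 2], makes every size positive, so that a level exists
   even when [d i = 0], and makes the comparison with [d i] strict. *)
pose del i := d i `^ t + (c - M) / 2 * 2^-1 ^+ i.+1.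
have del_gt i : d i `^ t < del i by rewrite ltrDl mulr_gt0 // exprn_gt0 // invr_gt0.
have del0 i : 0 < del i by apply: le_lt_trans (del_gt i); exact: powR_ge0.
(* The first level whose separation scale does not exceed the padded size. Branches that part
   earlier have images too far apart to lie both in [U i], so [U i] meets the image of at most one
   cylinder of this level. *)
have ex_lev i : exists k, ((c1 * th ^+ k) `^ t <= del i) &&
    [forall j : 'I_k, del i < (c1 * th ^+ j) `^ t].
  case: (ex_minnP (geometric_powR_small th01 c10 t0 (del0 i))) => k hk kmin.
  exists k; rewrite hk; apply/forallP => j; rewrite ltNge; apply/negP => /kmin.
  by rewrite leqNgt ltn_ord.
pose lev i := xchoose (ex_lev i).
have levP i : (c1 * th ^+ lev i) `^ t <= del i by have /andP[] := xchooseP (ex_lev i).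
have levj i j : (j < lev i)%N -> del i < (c1 * th ^+ j) `^ t.
  by move=> ji; have /andP[_ /forallP/(_ (Ordinal ji))] := xchooseP (ex_lev i).
have [p0 p0B] : exists p : nat -> T, forall i, p i \in B i.
  have h i : exists x, x \in B i by apply/card_gt0P.
  by exists (fun i => xchoose (h i)) => i; exact: xchooseP.
(* [p0] is a dummy for the members of the cover that contain no image of a branch. *)
have /choice[om omP] i : exists p : nat -> T,
    (exists2 p', (forall j, p' j \in B j) & U i (G p')) ->
    (forall j, p j \in B j) /\ U i (G p).
  have [[p hp1 hp2]|no] := pselect (exists2 p', (forall j, p' j \in B j) & U i (G p')).
    by exists p.
  by exists p0 => /no.
have Wpos n : 0 < \prod_(j < n) #|B j|%:R :> R.
  by apply: prodr_gt0 => j _; rewrite ltr0n.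
have wbound i : (\prod_(j < lev i) #|B j|%:R)^-1 <= del i / c.
  rewrite ler_pdivlMr // mulrC ler_pdivrMr //.
  have hk : (c1 * th ^+ lev i) `^ t = c1 `^ t * (th ^+ lev i) `^ t.
    by rewrite powRM ?exprn_ge0 ?ltW.
  have := levP i; rewrite hk => h.
  have h2 := hW (lev i).
  have h3 := ler_wpM2l (powR_ge0 c1 t) h2.
  have h4 := ler_wpM2r (ltW (Wpos (lev i))) h.
  apply: le_trans h3 _; apply: le_trans h4.
  by rewrite mulrA mulrAC.
have q1 : (M + (c - M) / 2) / c < 1 by rewrite ltr_pdivrMr // mul1r; lra.
have [|p [pB pom]] := @weighted_koenig R T B om lev _ Bpos q1.
  move=> n; rewrite ler_pdivlMr // mulr_suml.
  apply: (@le_trans _ _ (\sum_(i < n) del i)).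
    by apply: ler_sum => i _; rewrite -ler_pdivlMr.
  rewrite big_split /= lerD ?hM // -mulr_sumr.
  by rewrite ler_piMr ?(ltW sg0) ?sum_half.
have [i Ui] := cov p pB.
have [|omB Uom] := omP i; first by exists p.
have [j ji pj] := pom i.
have [k [pk kmin]] : exists k, p k != om i k /\ forall j, p j != om i j -> (k <= j)%N.
  have : exists k, p k != om i k by exists j; apply/eqP.
  by case/ex_minnP => k hk kmin; exists k.
have kj : (k < lev i)%N by apply: leq_ltn_trans (kmin j _) ji; apply/eqP.
have := hG p (om i) k pB omB; move=> /(_ _ (elimN eqP pk)).
rewrite leNgt => /(_ _)/negP[].
  by move=> l lk; apply/eqP; apply: contraT => /kmin; rewrite leqNgt lk.
apply: le_lt_trans (hU _ _ _ Ui Uom) _.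
apply: (@powR_gt_inj _ _ _ t) => //; first by rewrite mulr_ge0 ?exprn_ge0 ?ltW.
exact: lt_trans (del_gt i) (levj _ _ kj).
Qed.

(** * Distances to the points of a tree in [K] *)

Section DistanceTree.
Context (R : realType) (K : set R[i]).
Implicit Types (x y z : R[i]).

Definition bounded_by (L : R) := forall x y, K x -> K y -> normc (x - y) <= L.

(** Sequential compactness stated with cluster points, so that no subsequence has to be
    extracted. *)
Definition clustering := forall s : nat -> R[i], (forall n, K (s n)) ->
  exists2 x, K x & forall e : R, 0 < e -> forall n,
    exists2 m, (n <= m)%N & normc (s m - x) < e.

Definition covers_distances (U : nat -> set R) :=
  forall x y, K x -> K y -> exists k, U k (normc (x - y)).

(* Sums of series are bounded through their partial sums, within [R]. *)
Definition distance_content (t : R) :=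
  exists2 c : R, 0 < c & forall (U : nat -> set R) (d : nat -> R) (M : R),
    (forall k, 0 <= d k) ->
    (forall k (u u' : R), U k u -> U k u' -> `|u - u'| <= d k) ->
    covers_distances U ->
    (forall n, \sum_(k < n) d k `^ t <= M) -> c <= M.

Lemma clustering_closed : clustering -> forall x,
  (forall e : R, 0 < e -> exists2 y, K y & normc (y - x) < e) -> K x.
Proof.
move=> cl x hx.
have /choice[s hs] n : exists y, K y /\ normc (y - x) < n.+1%:R^-1.
  by have [|y Ky hy] := hx n.+1%:R^-1; [rewrite invr_gt0|exists y].
have [x' Kx' hx'] := cl s (fun n => (hs n).1).
suff -> : x = x' by [].
apply/eqP; rewrite -subr_eq0 -normc_eq0 eq_le normc_ge0 andbT leNgt; apply/negP => p.
have h2 : 0 < normc (x - x') / 2 by rewrite divr_gt0.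
have [k hk] : exists k, k.+1%:R^-1 < normc (x - x') / 2.
  exists (Num.truncn (normc (x - x') / 2)^-1).
  by rewrite invf_plt ?posrE // truncnS_gt.
have [m km hm] := hx' _ h2 k.
have h3 : normc (s m - x) < normc (x - x') / 2.
  apply: lt_trans ((hs m).2) _; apply: le_lt_trans hk.
  by rewrite lef_pV2 ?posrE // ler_nat ltnS.
have := normc_trans (s m) x x'; rewrite (normcB x (s m)); lra.
Qed.

Lemma sqr_dist_diff x x' y :
  normc (x - y) ^+ 2 - normc (x' - y) ^+ 2 = proj (x + x' - 2%:R * y) (x - x').
Proof. by rewrite !sqr_normc projE !ReImE; ring. Qed.

Section Branches.
Context (I : finType) (a : R[i]) (c : I -> R[i]).
Implicit Type p : nat -> I.

Definition branch_shift p k := \sum_(j < k) a ^+ j * c (p j).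

Lemma branch_in p k z : (forall i x, K x -> K (a * x + c i)) -> K z ->
  K (a ^+ k * z + branch_shift p k).
Proof.
move=> hK Kz; elim: k p => [|k IH] p.
  by rewrite /branch_shift big_ord0 expr0 mul1r addr0.
rewrite /branch_shift big_ord_recl /= expr0 mul1r.
have -> : a ^+ k.+1 * z + (c (p 0%N) + \sum_(i < k) a ^+ bump 0 i * c (p (bump 0 i))) =
   a * (a ^+ k * z + branch_shift (fun j => p j.+1) k) + c (p 0%N).
  rewrite mulrDr /branch_shift mulr_sumr exprS mulrA addrAC addrA; congr (_ + _ + _).
  by apply: eq_bigr => j _; rewrite /bump /= add1n exprS mulrA.
by apply: hK; exact: IH.
Qed.

Lemma branch_shiftD p k m :
  branch_shift p (k + m) = branch_shift p k + a ^+ k * branch_shift (fun j => p (k + j)%N) m.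
Proof.
rewrite /branch_shift big_split_ord /=; congr (_ + _).
by rewrite mulr_sumr; apply: eq_bigr => j _; rewrite exprD mulrA.
Qed.

(** The finite words applied to [z] cluster at [X], and after undoing [k] maps the tails come
    arbitrarily close to [P], which lies in the closed set [K]. A tail in [K] at every level allows
    two branches to be compared at the level where they part. *)
Lemma branch_point p z : clustering -> a != 0 ->
  (forall i x, K x -> K (a * x + c i)) -> K z ->
  exists X, forall k, exists2 P, K P & X = a ^+ k * P + branch_shift p k.
Proof.
move=> cl a0 hK Kz.
have [X _ hX] := cl _ (fun n => branch_in p n hK Kz).
exists X => k; exists ((X - branch_shift p k) / a ^+ k); last first.
  by rewrite mulrC divfK ?expf_neq0 // subrK.
apply: clustering_closed => // e e0.
have ak : 0 < normc (a ^+ k) by rewrite normc_gt0 expf_neq0.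
have [m km hm] := hX _ (mulr_gt0 e0 ak) k.
exists (a ^+ (m - k) * z + branch_shift (fun j => p (k + j)%N) (m - k)).
  exact: branch_in.
rewrite -(ltr_pM2r ak) -normcM; apply: le_lt_trans hm.
rewrite le_eqVlt; apply/orP; left; apply/eqP; congr normc.
rewrite mulrBl divfK ?expf_neq0 // -{3 4}(subnKC km) branch_shiftD exprD; ring.
Qed.

End Branches.

(** The map with coefficients [b] and [h] gives a copy of [K] inside [K] on which [x + x' - 2 y]
    stays within [eta] of [E]. Pulling [E] back to [K] gives [tau * e0]; pulling it back along [k]
    maps of the tree turns it to [v ^+ k * e0], hence the direction imposed on the digits of level
    [k]. The last hypothesis keeps the error below half of the main term. *)
Lemma tree_distance (I : finType) (a v : R[i]) (c : I -> R[i]) (rho L t c2 : R)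
    (B : nat -> {set I}) (z e0 b h y E : R[i]) (tau eta : R) :
  clustering -> bounded_by L -> 0 < L ->
  normc v = 1 -> conjc a = real_complex R rho * v -> 0 < rho < 1 ->
  (forall i x, K x -> K (a * x + c i)) ->
  K z ->
  (forall k, (0 < #|B k|)%N) ->
  0 < t -> 0 < c2 ->
  (forall k, c2 <= \prod_(i < k) #|B i|%:R * (rho ^+ k) `^ t) ->
  (forall k i j, i \in B k -> j \in B k -> i != j ->
     (2 * L + 1) * rho < `|proj (v ^+ k * e0) (a * z + c i) - proj (v ^+ k * e0) (a * z + c j)|) ->
  normc e0 = 1 ->
  (forall x, K x -> K (b * x + h)) -> K y ->
  conjc b * E = real_complex R tau * e0 -> 0 < tau ->
  (forall x x', K x -> K x' ->
     normc ((b * x + h) + (b * x' + h) - 2%:R * y - E) <= eta) ->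
  2 * (eta * normc b * L) <= tau * rho ->
  distance_content t.
Proof.
move=> cl bL L0 v1 av /andP[r0 r1] hK Kz Bpos t0 c20 hW hsep e1 hb Ky hE tau0 heta hsmall.
have na : normc a = rho.
  by rewrite -normcJ av normcM v1 mulr1 normc_real ger0_norm ?ltW.
have a0 : a != 0 by rewrite -normc_gt0 na.
have /choice[X hX] p := branch_point p cl a0 hK Kz.
pose G p := normc (b * X p + h - y).
have XK p : K (X p).
  by have [P KP ->] := hX p 0%N; exact: branch_in.
(* In [4 * L], a factor 2 pays for the error term, and [2 * L] bounds the sum of two distances when
   the difference of squares is factored. *)
have [|||c' c'0 hc'] := @tree_cover R I B G rho (tau * rho / (4 * L)) c2 t _ _ c20 t0 Bpos hW.
- by rewrite r0.
- by rewrite divr_gt0 ?mulr_gt0.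
- move=> p p' k pB p'B agree pk.
  have [P KP eP] := hX p k.+1; have [P' KP' eP'] := hX p' k.+1.
  have shE : branch_shift a c p k = branch_shift a c p' k.
    by apply: eq_bigr => j _; rewrite agree.
  pose q := a * P + c (p k); pose q' := a * P' + c (p' k).
  have dX : X p - X p' = a ^+ k * (q - q').
    rewrite eP eP' /branch_shift !big_ord_recr /= -!/(branch_shift a c _ k) shE exprSr.
    by rewrite /q /q'; ring.
  have akE : conjc (a ^+ k) = real_complex R (rho ^+ k) * v ^+ k.
    by rewrite !rmorphXn /= av exprMn.
  have projk : proj e0 (X p - X p') = rho ^+ k * proj (v ^+ k * e0) (q - q').
    by rewrite dX projM akE !projE !ReImE /=; ring.
  (* The digits are separated at the base point [z]; replacing [z] by the tails [P] and [P'] costs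
     at most [2 * L * rho] of the gap [(2 * L + 1) * rho]. *)
  have hq : rho <= `|proj (v ^+ k * e0) (q - q')|.
    have pk' : p k != p' k by apply/eqP.
    have := hsep k _ _ (pB k) (p'B k) pk'; set f := v ^+ k * e0.
    have f1 : normc f = 1 by rewrite normcM normcX v1 expr1n e1 mulr1.
    have hz Q : K Q -> `|proj f (a * (z - Q))| <= rho * L.
      move=> KQ; apply: le_trans (normr_proj_le _ _) _.
      by rewrite f1 mul1r normcM na ler_wpM2l ?bL // ltW.
    have -> : proj f (a * z + c (p k)) - proj f (a * z + c (p' k)) =
       proj f (q - q') + (proj f (a * (z - P)) - proj f (a * (z - P'))).
      by rewrite -!projB -projD; congr proj; rewrite /q /q'; ring.
    have := hz _ KP; have := hz _ KP'.
    move: (proj f (q - q')) (proj f (a * (z - P))) (proj f (a * (z - P'))) => A1 A2 A3.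
    have := ler_normD A1 (A2 - A3); have := ler_normB A2 A3; lra.
  pose x := b * X p + h; pose x' := b * X p' + h.
  have hx y' : K y' -> K (b * y' + h) by exact: hb.
  have gx : 0 <= normc (x - y) <= L by rewrite normc_ge0 bL //; apply: hb.
  have gx' : 0 <= normc (x' - y) <= L by rewrite normc_ge0 bL //; apply: hb.
  have rk : 0 < rho ^+ k by rewrite exprn_gt0.
  have main : tau * rho * rho ^+ k <= 2 * `|normc (x - y) ^+ 2 - normc (x' - y) ^+ 2|.
    rewrite sqr_dist_diff.
    have -> : proj (x + x' - 2%:R * y) (x - x') =
       tau * proj e0 (X p - X p') + proj (x + x' - 2%:R * y - E) (b * (X p - X p')).
      have -> : tau * proj e0 (X p - X p') = proj E (b * (X p - X p')).
        by rewrite projM hE !projE !ReImE /=; ring.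
      have -> : x - x' = b * (X p - X p') by rewrite /x /x'; ring.
      by rewrite !projE !ReImE; ring.
    have h2 : `|proj (x + x' - 2%:R * y - E) (b * (X p - X p'))| <= eta * normc b * L * rho ^+ k.
      apply: le_trans (normr_proj_le _ _) _; rewrite normcM dX normcM normcX na.
      rewrite (_ : eta * _ * _ * _ = eta * (normc b * (rho ^+ k * L))); last by ring.
      apply: ler_pM; rewrite ?normc_ge0 ?heta //.
        by rewrite !mulr_ge0 ?normc_ge0 ?(ltW rk).
      rewrite ler_wpM2l ?normc_ge0 // ler_wpM2l ?(ltW rk) //.
      by apply: bL; apply: hK.
    have h1 : tau * rho * rho ^+ k <= `|tau * proj e0 (X p - X p')|.
      rewrite projk normrM (ger0_norm (ltW tau0)) normrM (ger0_norm (ltW rk)).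
      by rewrite -mulrA ler_wpM2l ?(ltW tau0) // mulrC ler_wpM2l ?(ltW rk).
    have h3 := ler_wpM2r (ltW rk) hsmall.
    move: h1 h2; move: (tau * proj e0 _) (proj (_ - _ - _) _) => A1 A2 h1 h2.
    have := lerB_normD A1 A2; lra.
  have fac : normc (x - y) ^+ 2 - normc (x' - y) ^+ 2 =
     (G p - G p') * (normc (x - y) + normc (x' - y)) by rewrite /G -/x -/x'; ring.
  move: main; rewrite fac normrM (ger0_norm (_ : 0 <= normc (x - y) + normc (x' - y))); last first.
    by case/andP: gx; case/andP: gx'; lra.
  move=> main; rewrite mulrAC ler_pdivrMr ?mulr_gt0 //.
  apply: le_trans main _.
  have : `|G p - G p'| * (normc (x - y) + normc (x' - y)) <= `|G p - G p'| * (2 * L).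
    by rewrite ler_wpM2l //; case/andP: gx; case/andP: gx'; lra.
  lra.
exists c' => // U d M d0 Ud cov hM; apply: (hc' U d M) => // p pB.
by apply: cov => //; apply: hb.
Qed.

End DistanceTree.

(** * Rotations and averaging over arcs *)

Section Rotations.
Context (R : realType).
Implicit Types (v e : R[i]).

Lemma truncn_eq_dist (x y : R) : 0 <= x -> 0 <= y ->
  Num.truncn x = Num.truncn y -> `|x - y| <= 1.
Proof.
move=> /truncn_itv /andP[x1 x2] /truncn_itv /andP[y1 y2] h.
rewrite h in x1 x2; rewrite -natr1 in x2; rewrite -natr1 in y2.
by rewrite ler_norml; apply/andP; split; lra.
Qed.

(** Pigeonhole on a grid of squares of side [eta / 2]: two powers of [v] in one square differ by at
    most [eta], and their quotient is the power sought. *)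
Lemma rotation_return v (eta : R) : normc v = 1 -> 0 < eta ->
  exists2 m, (0 < m)%N & normc (v ^+ m - 1) <= eta.
Proof.
move=> v1 eta0.
pose s := 2 / eta; have s0 : 0 < s by rewrite divr_gt0.
pose g := Num.truncn (2 * s).
pose cell x : 'I_g.+1 := inord (Num.truncn ((x + 1) * s)).
have vR k : -1 <= Re (v ^+ k) <= 1 /\ -1 <= Im (v ^+ k) <= 1.
  have := normRe_le (v ^+ k); have := normIm_le (v ^+ k).
  by rewrite normcX v1 expr1n !ler_norml.
have cellP x y : -1 <= x <= 1 -> -1 <= y <= 1 -> cell x = cell y -> `|x - y| <= eta / 2.
  move=> /andP[x1 x2] /andP[y1 y2] /(congr1 val).
  have bnd w : -1 <= w -> w <= 1 -> (Num.truncn ((w + 1) * s) < g.+1)%N.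
    by move=> w1 w2; rewrite ltnS; apply: le_truncn; rewrite ler_wpM2r ?(ltW s0) //; lra.
  rewrite /= !inordK ?bnd // => /truncn_eq_dist.
  have hw w : -1 <= w -> 0 <= (w + 1) * s by move=> ?; rewrite mulr_ge0 ?(ltW s0) //; lra.
  move=> /(_ (hw _ x1) (hw _ y1)).
  rewrite -mulrBl opprD addrACA subrr addr0 normrM (gtr0_norm s0) -ler_pdivlMr //.
  by rewrite /s invf_div mul1r.
pose f (k : 'I_(#|{: 'I_g.+1 * 'I_g.+1}|).+1) := (cell (Re (v ^+ k)), cell (Im (v ^+ k))).
have /injectivePn[j [k jk [e1 e2]]] : ~~ injectiveb f.
  by apply/injectiveP => /leq_card; rewrite card_ord ltnn.
wlog lt : j k jk e1 e2 / (j < k)%N.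
  move=> H; have [h|h|h] := ltngtP j k; first exact: (H j k).
    by apply: (H k j) => //; rewrite eq_sym.
  by case/eqP: jk; exact: val_inj.
exists (k - j)%N; first by rewrite subn_gt0.
have -> : normc (v ^+ (k - j) - 1) = normc (v ^+ k - v ^+ j).
  rewrite -{2}(subnK (ltnW lt)) exprD -{2}[v ^+ j]mul1r -mulrBl normcM.
  by rewrite normcX v1 expr1n mulr1.
apply: le_trans (normc_le_ReIm _) _; rewrite ReD ReN ImD ImN.
have [hj1 hj2] := vR j; have [hk1 hk2] := vR k.
have := cellP _ _ hk1 hj1 (esym e1); have := cellP _ _ hk2 hj2 (esym e2); lra.
Qed.

Lemma small_rotation (beta : R) : 0 < beta <= 1 ->
  exists2 v, normc v = 1 & normc (v - 1) = beta.
Proof.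
move=> /andP[b0 b1]; pose s := Num.sqrt (1 - beta ^+ 2 / 4).
have bb : beta ^+ 2 <= 1 by rewrite expr_le1 // ltW.
have hs : s ^+ 2 = 1 - beta ^+ 2 / 4 by rewrite sqr_sqrtr //; lra.
exists (Complex (1 - beta ^+ 2 / 2) (beta * s)).
  apply/eqP; rewrite -(@eqrXn2 _ 2) ?normc_ge0 // expr1n sqr_normc /=.
  by rewrite exprMn hs; apply/eqP; field.
apply/eqP; rewrite -(@eqrXn2 _ 2) ?normc_ge0 ?ltW // sqr_normc !ReImE /=.
by rewrite subr0 exprMn hs; apply/eqP; field.
Qed.

Lemma expn2_dominates (C : R) : exists n0, forall n, (n0 <= n)%N -> 2 + C * n%:R <= 2 ^+ n.
Proof.
exists (4 * (Num.truncn `|C|).+2)%N => n hn.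
have hC : C + 1 <= n%:R / 4.
  rewrite ler_pdivlMr // mulrC.
  apply: le_trans (_ : (4 * (Num.truncn `|C|).+2)%:R <= _); last by rewrite ler_nat.
  rewrite natrM ler_pM2l // -natr1 lerD2r ltW //.
  by apply: le_lt_trans (ler_norm C) _; exact: truncnS_gt.
have n2 : 2 <= n%:R :> R by rewrite ler_nat; lia.
have h : n%:R * n%:R <= 4 * 2 ^+ n :> R.
  rewrite -natrX -!natrM ler_nat.
  have := ltn_expl n./2 (isT : (1 < 2)%N); have := odd_double_half n.
  set k := n./2 => hk h2.
  have h3 : (2 ^ (k + k) <= 2 ^ n)%N by rewrite leq_exp2l //; lia.
  rewrite expnD in h3; apply: leq_trans (_ : 4 * (2 ^ k * 2 ^ k) <= _)%N; last by rewrite leq_mul2l.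
  have h4 : (n <= 2 * 2 ^ k)%N by lia.
  have := leq_mul h4 h4; lia.
have : (C + 1) * n%:R <= n%:R / 4 * n%:R by rewrite ler_wpM2r.
lra.
Qed.

(** Poor levels are allowed as long as every window of length [T] is rich as a whole: full windows
    contribute at least 1, and the incomplete last one loses at most [x ^+ T]. *)
Lemma window_weights (b : nat -> nat) (x : R) T : 0 < x <= 1 -> (0 < T)%N ->
  (forall k, (0 < b k)%N) ->
  (forall s, 1 <= \prod_(i < T) (b (s + i)%N)%:R * x ^+ T) ->
  forall k, x ^+ T <= \prod_(i < k) (b i)%:R * x ^+ k.
Proof.
move=> /andP[x0 x1] T0 b0 hw k.
have hq q : 1 <= \prod_(i < q * T) (b i)%:R * x ^+ (q * T).
  elim: q => [|q IH]; first by rewrite mul0n big_ord0 expr0 mulr1.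
  have := ler_pM ler01 ler01 IH (hw (q * T)%N); rewrite mulr1 mulrACA.
  by rewrite -exprD mulSnr big_split_ord.
rewrite (divn_eq k T); set q := (k %/ T)%N; set r := (k %% T)%N.
have rT : (r <= T)%N by rewrite ltnW // ltn_pmod.
rewrite big_split_ord /= exprD mulrACA.
apply: le_trans (_ : 1 * (1 * x ^+ r) <= _).
  by rewrite !mul1r ler_wiXn2l // ltW.
apply: ler_pM (hq q) _ => //; first by rewrite mul1r exprn_ge0 // ltW.
apply: ler_wpM2r; first by rewrite exprn_ge0 // ltW.
by elim/big_ind: _ => // [y z|i _]; [exact: mulr_ege1|rewrite ler1n].
Qed.

Lemma powR_expr (x t : R) k : 0 <= x -> (x ^+ k) `^ t = (x `^ t) ^+ k.
Proof.
move=> x0; elim: k => [|k IH]; first by rewrite !expr0 powR1.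
by rewrite !exprS powRM ?exprn_ge0 // IH.
Qed.

End Rotations.

(** * Choice of the digits, for rotation parts of finite and infinite order *)

Section Digits.
Context (R : realType) (K : set R[i]) (I : finType) (a v : R[i]) (c : I -> R[i]).
Context (rho L t : R) (z : R[i]).
Context (fam : separated_family K a c rho).
Context (cl : clustering K) (bL : bounded_by K L) (L0 : 0 < L) (Kz : K z).
Context (v1 : normc v = 1) (av : conjc a = real_complex R rho * v).
Context (N1 : #|I|%:R * rho <= 1) (t0 : 0 < t) (N2 : 2 <= #|I|%:R * rho `^ t).

Let N : R := #|I|%:R.

Let rho0 : 0 < rho. Proof. by case: fam => _ /andP[]. Qed.
Let rho1 : rho < 1. Proof. by case: fam => _ /andP[]. Qed.
Let N0 : 0 < N.
Proof.
rewrite lt_neqAle ler0n andbT; apply/eqP => h.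
by move: N2; rewrite -/N -h mul0r lern0.
Qed.

Definition close_pairs n e : {set word I n * word I n} :=
  [set p | `|proj e (wordp a c z p.1) - proj e (wordp a c z p.2)| <=
           (2 * (2 * L + 1)) * rho ^+ n].

Definition digits n e (B : {set word I n}) :=
  forall i j, i \in B -> j \in B -> i != j ->
    (2 * L + 1) * rho ^+ n < `|proj e (wordp a c z i) - proj e (wordp a c z j)|.

Lemma digits_exist n e : exists B : {set word I n},
  digits e B /\ N ^+ n * N ^+ n <= #|B|%:R * #|close_pairs n e|%:R.
Proof.
have [|B [hB cB]] := @separated_subset R (word I n) (fun w => proj e (wordp a c z w))
  ((2 * L + 1) * rho ^+ n).
  by rewrite mulr_ge0 ?exprn_ge0 ?(ltW rho0) // addr_ge0 ?mulr_ge0 ?(ltW L0).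
exists B; split => //.
by move: cB; rewrite -(ler_nat R) card_word natrM natrX natrX expr2 mulrA.
Qed.

Lemma close_pairs_gt0 n e : (0 < #|close_pairs n e|)%N.
Proof.
have : (0 < #|word I n|)%N by rewrite card_word expn_gt0 -(ltr0n R) N0.
case/card_gt0P => w _; apply/card_gt0P; exists (w, w); rewrite inE /= subrr normr0.
by rewrite !mulr_ge0 ?exprn_ge0 ?(ltW rho0) // addr_ge0 ?mulr_ge0 ?(ltW L0).
Qed.

(** With at least [N ^+ n] directions on an arc of length between [kap] and 1/8, a direction has on
    average O(n) close pairs per word, the diagonal included. *)
Lemma sum_close_pairs_arc n J (w e : R[i]) (kap : R) :
  normc w = 1 -> w != 1 -> normc e = 1 -> 0 < kap ->
  J%:R * normc (w - 1) <= 1 / 8 -> kap <= J%:R * normc (w - 1) -> N ^+ n <= J%:R ->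
  \sum_(j < J) #|close_pairs n (w ^+ j * e)|%:R <=
    J%:R * (N ^+ n * (2 + (8 * (2 * L + 1) / (kap * rho)) * n%:R)).
Proof.
move=> w1 wn1 e1 k0 hJ hk hN.
have D0 : 0 <= 2 * (2 * L + 1) by rewrite mulr_ge0 // addr_ge0 ?mulr_ge0 ?(ltW L0).
apply: le_trans (sum_close_pairs fam n Kz N1 D0 w1 wn1 e1 hJ) _.
rewrite -/N [leRHS]mulrCA; apply: ler_wpM2l; first by rewrite exprn_ge0 ?ltW.
rewrite [leRHS]mulrDr; apply: lerD; first by lra.
set b := normc (w - 1) in hJ hk *.
have b0 : 0 < b by rewrite normc_gt0 subr_eq0.
rewrite [leLHS](_ : _ = 8 * (2 * L + 1) * n%:R / rho * b^-1); last first.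
  by field; rewrite !gt_eqF.
rewrite [leRHS](_ : _ = 8 * (2 * L + 1) * n%:R / rho * (J%:R / kap)); last first.
  by field; rewrite !gt_eqF.
apply: ler_wpM2l.
  have := L0; by rewrite divr_ge0 ?(ltW rho0) // mulr_ge0 //; lra.
by rewrite ler_pdivlMr // mulrC ler_pdivrMr.
Qed.

(** In the applications the loss [A] is linear in [n], and [N2] supplies [2 ^+ n] against it. This
    decides the length of the words that serve as digits. *)
Lemma gain n A : 0 < A -> A <= 2 ^+ n -> 1 <= N ^+ n / A * (rho `^ t) ^+ n.
Proof.
move=> A0 An; rewrite mulrAC ler_pdivlMr // mul1r -exprMn.
by apply: le_trans An _; apply: lerXn2r; rewrite ?nnegrE ?mulr_ge0 ?powR_ge0 ?(ltW N0).
Qed.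


(** For [n] a multiple of the order [m] the linear part [a ^+ n] is a positive real, so all levels
    see the same direction and one digit set serves for all. A single good direction near [e1] is
    enough; as a limit direction it is nearly realised by some [x - y], and a small homothetic copy
    of [K] near [x] carries the tree. *)
Lemma homothetic_case (m : nat) (e1 : R[i]) (kap : R) :
  (0 < m)%N -> v ^+ m = 1 -> normc e1 = 1 -> 0 < kap ->
  (forall e, normc e = 1 -> normc (e - e1) <= kap -> forall eta : R, 0 < eta ->
     exists x y, [/\ K x, K y, x != y &
       normc (x - y - real_complex R (normc (x - y)) * e) <= eta * normc (x - y)]) ->
  (forall x (eta : R), K x -> 0 < eta -> exists (b : R) h,
     [/\ 0 < b, forall u, K u -> K (real_complex R b * u + h) &
         forall u, K u -> normc (real_complex R b * u + h - x) <= eta]) ->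
  distance_content K t.
Proof.
move=> m0 vm e11 kap0 hdir hpiece.
(* Length of the arc: it must remain within [kap] of [e1] and be short enough for [arc_count]. *)
pose k' := Num.min kap (1 / 8).
have k'0 : 0 < k' by rewrite lt_min kap0; lra.
have [n0 hn0] := expn2_dominates (8 * (2 * L + 1) / (k' * rho)).
pose n := (m * n0.+1)%N.
have n_gt0 : (0 < n)%N by rewrite muln_gt0 m0.
have nn0 : (n0 <= n)%N by rewrite (leq_trans (leqnSn _)) // leq_pmull.
have {hn0}hA := hn0 n nn0; set A := 2 + _ in hA.
have A0 : 0 < A.
  have l0 : 0 <= 2 * L + 1 by have := L0; lra.
  have p0 : 0 <= k' * rho by rewrite mulr_ge0 ?(ltW rho0) ?(ltW k'0).
  have p1 : 0 <= 8 * (2 * L + 1) / (k' * rho) * n%:R.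
    by apply: mulr_ge0 => //; apply: divr_ge0 => //; apply: mulr_ge0.
  by rewrite /A; lra.
pose J := (#|I| ^ n)%N.
have JN : N ^+ n = J%:R by rewrite /J natrX.
have J0 : 0 < J%:R :> R by rewrite -JN exprn_gt0.
have J1 : 1 <= J%:R :> R by rewrite ler1n -(ltr0n R).
have [|w w1 wb] := @small_rotation R (k' / J%:R).
  rewrite divr_gt0 //= ler_pdivrMr // mul1r; apply: le_trans J1.
  by apply: (@le_trans _ _ (1 / 8)); [rewrite ge_min lexx orbT|lra].
have Jb : J%:R * normc (w - 1) = k' by rewrite wb mulrCA divff ?mulr1 // gt_eqF.
have wn1 : w != 1 by rewrite -subr_eq0 -normc_gt0 wb divr_gt0.
have hsum := @sum_close_pairs_arc n J w e1 k' w1 wn1 e11 k'0.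
rewrite Jb JN lexx in hsum; have {hsum} := hsum _ isT (lexx _).
have -> : k' <= 1 / 8 by rewrite ge_min lexx orbT.
move=> /(_ isT) hsum.
have [j hj] : exists j : 'I_J, #|close_pairs n (w ^+ j * e1)|%:R <= N ^+ n * A.
  apply/existsP; apply: contraT; rewrite negb_exists => /forallP h.
  have : J%:R * (N ^+ n * A) < \sum_(j < J) #|close_pairs n (w ^+ j * e1)|%:R.
    rewrite -{1}(card_ord J) -sum_cst; apply: ltr_sum => [|j _]; last by rewrite ltNge h.
    have J0' : (0 < J)%N by rewrite -(ltr0n R).
    by apply/hasP; exists (Ordinal J0'); rewrite ?mem_index_enum.
  by rewrite JN ltNge hsum.
pose e := w ^+ j * e1.
have e_1 : normc e = 1 by rewrite normcM normcX w1 expr1n mul1r.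
have ee1 : normc (e - e1) <= kap.
  rewrite /e -{2}[e1]mul1r -mulrBl normcM e11 mulr1.
  apply: le_trans (normc_expB1 _ w1) _; apply: (@le_trans _ _ k'); last by rewrite ge_min lexx.
  by rewrite -Jb ler_wpM2r ?normc_ge0 // ler_nat ltnW.
have rn0 : 0 < rho ^+ n by rewrite exprn_gt0.
have rn1 : rho ^+ n < 1 by rewrite exprn_ilt1 ?(ltW rho0) ?rho1 // -lt0n.
have [B [hB cB]] := digits_exist n e.
(* The two points of the copy and twice the deviation of [x - y] from [e] give the error
   [4 * (eta * normc (x - y))], against [tau = 2 * b * normc (x - y)]. This value gives equality in
   the last hypothesis of [tree_distance]. *)
pose eta := rho ^+ n / (4 * L).
have eta0 : 0 < eta by rewrite divr_gt0 ?mulr_gt0.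
have [x [y [Kx Ky xy hxy]]] := hdir e e_1 ee1 eta eta0.
have nxy : 0 < normc (x - y) by rewrite normc_gt0 subr_eq0.
have [b [h [b0 hbK hbx]]] := hpiece x (eta * normc (x - y)) Kx (mulr_gt0 eta0 nxy).
have vn : v ^+ n = 1 by rewrite exprM vm expr1n.
have hNA : N ^+ n / A <= #|B|%:R.
  rewrite ler_pdivrMr // -(ler_pM2l (exprn_gt0 n N0)).
  apply: le_trans cB _; rewrite mulrCA [leRHS]mulrC -/e.
  by rewrite [leRHS]mulrC ler_wpM2l.
have Bw : 1 <= #|B|%:R * (rho `^ t) ^+ n.
  apply: le_trans (gain A0 hA) _.
  by rewrite ler_wpM2r ?exprn_ge0 ?powR_ge0.
apply: (@tree_distance R K (word I n) (a ^+ n) 1 (@wordc R I a c n) (rho ^+ n) L t 1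
  (fun _ => B) z e (real_complex R b) h y
  (real_complex R (2 * normc (x - y)) * e) (2 * b * normc (x - y))
  (4 * (eta * normc (x - y)))) => //.
- exact: normc1.
- by rewrite rmorphXn /= av exprMn vn -rmorphXn.
- by rewrite rn0.
- by move=> i u Ku; exact: (wordp_in fam).
- move=> _; rewrite -(ltr0n R); apply: lt_le_trans hNA.
  by rewrite divr_gt0 // exprn_gt0.
- move=> k; rewrite prodr_const card_ord powR_expr ?(ltW rn0) // powR_expr ?(ltW rho0) //.
  by rewrite -exprMn exprn_ege1.
- by move=> k i1 j1 iB jB ij; rewrite expr1n mul1r; apply: hB.
- by apply: complex_eqP; rewrite !ReImE /=; ring.
- by rewrite !mulr_gt0.
- move=> u u' Ku Ku'.
  have -> : real_complex R b * u + h + (real_complex R b * u' + h) - 2%:R * y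
     - real_complex R (2 * normc (x - y)) * e =
     (real_complex R b * u + h - x) + (real_complex R b * u' + h - x) +
     2%:R * (x - y - real_complex R (normc (x - y)) * e).
    by rewrite rmorphM /= (rmorph_nat (real_complex R) 2); ring.
  have n2 : normc (2%:R : R[i]) = 2.
    by rewrite -(rmorph_nat (real_complex R) 2) normc_real ger0_norm.
  apply: le_trans (le_normcD _ _) _; rewrite normcM n2.
  have := le_normcD (real_complex R b * u + h - x) (real_complex R b * u' + h - x).
  have := hbx u Ku; have := hbx u' Ku'; lra.
- rewrite normc_real (gtr0_norm b0) /eta le_eqVlt; apply/orP; left; apply/eqP.
  by field; rewrite gt_eqF.
Qed.

Lemma sum_residues (F : nat -> R) m J :
  \sum_(i < J * m) F i = \sum_(r < m) \sum_(j < J) F (j * m + r)%N.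
Proof.
elim: J => [|J IH]; first by rewrite big_ord0 big1 // => r _; rewrite big_ord0.
rewrite mulSnr big_split_ord /= IH -big_split /=.
by apply: eq_bigr => r _; rewrite big_ord_recr.
Qed.

(** The digits of level [k] are adapted to the direction [u ^+ k * e0]. Within a residue class
    modulo the return time [m], these directions run along an arc with step [w = u ^+ m], so close
    pairs are few on average over any [J * m] consecutive levels. The inequality of arithmetic and
    geometric means turns this average into a lower bound for the product of the numbers of digits,
    which is all that [tree_distance] needs. *)
Lemma irrational_case (x y : R[i]) :
  (forall m, (0 < m)%N -> v ^+ m != 1) ->
  K x -> K y -> x != y ->
  (forall eta : R, 0 < eta -> exists b h,
     [/\ b != 0, forall u, K u -> K (b * u + h) &
         forall u, K u -> normc (b * u + h - x) <= eta]) ->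
  distance_content K t.
Proof.
move=> vinf Kx Ky xy hpiece.
have k0 : 0 < 1 / 16 :> R by lra.
have [n0 hn0] := expn2_dominates (8 * (2 * L + 1) / (1 / 16 * rho)).
pose n := n0.+1.
have {hn0}hA := hn0 n (leqnSn _); set A := 2 + _ in hA.
have A0 : 0 < A.
  have l0 : 0 <= 2 * L + 1 by have := L0; lra.
  have p0 : 0 <= 1 / 16 * rho by rewrite mulr_ge0 ?(ltW rho0) ?(ltW k0).
  have p1 : 0 <= 8 * (2 * L + 1) / (1 / 16 * rho) * n%:R.
    by apply: mulr_ge0 => //; apply: divr_ge0 => //; apply: mulr_ge0.
  by rewrite /A; lra.
have Nn0 : 0 < N ^+ n by rewrite exprn_gt0.
have rn0 : 0 < rho ^+ n by rewrite exprn_gt0.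
have rn1 : rho ^+ n < 1 by rewrite exprn_ilt1 ?(ltW rho0) ?rho1.
pose u := v ^+ n.
have u1 : normc u = 1 by rewrite normcX v1 expr1n.
(* Small enough for [J], the number of steps on an arc of length 1/8, to be at least [N ^+ n]; the
   added 1 absorbs the rounding in [J]. *)
have [|m m0 wb] := @rotation_return R u (1 / (16 * (N ^+ n + 1))) u1.
  by apply: divr_gt0 => //; apply: mulr_gt0 => //; apply: addr_gt0.
pose w := u ^+ m; rewrite -/w in wb.
have w1 : normc w = 1 by rewrite normcX u1 expr1n.
have wn1 : w != 1 by rewrite /w /u -exprM vinf // muln_gt0.
have b0 : 0 < normc (w - 1) by rewrite normc_gt0 subr_eq0.
set b := normc (w - 1) in wb b0.
have b80 : 0 < 8 * b by rewrite mulr_gt0.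
pose J := Num.truncn (1 / (8 * b)).
have J1 : J%:R * b <= 1 / 8.
  have : J%:R <= 1 / (8 * b) by rewrite truncn_le divr_ge0 // ltW.
  by rewrite ler_pdivlMr ?mulr_gt0 //; lra.
have Nb : (N ^+ n + 1) * b <= 1 / 16.
  have h16 : 0 < 16 * (N ^+ n + 1) by rewrite mulr_gt0 // addr_gt0.
  by move: wb; rewrite ler_pdivlMr //; lra.
have J2 : 1 / 16 <= J%:R * b.
  have : 1 / (8 * b) < J.+1%:R by exact: truncnS_gt.
  have Nnb : 0 <= N ^+ n * b by rewrite mulr_ge0 ?ltW.
  by rewrite ltr_pdivrMr ?mulr_gt0 // -natr1; lra.
have J3 : N ^+ n <= J%:R.
  by rewrite -(ler_pM2r b0); lra.
have J0 : (0 < J)%N by rewrite -(ltr0n R); apply: lt_le_trans J3.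
have /choice[Bf hBf] e := digits_exist n e.
pose x0 := (rho ^+ n) `^ t.
have x0E : x0 = (rho `^ t) ^+ n by rewrite /x0 powR_expr // ltW.
have x00 : 0 < x0 by rewrite powR_gt0.
have x01 : x0 <= 1.
  rewrite x0E exprn_ile1 ?powR_ge0 //.
  have : rho `^ t <= 1 `^ t.
    by apply: ge0_ler_powR; rewrite ?nnegrE ?(ltW t0) ?(ltW rho0) ?(ltW rho1).
  by rewrite powR1.
pose E := 2%:R * (x - y).
have nE : 0 < normc E.
  by rewrite normc_gt0 mulf_neq0 ?subr_eq0 // pnatr_eq0.
have window e0 : normc e0 = 1 -> forall s,
   1 <= \prod_(i < J * m) (#|Bf (u ^+ (s + i) * e0)|)%:R * x0 ^+ (J * m).
  move=> e01 s.
  pose P i := #|close_pairs n (u ^+ (s + i) * e0)|%:R : R.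
  have P0 i : 0 < P i by rewrite ltr0n close_pairs_gt0.
  have T0 : 0 < (J * m)%:R :> R by rewrite ltr0n muln_gt0 J0.
  have sumP : \sum_(i < J * m) P i <= (J * m)%:R * (N ^+ n * A).
    rewrite sum_residues natrM -mulrA mulrCA.
    rewrite (_ : m%:R * _ = \sum_(r < m) (J%:R * (N ^+ n * A))); last first.
      by rewrite sum_cst card_ord.
    apply: ler_sum => r _.
    under eq_bigr => j _.
      rewrite /P addnCA exprD mulnC exprM -/w -mulrA.
      over.
    apply: sum_close_pairs_arc => //.
    by rewrite normcM normcX u1 e01 expr1n mulr1.
  have prodP : \prod_(i < J * m) P i <= (N ^+ n * A) ^+ (J * m).
    have [|h _] := @leif_AGM R 'I_(J * m) predT (fun i => P i); first by move=> i _; exact: ltW.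
    move: h; rewrite /= cardT size_enum_ord => h; apply: le_trans h _.
    apply: lerXn2r; rewrite ?nnegrE.
    - by rewrite divr_ge0 ?(ltW T0) // sumr_ge0 // => i _; exact: ltW.
    - by rewrite mulr_ge0 ?(ltW Nn0) ?(ltW A0).
    - by rewrite ler_pdivrMr // mulrC.
  have prodBP : (N ^+ n * N ^+ n) ^+ (J * m) <=
     \prod_(i < J * m) (#|Bf (u ^+ (s + i) * e0)|)%:R * \prod_(i < J * m) P i.
    rewrite -big_split /= (_ : _ ^+ _ = \prod_(i < J * m) (N ^+ n * N ^+ n)); last first.
      by rewrite prodr_const card_ord.
    apply: ler_prod => i _; rewrite mulr_ge0 ?(ltW Nn0) //=.
    by have [_] := hBf (u ^+ (s + i) * e0).
  have PB0 : 0 <= \prod_(i < J * m) (#|Bf (u ^+ (s + i) * e0)|)%:R :> R.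
    by apply: prodr_ge0.
  have h1 := le_trans prodBP (ler_wpM2l PB0 prodP).
  have h2 : (N ^+ n / A) ^+ (J * m) <= \prod_(i < J * m) (#|Bf (u ^+ (s + i) * e0)|)%:R.
    rewrite expr_div_n ler_pdivrMr ?exprn_gt0 //.
    rewrite -(ler_pM2l (exprn_gt0 (J * m) Nn0)) -exprMn.
    by apply: le_trans h1 _; rewrite exprMn mulrCA.
  apply: le_trans (_ : (N ^+ n / A * x0) ^+ (J * m) <= _).
    by rewrite exprn_ege1 // x0E; exact: gain.
  by rewrite exprMn ler_wpM2r // exprn_ge0 // ltW.
pose eta := normc E * rho ^+ n / (4 * L).
have eta0 : 0 < eta by rewrite divr_gt0 ?mulr_gt0.
have [b' [h [b'0 hbK hbx]]] := hpiece (eta / 2) (divr_gt0 eta0 (ltr0Sn _ _)).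
have nb' : 0 < normc b' by rewrite normc_gt0.
pose tau := normc (conjc b' * E).
have tau0 : 0 < tau by rewrite /tau normcM normcJ mulr_gt0.
have rtau : real_complex R tau != 0.
  by rewrite -normc_eq0 normc_real normr_eq0 gt_eqF.
pose e0 := conjc b' * E / real_complex R tau.
have e01 : normc e0 = 1.
  by rewrite normcM normcV normc_real (gtr0_norm tau0) -/tau divff // gt_eqF.
have Bpos k : (0 < #|Bf (u ^+ k * e0)%R|)%N.
  have [_] := hBf (u ^+ k * e0); case: #|Bf _| => // /(lt_le_trans (mulr_gt0 Nn0 Nn0)).
  by rewrite mul0r ltxx.
apply: (@tree_distance R K (word I n) (a ^+ n) u (@wordc R I a c n) (rho ^+ n) L t
  (x0 ^+ (J * m)) (fun k => Bf (u ^+ k * e0)) z e0 b' h y E tau eta) => //.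
- by rewrite rmorphXn /= av exprMn -rmorphXn.
- by rewrite rn0.
- by move=> i u' Ku; exact: (wordp_in fam).
- by rewrite exprn_gt0.
- move=> k; rewrite powR_expr ?(ltW rn0) //.
  apply: (@window_weights R (fun k => #|Bf (u ^+ k * e0)|)) => //.
  + by rewrite x00.
  + by rewrite muln_gt0 J0.
  + exact: window.
- by move=> k i1 j1 iB jB ij; have [hB _] := hBf (u ^+ k * e0); apply: hB.
- by rewrite /e0 [RHS]mulrCA divff ?mulr1.
- move=> u1' u2' Ku1 Ku2.
  have -> : b' * u1' + h + (b' * u2' + h) - 2%:R * y - E =
     (b' * u1' + h - x) + (b' * u2' + h - x) by rewrite /E; ring.
  apply: le_trans (le_normcD _ _) _.
  by have := hbx _ Ku1; have := hbx _ Ku2; lra.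
- rewrite /tau normcM normcJ.
  have -> : 2 * (eta * normc b' * L) = normc b' * normc E * rho ^+ n / 2.
    by rewrite /eta; field; rewrite gt_eqF.
  have : 0 < normc b' * normc E * rho ^+ n by rewrite !mulr_gt0.
  lra.
Qed.

End Digits.

(** * Words of similitudes *)

Section PolynomialGrowth.
Context (R : realType).

(** Induction on the degree: one square root of [g] pays for one factor [n.+1%:R] by Bernoulli's
    inequality, the other goes to the induction hypothesis. *)
Lemma poly_le_exp D (g : R) : 1 < g ->
  exists2 C, 0 < C & forall n, n.+1%:R ^+ D <= C * g ^+ n.
Proof.
elim: D g => [|D IH] g g1.
  by exists 1 => // n; rewrite expr0 mul1r exprn_ege1 // ltW.
have g0 : 0 < g by apply: lt_trans g1.
have s1 : 1 < Num.sqrt g by rewrite -sqrtr1 ltr_sqrt.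
have [C C0 hC] := IH _ s1.
exists ((1 + (Num.sqrt g - 1)^-1) * C).
  by rewrite mulr_gt0 // addr_gt0 // invr_gt0 subr_gt0.
move=> n; rewrite exprS.
have -> : (1 + (Num.sqrt g - 1)^-1) * C * g ^+ n =
   ((1 + (Num.sqrt g - 1)^-1) * Num.sqrt g ^+ n) * (C * Num.sqrt g ^+ n).
  have -> : g ^+ n = Num.sqrt g ^+ n * Num.sqrt g ^+ n.
    by rewrite -exprMn -expr2 sqr_sqrtr // ltW.
  ring.
apply: ler_pM; rewrite ?exprn_ge0 //.
have sp : 0 < Num.sqrt g - 1 by rewrite subr_gt0.
have bern m : 1 + m%:R * (Num.sqrt g - 1) <= Num.sqrt g ^+ m.
  elim: m => [|m IHm]; first by rewrite mul0r addr0.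
  rewrite exprS -natr1; have := ler_wpM2l (ltW (lt_trans ltr01 s1)) IHm.
  have : 0 <= m%:R * (Num.sqrt g - 1) * (Num.sqrt g - 1).
    by rewrite !mulr_ge0 // ltW.
  lra.
rewrite mulrDl mul1r -natr1 addrC; apply: lerD.
  by apply: le_trans (bern n); rewrite lerDl mulr_ge0 // ltW.
rewrite mulrC ler_pdivlMr //; apply: le_trans (bern n); by rewrite lerDr.
Qed.

Lemma poly_dominated D (C g : R) : 1 < g ->
  exists n0, forall n, (n0 <= n)%N -> C * n.+1%:R ^+ D <= g ^+ n.
Proof.
move=> g1; have [C' C'0 hC'] := poly_le_exp D.+1 g1.
exists (Num.truncn (`|C| * C')) => n hn.
have n1 : 0 < n.+1%:R :> R by [].
rewrite -(ler_pM2r n1) -mulrA -exprSr.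
apply: (@le_trans _ _ (`|C| * (C' * g ^+ n))).
  apply: (@le_trans _ _ (`|C| * n.+1%:R ^+ D.+1)); last by rewrite ler_wpM2l.
  by rewrite ler_wpM2r ?exprn_ge0 // ler_norm.
rewrite mulrA mulrC ler_wpM2l ?exprn_ge0 ?(ltW (lt_trans ltr01 g1)) //.
by apply: ltW; apply: lt_le_trans (truncnS_gt _) _; rewrite ler_nat.
Qed.

End PolynomialGrowth.

(** * Linear parts of words, with reflections *)

Section Similitudes.
Context (R : realType).
Implicit Types (z w : R[i]).

Definition flip (s : bool) z := if s then conjc z else z.

Lemma flipM s z w : flip s (z * w) = flip s z * flip s w.
Proof. by case: s => //=; exact: rmorphM. Qed.

Lemma flipB s z w : flip s (z - w) = flip s z - flip s w.
Proof. by case: s => //=; exact: rmorphB. Qed.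

Lemma flipX s z n : flip s (z ^+ n) = flip s z ^+ n.
Proof. by case: s => //=; exact: rmorphXn. Qed.

Lemma flip_flip s s' z : flip s (flip s' z) = flip (s (+) s') z.
Proof. by case: s s' => [] [] //=; rewrite conjcK. Qed.

Lemma flip_prod s (I : finType) (F : I -> R[i]) :
  flip s (\prod_i F i) = \prod_i flip s (F i).
Proof. by case: s => //=; exact: rmorph_prod. Qed.

Lemma normc_flip s z : normc (flip s z) = normc z.
Proof. by case: s => //=; exact: normcJ. Qed.

Context (q : nat) (al be : 'I_q -> R[i]) (sg : 'I_q -> bool).
Implicit Types (u v : seq 'I_q).

Definition sim j z := al j * flip (sg j) z + be j.

Definition act u z := foldr sim z u.

Definition parity u := foldr (fun j s => sg j (+) s) false u.

Definition lin u : R[i] := foldr (fun j a => al j * flip (sg j) a) 1 u.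

Lemma act_cat u v z : act (u ++ v) z = act u (act v z).
Proof. by rewrite /act foldr_cat. Qed.

Lemma actB u z w : act u z - act u w = lin u * flip (parity u) (z - w).
Proof.
elim: u => [|j u IH] /=; first by rewrite mul1r.
rewrite /sim opprD addrACA subrr addr0 -mulrBr -flipB -/(act u z) -/(act u w) IH.
by rewrite flipM flip_flip mulrA.
Qed.

Lemma actE u z : act u z = lin u * flip (parity u) z + act u 0.
Proof. by rewrite -[LHS](subrK (act u 0)) actB subr0. Qed.

Lemma parity_cat u v : parity (u ++ v) = parity u (+) parity v.
Proof. by elim: u => //= j u ->; rewrite addbA. Qed.

Lemma lin_cat u v : lin (u ++ v) = lin u * flip (parity u) (lin v).
Proof.
elim: u => [|j u IH] /=; first by rewrite mul1r.
by rewrite IH flipM flip_flip mulrA.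
Qed.

Lemma normc_lin u : normc (lin u) = \prod_(j <- u) normc (al j).
Proof.
elim: u => [|j u IH]; first by rewrite big_nil normc1.
by rewrite big_cons /= normcM normc_flip IH.
Qed.

Definition lin_of_type (m : 'I_q * bool -> nat) : R[i] :=
  \prod_p flip p.2 (al p.1) ^+ m p.

(** Reflections do not commute with rotations, but their only effect on the linear part is to
    conjugate the coefficients of the letters that follow. Counting each letter in two versions,
    plain and conjugate, restores commutativity. *)
Lemma lin_type u : exists m : 'I_q * bool -> nat,
  (forall p, (m p <= size u)%N) /\ lin u = lin_of_type m.
Proof.
elim: u => [|j u [m [mu e]]] /=.
  by exists (fun _ => 0%N); split => //; rewrite /lin_of_type big1.
(* If the new first letter [j] reflects, the plain and the conjugate counts are exchanged. *)
pose sw (p : 'I_q * bool) := (p.1, sg j (+) p.2).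
have swK : involutive sw by case=> i s; rewrite /sw /= addbA addbb.
exists (fun p => ((p == (j, false)) + m (sw p))%N); split.
  by move=> p; apply: (leq_add (leq_b1 _)).
rewrite -/(lin u) e /lin_of_type flip_prod.
under [RHS]eq_bigr => p _ do rewrite exprD.
rewrite big_split /=; congr (_ * _).
  rewrite (bigD1 (j, false)) //= eqxx expr1 big1 ?mulr1 // => p /negbTE ->.
  by rewrite expr0.
rewrite (reindex_inj (inv_inj swK)) /=; apply: eq_bigr => p _.
by rewrite flipX flip_flip /= addbA addbb.
Qed.

Definition word_type n : finType := ({ffun 'I_q * bool -> 'I_n.+1} * bool)%type.

Definition type_lin n (T : word_type n) : R[i] := lin_of_type (fun p => T.1 p).

Lemma type_exists n (u : n.-tuple 'I_q) :
  exists T : word_type n, lin u = type_lin T /\ parity u = T.2.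
Proof.
have [m [mu e]] := lin_type u; rewrite size_tuple in mu.
exists ([ffun p => inord (m p)], parity u); split => //.
rewrite e /type_lin /lin_of_type; apply: eq_bigr => p _.
by rewrite /= ffunE inordK // ltnS.
Qed.

Lemma card_type n : #|word_type n| = (n.+1 ^ (q * 2) * 2)%N.
Proof. by rewrite card_prod card_ffun card_prod !card_ord card_bool. Qed.

End Similitudes.

(** * Families of words extracted from positive length *)

Section LengthContent.
Context (R : realType) (K : set R[i]) (d0 h : R).

(** The one-dimensional Hausdorff content of [K] at scale [d0] is at least [h], with series replaced
    by their partial sums. *)
Definition length_content := forall (F : nat -> set R[i]) (d : nat -> R) (M : R),
  (forall k, 0 <= d k <= d0) ->
  (forall k x y, F k x -> F k y -> normc (x - y) <= d k) ->
  (forall x, K x -> exists k, F k x) ->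
  (forall n, \sum_(k < n) d k <= M) -> h <= M.

Lemma sum_nth_le (s : seq R) n : all (fun x => 0 <= x) s ->
  \sum_(k < n) s`_k <= \sum_(x <- s) x.
Proof.
elim: s n => [|x s IH] [|n] /=.
- by rewrite big_nil big_ord0.
- by rewrite big_nil big1 // => k _; rewrite nth_nil.
- by move=> /andP[x0 /(IH 0%N)]; rewrite !big_ord0 big_cons => h0; rewrite addr_ge0.
- move=> /andP[x0 hs]; rewrite big_ord_recl big_cons /= lerD2l.
  exact: IH.
Qed.

Lemma finite_cover (T : finType) (F : T -> set R[i]) (d : T -> R) :
  length_content -> 0 <= d0 ->
  (forall k, 0 <= d k <= d0) ->
  (forall k x y, F k x -> F k y -> normc (x - y) <= d k) ->
  (forall x, K x -> exists k, F k x) -> h <= \sum_k d k.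
Proof.
move=> hc d00 hd hF hcov.
pose s := [seq d i | i <- enum T].
pose G := [seq F i | i <- enum T].
rewrite [leRHS](_ : _ = \sum_(x <- s) x); last by rewrite big_map big_enum.
have nthP k : (k < size (enum T))%N ->
    exists i, s`_k = d i /\ nth (set0 : set R[i])%classic G k = F i.
  move=> hk; have [i0 _] : exists i0 : T, true.
    by case: (enum T) hk => [//|i0 l _]; exists i0.
  by exists (nth i0 (enum T) k); split; rewrite (nth_map i0).
apply: (hc (fun k => nth (set0 : set R[i])%classic G k) (fun k => s`_k)).
- move=> k; have [/nthP[i [-> _]]|hk] := ltnP k (size (enum T)); first exact: hd.
  by rewrite nth_default ?lexx // /s size_map.
- move=> k x y; have [/nthP[i [-> ->]]|hk] := ltnP k (size (enum T)); first exact: hF.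
  by rewrite nth_default // /G size_map.
- move=> x /hcov[i Fx]; exists (index i (enum T)).
  by rewrite (nth_map i) ?index_mem ?mem_enum // nth_index ?mem_enum.
- move=> n; apply: sum_nth_le; apply/allP => _ /mapP[i _ ->].
  by have /andP[] := hd i.
Qed.

End LengthContent.

Section RichTypes.
Context (R : realType) (K : set R[i]) (q : nat).
Context (al be : 'I_q -> R[i]) (sg : 'I_q -> bool) (r L d0 h : R).
Context (r01 : 0 < r < 1) (al_gt0 : forall j, 0 < normc (al j))
  (al_le : forall j, normc (al j) <= r).
Context (K_in : forall j z, K z -> K (sim al be sg j z))
  (K_cov : forall z, K z -> exists j w, K w /\ z = sim al be sg j w).
Context (bL : bounded_by K L) (L0 : 0 < L).

Local Notation act := (act al be sg).
Local Notation lin := (lin al sg).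
Local Notation parity := (parity sg).

Lemma act_in u z : K z -> K (act u z).
Proof. by move=> Kz; elim: u => //= j u IH; apply: K_in. Qed.

Lemma act_cover n z : K z -> exists (u : n.-tuple 'I_q) w, K w /\ z = act u w.
Proof.
elim: n z => [|n IH] z Kz; first by exists [tuple], z.
have [j [w [Kw ->]]] := K_cov Kz; have [u [w' [Kw' ->]]] := IH w Kw.
by exists [tuple of j :: u], w'.
Qed.

Lemma lin_gt0 u : 0 < normc (lin u).
Proof. by rewrite normc_lin; apply: prodr_gt0 => j _. Qed.

Lemma lin_le u : normc (lin u) <= r ^+ size u.
Proof.
elim: u => [|j u IH]; first by rewrite expr0 normc1.
by rewrite /= normcM normc_flip exprS; apply: ler_pM; rewrite ?normc_ge0.
Qed.

Lemma act_diam u z w : K z -> K w -> normc (act u z - act u w) <= normc (lin u) * L.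
Proof.
by move=> Kz Kw; rewrite actB normcM normc_flip ler_wpM2l ?normc_ge0 ?bL.
Qed.

(* Only polynomially many linear parts occur among the words of length [n],
   because the linear part depends on the letter counts alone. *)
Lemma rich_type n : length_content K d0 h -> (3 * L + 2) * r ^+ n <= d0 ->
  exists (T : word_type q n) (B : {set n.-tuple 'I_q}),
  [/\ forall u, u \in B -> lin u = type_lin al T /\ parity u = T.2,
      forall u v z w, u \in B -> v \in B -> u != v -> K z -> K w ->
        normc (type_lin al T) <= normc (act u z - act v w) &
      h <= #|word_type q n|%:R * (#|B|%:R * ((3 * L + 2) * normc (type_lin al T)))].
Proof.
move=> hc hd0.
pose W (T : word_type q n) : {set n.-tuple 'I_q} :=
  [set u : n.-tuple 'I_q | (lin u == type_lin al T) && (parity u == T.2)].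
pose sep (T : word_type q n) (u v : n.-tuple 'I_q) :=
  `[< forall z w, K z -> K w -> normc (type_lin al T) <= normc (act u z - act v w) >].
have sepC T u v : sep T u v = sep T v u.
  by apply/asboolP/asboolP => H z w Kz Kw; rewrite normcB; exact: H.
pose P T (B : {set n.-tuple 'I_q}) := (B \subset W T) &&
  [forall u in B, forall v in B, (u != v) ==> sep T u v].
(* By maximality, every discarded word of type [T] has an image that comes closer than the common
   ratio to the image of a kept one. *)
have exB T : exists B : {set n.-tuple 'I_q}, P T B &&
    [forall u : n.-tuple 'I_q in W T, [exists b in B, (u == b) || ~~ sep T u b]].
  have P0 : P T finset.set0.
    by rewrite /P finset.sub0set; apply/forallP => i; rewrite inE.
  have [B /maxsetP[PB Bmax] _] := maxset_exists P0.
  exists B; rewrite PB /=; apply/forall_inP => u uW; apply: contraT.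
  rewrite negb_exists => /forallP hn.
  have hs b : b \in B -> sep T u b && (u != b).
    by move=> bB; have := hn b; rewrite bB negb_or negbK andbC.
  have uB : u \notin B by apply/negP => /hs; rewrite eqxx andbF.
  have : P T (u |: B).
    case/andP: PB => sB /forall_inP sepB; apply/andP; split.
      by rewrite finset.subUset finset.sub1set uW.
    apply/forall_inP => v /finset.setU1P[->|vB]; apply/forall_inP => w /finset.setU1P[->|wB].
    - by rewrite eqxx.
    - by have /andP[->] := hs _ wB; rewrite implybT.
    - by have /andP[] := hs _ vB; rewrite sepC => ->; rewrite implybT.
    - by have /forall_inP := sepB v vB; exact.
  move=> /Bmax /(_ (finset.subsetUr _ _)) e; case/negP: uB.
  by rewrite -e finset.setU11.
have /choice[B hB] T : exists B : {set n.-tuple 'I_q}, P T B /\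
    [forall u : n.-tuple 'I_q in W T, [exists b in B, (u == b) || ~~ sep T u b]].
  by have [B /andP[]] := exB T; exists B.
pose rho (T : word_type q n) := normc (type_lin al T).
have rhoB T (u : n.-tuple 'I_q) : u \in B T -> lin u = type_lin al T /\ parity u = T.2.
  have [/andP[/fintype.subsetP sB _] _] := hB T.
  by move=> /sB; rewrite inE => /andP[/eqP -> /eqP ->].
(* The kept images are thickened to swallow the discarded ones: such an image has diameter at most
   [L * rho] and comes within [rho] of a kept one. The thickened sets have diameter at most
   [L + 2 * (L + 1)] times [rho]. *)
pose F (x : word_type q n * n.-tuple 'I_q) : set R[i] :=
  fun y => x.2 \in B x.1 /\ exists2 z, K z & normc (y - act x.2 z) <= (L + 1) * rho x.1.
pose d (x : word_type q n * n.-tuple 'I_q) : R :=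
  if x.2 \in B x.1 then (3 * L + 2) * rho x.1 else 0.
have L32 : 0 <= 3 * L + 2 by have := L0; lra.
have L1 : 0 <= L + 1 by have := L0; lra.
have d00 : 0 <= d0.
  apply: le_trans hd0; rewrite mulr_ge0 // exprn_ge0 //.
  by case/andP: r01 => /ltW.
have hsum : h <= \sum_x d x.
  apply: (finite_cover (F := F) hc d00).
  - move=> [T u]; rewrite /d /=; case: ifP => [uB|]; last by rewrite lexx.
    rewrite mulr_ge0 ?normc_ge0 //=; apply: le_trans hd0.
    rewrite ler_wpM2l // /rho -(rhoB _ _ uB).1.
    by have := lin_le u; rewrite size_tuple.
  - move=> [T u] x y [uB /= [z Kz xz]] [_ [w Kw yw]].
    rewrite /d /= uB.
    have h1 := act_diam u Kz Kw; rewrite (rhoB _ _ uB).1 -/(rho T) in h1.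
    have h2 := normc_trans (act u z) x y; have h3 := normc_trans (act u w) (act u z) y.
    rewrite (normcB (act u w) y) in h3; rewrite /= in yw; lra.
  - move=> x Kx; have [u [z [Kz ->]]] := act_cover n Kx.
    have [T [Tu pu]] := type_exists al sg u.
    have [_ /forall_inP/(_ u)] := hB T.
    rewrite inE Tu pu !eqxx => /(_ isT)/existsP[b /andP[bB hub]].
    exists (T, b); split => //=.
    have [e|ub] := eqVneq u b.
      exists z => //; rewrite e subrr normc0 mulr_ge0 ?normc_ge0 //.
    move: hub; rewrite (negbTE ub) /= => /asboolPn/existsNP[z1 /existsNP[w1]].
    move=> /not_implyP[Kz1 /not_implyP[Kw1 /negP]]; rewrite -ltNge => hlt.
    exists w1 => //.
    have h1 := act_diam u Kz Kz1; rewrite Tu -/(rho T) in h1.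
    have := normc_trans (act u z1) (act u z) (act b w1).
    rewrite /= -/(rho T) in hlt *; lra.
have {hsum} hsum : h <= \sum_T #|B T|%:R * ((3 * L + 2) * rho T).
  apply: le_trans hsum _; rewrite le_eqVlt; apply/orP; left; apply/eqP.
  rewrite -(pair_bigA _ (fun T u => d (T, u))) /=; apply: eq_bigr => T _.
  rewrite /d /= -big_mkcond /= sumr_const [RHS]mulr_natl.
  by [].
have [T hT] : exists T, h <= #|word_type q n|%:R * (#|B T|%:R * ((3 * L + 2) * rho T)).
  apply/existsP; apply: contraT; rewrite negb_exists => /forallP hn.
  have card0 : (0 < #|word_type q n|)%N by rewrite card_type muln_gt0 expn_gt0.
  move: hsum; rewrite leNgt => /negP[].
  rewrite -(ltr_pM2l (_ : 0 < #|word_type q n|%:R)) ?ltr0n // mulr_sumr -sum_cst.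
  have [T0 _] := card_gt0P card0.
  apply: ltr_sum => [|T _]; last by rewrite ltNge hn.
  by apply/hasP; exists T0; rewrite ?mem_index_enum.
exists T, (B T); split => //; first exact: rhoB.
move=> u v z w uB vB uv Kz Kw.
have [/andP[_ /forall_inP/(_ u uB)/forall_inP/(_ v vB)/implyP/(_ uv)/asboolP hs] _] := hB T.
exact: hs.
Qed.

(** At most [1 / rho] of the words given by [rich_type] are kept, so that [N * rho] does not exceed
    1, as the energy estimate requires. This costs nothing, because [rho^(t-1)] is itself as large
    as desired. *)
Lemma family_exists (t Lam : R) : length_content K d0 h -> 0 < d0 -> 0 < h ->
  0 < t < 1 -> 0 < Lam ->
  exists N (f : 'I_N -> seq 'I_q) (a : R[i]) s,
  [/\ forall i, lin (f i) = a /\ parity (f i) = s,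
      forall i j z w, i != j -> K z -> K w ->
        normc a <= normc (act (f i) z - act (f j) w),
      0 < normc a < 1, N%:R * normc a <= 1 & Lam <= N%:R * normc a `^ t].
Proof.
move=> hc d00 h0 /andP[t0 t1] Lam0; case/andP: (r01) => r0 r1.
have L32 : 0 < 3 * L + 2 by have := L0; lra.
(* The power [1 - t] of [rho] is at most [g ^+ n]. The thresholds [n1], [n2], [n3] below make the
   covers fine enough, beat the number of types, and keep the truncated family large. *)
pose g := r `^ (1 - t).
have g0 : 0 < g by rewrite powR_gt0.
have g1 : g < 1.
  have : g < 1 `^ (1 - t).
    by apply: gt0_ltr_powR; rewrite ?nnegrE ?subr_gt0 ?(ltW r0).
  by rewrite powR1.
have G1 : 1 < g^-1 by rewrite invf_gt1.
have [n1 hn1] := @exprn_small R r (d0 / (3 * L + 2)) (introT andP (conj (ltW r0) r1)) (divr_gt0 d00 L32).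
have [n2 hn2] := poly_dominated (q * 2) (2 * Lam * (3 * L + 2) / h) G1.
have [n3 hn3] := poly_dominated 0 (2 * Lam) G1.
pose n := (maxn n1 (maxn n2 n3)).+1.
have l1 : (n1 <= n)%N by rewrite leqW ?leq_maxl.
have l2 : (n2 <= n)%N by rewrite leqW // !leq_max leqnn orbT.
have l3 : (n3 <= n)%N by rewrite leqW // !leq_max leqnn !orbT.
have {hn1} hr : (3 * L + 2) * r ^+ n <= d0.
  rewrite mulrC -ler_pdivlMr //; apply: ltW; apply: le_lt_trans hn1.
  by apply: ler_wiXn2l => //; exact: ltW.
have {}hn2 := hn2 n l2; have {}hn3 := hn3 n l3.
have [T [B [hB hsep hcard]]] := rich_type hc hr.
set rho := normc (type_lin al T) in hsep hcard.
have [u uB] : exists u, u \in B.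
  apply/card_gt0P; rewrite lt0n; apply/eqP => B0.
  by move: hcard; rewrite B0 mul0r mulr0 leNgt h0.
have rho0 : 0 < rho by rewrite /rho -(hB _ uB).1 lin_gt0.
have rhon : rho <= r ^+ n.
  by rewrite /rho -(hB _ uB).1; have := lin_le u; rewrite size_tuple.
have rho1 : rho < 1 by apply: le_lt_trans rhon _; rewrite exprn_ilt1 ?(ltW r0).
have rhot : rho = rho `^ t * rho `^ (1 - t).
  rewrite -powRD; last by rewrite (gt_eqF rho0) implybT.
  by rewrite addrC subrK powRr1 // ltW.
have rg : rho `^ (1 - t) <= g ^+ n.
  rewrite /g -powR_expr ?(ltW r0) //; apply: ge0_ler_powR; rewrite ?nnegrE //.
  - by rewrite subr_ge0; exact: ltW.
  - exact: ltW.
  - by rewrite exprn_ge0 // ltW.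
have gn0 : 0 < g ^+ n by rewrite exprn_gt0.
have pt0 : 0 < rho `^ t by rewrite powR_gt0.
have rt : rho <= rho `^ t * g ^+ n by rewrite {1}rhot ler_wpM2l // ltW.
have LB : Lam <= #|B|%:R * rho `^ t.
  have cT : (#|word_type q n|%:R : R) = n.+1%:R ^+ (q * 2) * 2.
    by rewrite card_type natrM natrX.
  have h1 : h <= #|word_type q n|%:R * (#|B|%:R * ((3 * L + 2) * (rho `^ t * g ^+ n))).
    by apply: le_trans hcard _; rewrite !ler_wpM2l // ltW.
  have cT0 : 0 < (#|word_type q n|%:R : R) by rewrite cT mulr_gt0 ?exprn_gt0.
  move: hn2; rewrite exprVn -[leRHS]mul1r ler_pdivlMr //.
  set p := n.+1%:R ^+ _ in cT *; rewrite {}cT in h1 => hn2.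
  have p0 : 0 < p by rewrite exprn_gt0.
  have K0 : 0 < p * 2 * (3 * L + 2) * g ^+ n by rewrite !mulr_gt0.
  rewrite -(ler_pM2l K0); apply: le_trans (_ : h <= _).
    have := ler_wpM2l (ltW h0) hn2.
    rewrite (_ : h * (2 * Lam * (3 * L + 2) / h * p * g ^+ n) =
      p * 2 * (3 * L + 2) * g ^+ n * Lam); last by field; rewrite gt_eqF.
    by rewrite mulr1.
  by apply: le_trans h1 _; rewrite le_eqVlt; apply/orP; left; apply/eqP; ring.
have Lr : Lam <= (Num.truncn rho^-1)%:R * rho `^ t.
  have i1 : 1 <= rho^-1 by rewrite invf_ge1 // ltW.
  have tr1 : 1 <= (Num.truncn rho^-1)%:R :> R by rewrite ler1n truncn_gt0.
  have tr2 := truncnS_gt rho^-1; rewrite -natr1 in tr2.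
  set tr : R := _%:R in tr1 tr2 *.
  have h2 : rho^-1 <= 2 * tr by lra.
  have h3 : 1 <= 2 * tr * rho by rewrite -ler_pdivrMr // mul1r.
  move: hn3; rewrite expr0 mulr1 exprVn -[leRHS]mul1r ler_pdivlMr // => hn3.
  rewrite -(ler_pM2r gn0) -(@ler_pM2l _ 2) // mulrA; apply: le_trans hn3 _.
  by apply: le_trans h3 _; rewrite -!mulrA !ler_wpM2l.
pose N := minn #|B| (Num.truncn rho^-1).
have NB : (N <= #|B|)%N by exact: geq_minl.
exists N, (fun i => tval (enum_val (widen_ord NB i))), (type_lin al T), T.2; split.
- by move=> i; apply: hB; exact: enum_valP.
- move=> i j z w ij Kz Kw; apply: hsep => //; try exact: enum_valP.
  by rewrite (inj_eq enum_val_inj) -val_eqE.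
- by rewrite rho0.
- rewrite -ler_pdivlMr // mul1r; apply: le_trans (_ : (Num.truncn rho^-1)%:R <= _).
    by rewrite ler_nat geq_minr.
  by rewrite truncn_le invr_ge0 ltW.
- by rewrite /N /minn; case: ifP.
Qed.

End RichTypes.

(** * Reduction to a family without reflections *)

Section Cases.
Context (R : realType) (K : set R[i]) (q : nat).
Context (al be : 'I_q -> R[i]) (sg : 'I_q -> bool) (r L d0 h t : R).
Context (r01 : 0 < r < 1) (al_gt0 : forall j, 0 < normc (al j))
  (al_le : forall j, normc (al j) <= r).
Context (K_in : forall j z, K z -> K (sim al be sg j z))
  (K_cov : forall z, K z -> exists j w, K w /\ z = sim al be sg j w).
Context (cl : clustering K) (bL : bounded_by K L) (L0 : 0 < L).
Context (hc : length_content K d0 h) (d00 : 0 < d0) (h0 : 0 < h) (t01 : 0 < t < 1).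

Local Notation act := (act al be sg).
Local Notation lin := (lin al sg).
Local Notation parity := (parity sg).

(** The rotation part of [a] has finite order. *)
Definition torsion (a : R[i]) :=
  exists2 m, (0 < m)%N & a ^+ m = real_complex R (normc a ^+ m).

Lemma torsion_quot (a b : R[i]) : a != 0 ->
  torsion a -> torsion (a * b) -> torsion b.
Proof.
move=> a0 [m m0 ha] [k k0 hb]; exists (m * k)%N; first by rewrite muln_gt0 m0.
have : (a * b) ^+ (k * m) = real_complex R (normc (a * b) ^+ (k * m)).
  by rewrite exprM hb -rmorphXn exprM.
rewrite mulnC exprMn normcM exprMn rmorphM /= => e.
have a1 : a ^+ (m * k) = real_complex R (normc a ^+ (m * k)).
  by rewrite exprM ha -rmorphXn -exprM.
rewrite a1 in e; apply: (mulfI _ e).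
by rewrite -a1 expf_neq0.
Qed.

(** The word is doubled to cancel its parity. All its powers are controlled at once because a power
    may be needed to make the linear part a positive real. *)
Lemma piece_exists x (eta : R) : K x -> 0 < eta -> exists u,
  parity u = false /\ forall k, (0 < k)%N ->
    forall z, K z -> normc (act (flatten (nseq k u)) z - x) <= eta.
Proof.
move=> Kx eta0; case/andP: (r01) => r0 r1.
have [|n hn] := @exprn_small R r (eta / L) _ (divr_gt0 eta0 L0).
  by rewrite (ltW r0) r1.
have [w [y [Ky ey]]] := act_cover K_cov n Kx.
exists (w ++ w); split; first by rewrite parity_cat addbb.
move=> [//|k] _ z Kz /=; rewrite -catA act_cat ey.
have := act_diam al be sg bL w (act_in K_in _ Kz) Ky. move=> hd; apply: le_trans (hd _) _.
rewrite -ler_pdivlMr //; apply: le_trans (ltW hn).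
by have := lin_le sg al_le w; rewrite size_tuple.
Qed.

Lemma lin_flatten k u : parity u = false ->
  parity (flatten (nseq k u)) = false /\ lin (flatten (nseq k u)) = lin u ^+ k.
Proof.
move=> pu; elim: k => [|k [IH1 IH2]] //=.
by rewrite parity_cat lin_cat pu IH1 IH2 exprS.
Qed.

Lemma ratio_min : exists2 k : R, 0 < k <= 1 & forall j, k <= normc (al j).
Proof.
have a1 j : normc (al j) <= 1.
  by case/andP: r01 => _ /ltW; apply: le_trans; exact: al_le.
exists (\prod_j normc (al j)).
  rewrite prodr_gt0 //=; apply: Num.Theory.prodr_ile1 => j _.
  by rewrite normc_ge0 a1.
move=> j; rewrite (bigD1 j) //= ler_piMr ?normc_ge0 //.
by apply: Num.Theory.prodr_ile1 => i _; rewrite normc_ge0 a1.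
Qed.

(** A suffix determined by linear part and parity is the same for all words of the family, so the
    linear part remains common. Separation survives because the new images lie in the old ones while
    the ratio decreases; the loss, a factor at least [kap], is paid in advance through the constant
    requested from [family_exists]. *)
Lemma suffixed_family (kap : R) (suf : seq 'I_q -> seq 'I_q) :
  0 < kap <= 1 -> (forall u, kap <= normc (lin (suf u))) ->
  (forall u v, lin u = lin v -> parity u = parity v -> suf u = suf v) ->
  (forall u, parity (u ++ suf u) = false) ->
  exists N (f : 'I_N -> seq 'I_q) (a : R[i]) (rho : R),
  [/\ forall i, a = lin (f i ++ suf (f i)) /\ parity (f i ++ suf (f i)) = false,
      separated_family K a (fun i => act (f i ++ suf (f i)) 0) rho,
      (0 < N)%N, #|'I_N|%:R * rho <= 1 & 2 <= #|'I_N|%:R * rho `^ t].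
Proof.
move=> /andP[k0 k1] hk hsuf hpar; case/andP: (t01) => t0 t1.
have kt : 0 < kap `^ t by rewrite powR_gt0.
have [N [f [a [s [hf hsep /andP[a0 a1] hN1 hN2]]]]] :=
  family_exists r01 al_gt0 al_le K_cov bL L0 hc d00 h0 t01 (divr_gt0 (ltr0Sn _ 1) kt).
have N0 : (0 < N)%N.
  rewrite lt0n; apply/eqP => N0; move: hN2; rewrite N0 mul0r leNgt.
  by rewrite divr_gt0.
pose i0 := Ordinal N0.
have sufE i : suf (f i) = suf (f i0).
  by apply: hsuf; rewrite (hf i).1 (hf i0).1 || rewrite (hf i).2 (hf i0).2.
set v := suf (f i0) in sufE.
have linE i : lin (f i ++ v) = a * flip s (lin v) by rewrite lin_cat (hf i).1 (hf i).2.
have v0 : 0 < normc (lin v) by apply: lt_le_trans k0 (hk _).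
have v1 : normc (lin v) <= 1.
  apply: le_trans (lin_le sg al_le v) _; case/andP: r01 => /ltW ? /ltW ?.
  by rewrite exprn_ile1.
exists N, f, (a * flip s (lin v)), (normc a * normc (lin v)); split => //.
- by move=> i; split; [rewrite sufE linE|exact: hpar].
- split.
  + by rewrite normcM normc_flip.
  + rewrite mulr_gt0 //=; apply: le_lt_trans a1.
    by rewrite ler_piMr ?normc_ge0.
  + move=> i z Kz; rewrite sufE -(linE i).
    have := act_in K_in (f i ++ v) Kz; rewrite actE.
    by have := hpar (f i); rewrite sufE => ->.
  + move=> i j z w ij Kz Kw; rewrite !sufE -{1}(linE i) -(linE j).
    have p i' : parity (f i' ++ v) = false by have := hpar (f i'); rewrite sufE.
    have e i' z' : lin (f i' ++ v) * z' + act (f i' ++ v) 0 = act (f i') (act v z').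
      by rewrite -act_cat [RHS]actE p.
    rewrite !e; apply: le_trans (hsep _ _ _ _ ij (act_in K_in _ Kz) (act_in K_in _ Kw)).
    by rewrite ler_piMr ?normc_ge0.
- rewrite card_ord mulrA; apply: le_trans hN1.
  by rewrite ler_piMr ?mulr_ge0 ?normc_ge0.
- rewrite card_ord powRM ?normc_ge0 // mulrA.
  move: hN2; rewrite ler_pdivrMr // => hN2; apply: le_trans hN2 _.
  rewrite ler_wpM2l ?mulr_ge0 ?powR_ge0 //.
  apply: ge0_ler_powR; rewrite ?nnegrE ?(ltW t0) ?(ltW k0) ?normc_ge0 //.
  exact: hk.
Qed.

(* A reflecting letter, if there is one, is appended to the words of odd parity. *)
Lemma parity_fix (k : R) : 0 < k <= 1 -> (forall j, k <= normc (al j)) ->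
  exists suf : bool -> seq 'I_q,
  (forall u, parity (u ++ suf (parity u)) = false) /\
  (forall s, k <= normc (lin (suf s))).
Proof.
move=> /andP[k0 k1] hk.
have [[j sj]|no] := pselect (exists j, sg j = true).
  exists (fun s => if s then [:: j] else [::]); split => //.
    by move=> u; rewrite parity_cat; case: (parity u) => //=; rewrite sj.
  by case; rewrite ?normc1 //= ?normcM ?normc_flip ?normc1 ?mulr1.
exists (fun _ => [::]); split => //.
  move=> u; rewrite cats0; elim: u => //= j u ->.
  by case E : (sg j) => //; case: no; exists j.
by move=> s; rewrite normc1.
Qed.

(** The conjugate is factored, and not [a], because projections are pulled back by the adjoint of
    multiplication by [a]. *)
Lemma unit_part (a : R[i]) : 0 < normc a -> exists v,
  [/\ normc v = 1, conjc a = real_complex R (normc a) * v &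
      forall m, v ^+ m = 1 <-> a ^+ m = real_complex R (normc a ^+ m)].
Proof.
move=> a0; have ra : real_complex R (normc a) != 0.
  by rewrite -normc_eq0 normc_real ger0_norm ?normc_ge0 // gt_eqF.
exists (conjc a / real_complex R (normc a)).
have e : conjc a = real_complex R (normc a) * (conjc a / real_complex R (normc a)).
  by rewrite mulrCA divff ?mulr1.
split => //.
  by rewrite normcM normcV normcJ normc_real ger0_norm ?normc_ge0 // divff // gt_eqF.
move=> m; have ram : real_complex R (normc a ^+ m) != 0.
  by rewrite rmorphXn expf_neq0.
have -> : (conjc a / real_complex R (normc a)) ^+ m =
    conjc (a ^+ m) / real_complex R (normc a ^+ m).
  by rewrite expr_div_n [conjc (a ^+ m)]rmorphXn [real_complex R (_ ^+ _)]rmorphXn.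
split => [H|->]; last by rewrite conjc_real divff.
apply: (can_inj (@conjcK R)); rewrite conjc_real.
have := congr1 (fun x => x * real_complex R (normc a ^+ m)) H.
by rewrite /= divfK ?mul1r.
Qed.

(** If the linear part obtained after cancelling the parity is torsion, appending [u0] destroys this
    by [torsion_quot]; otherwise nothing is appended. The choice depends on linear part and parity
    only, as [suffixed_family] demands. *)
Lemma rotation_case (u0 : seq 'I_q) x y :
  parity u0 = false -> ~ torsion (lin u0) ->
  K x -> K y -> x != y -> distance_content K t.
Proof.
move=> pu0 tu0 Kx Ky xy; case/andP: (t01) => t0 t1.
have [k /andP[k0 k1] hk] := ratio_min.
have [suf [suf1 suf2]] := parity_fix (introT andP (conj k0 k1)) hk.
pose ext u := if `[< torsion (lin (u ++ suf (parity u))) >] then u0 else [::].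
pose kap := k * Num.min 1 (normc (lin u0)).
have m0 : 0 < Num.min 1 (normc (lin u0)) by rewrite lt_min ltr01 lin_gt0.
have m1 : Num.min 1 (normc (lin u0)) <= 1 by rewrite ge_min lexx.
have kap0 : 0 < kap by rewrite mulr_gt0.
have kap1 : kap <= 1 by rewrite /kap -[leRHS]mulr1 ler_pM // ltW.
have [||||N [f [a [rho [hf fam N0 hN1 hN2]]]]] :=
  @suffixed_family kap (fun u => suf (parity u) ++ ext u).
- by rewrite kap0.
- move=> u; rewrite lin_cat normcM normc_flip; apply: ler_pM => //; rewrite ?(ltW k0) ?(ltW m0) //.
  rewrite /ext; case: ifP => _; rewrite ?normc1 //.
  by rewrite ge_min lexx orbT.
- by move=> u v e1 e2; rewrite /ext e2 !lin_cat e1 e2.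
- move=> u; rewrite catA parity_cat suf1 /ext; case: ifP => //.
have [i0 _] : exists i : 'I_N, true by exists (Ordinal N0).
have [eA pA] := hf i0.
have ator : ~ torsion a.
  rewrite eA catA lin_cat suf1 /= /ext.
  have w0 : lin (f i0 ++ suf (parity (f i0))) != 0 by rewrite -normc_gt0 lin_gt0.
  case: asboolP => [tor|ntor] /=; last by rewrite mulr1.
  by move=> /(torsion_quot w0 tor).
have a0 : 0 < normc a by rewrite eA lin_gt0.
have [v [v1 av vm]] := unit_part a0.
have ea : normc a = rho by case: fam.
rewrite ea in av.
apply: (irrational_case fam cl bL L0 Kx v1 av hN1 t0 hN2 _ Kx Ky xy).
  by move=> m m0'; apply/eqP => /vm e; apply: ator; exists m.
move=> eta eta0; have [u [pu hu]] := piece_exists Kx eta0.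
have hE z : lin u * z + act u 0 = act u z by rewrite [RHS]actE pu.
exists (lin u), (act u 0); split.
- by rewrite -normc_gt0 lin_gt0.
- by move=> z Kz; rewrite hE; exact: act_in.
- by move=> z Kz; rewrite hE; have := hu 1%N isT z Kz; rewrite /= cats0.
Qed.

(** The linear part of the family is torsion like all those of even parity, and copies of [K] near a
    given point become homothetic once the word is replaced by a power. *)
Lemma torsion_case (e1 : R[i]) (kap : R) x :
  (forall u, parity u = false -> torsion (lin u)) -> K x ->
  normc e1 = 1 -> 0 < kap ->
  (forall e, normc e = 1 -> normc (e - e1) <= kap -> forall eta : R, 0 < eta ->
     exists x y, [/\ K x, K y, x != y &
       normc (x - y - real_complex R (normc (x - y)) * e) <= eta * normc (x - y)]) ->
  distance_content K t.
Proof.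
move=> htor Kx e11 kap0 hdir; case/andP: (t01) => t0 t1.
have [k /andP[k0 k1] hk] := ratio_min.
have [suf [suf1 suf2]] := parity_fix (introT andP (conj k0 k1)) hk.
have [||||N [f [a [rho [hf fam N0 hN1 hN2]]]]] :=
  @suffixed_family k (fun u => suf (parity u)).
- by rewrite k0.
- by [].
- by move=> u v _ ->.
- by [].
have [i0 _] : exists i : 'I_N, true by exists (Ordinal N0).
have [eA pA] := hf i0.
have a0 : 0 < normc a by rewrite eA lin_gt0.
have [v [v1 av vm]] := unit_part a0.
have ea : normc a = rho by case: fam.
have [m m0 ham] : torsion a by rewrite eA; apply: htor.
rewrite ea in av.
have v_m : v ^+ m = 1 by apply/vm.
apply: (homothetic_case fam cl bL L0 Kx av hN1 t0 hN2 m0 v_m e11 kap0 hdir).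
move=> x' eta Kx' eta0; have [u [pu hu]] := piece_exists Kx' eta0.
have [n n0 hn] := htor u pu; have [pn ln] := lin_flatten n pu.
have hE z : real_complex R (normc (lin u) ^+ n) * z + act (flatten (nseq n u)) 0 =
    act (flatten (nseq n u)) z.
  by rewrite [RHS]actE pn ln hn.
exists (normc (lin u) ^+ n), (act (flatten (nseq n u)) 0); split.
- by rewrite exprn_gt0 // lin_gt0.
- by move=> z Kz; rewrite hE; exact: act_in.
- by move=> z Kz; rewrite hE; exact: hu.
Qed.

End Cases.

(** * Limit directions *)

Section Directions.
Context (R : realType).
Implicit Types (x y z d e : R[i]).

Definition cross d z : R := Re d * Im z - Im d * Re z.

Lemma proj_cross_sqr d z :
  proj d z ^+ 2 + cross d z ^+ 2 = normc d ^+ 2 * normc z ^+ 2.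
Proof. by rewrite !sqr_normc projE /cross; ring. Qed.

Lemma crossB d x y : cross d (x - y) = cross d x - cross d y.
Proof. by rewrite /cross !ReImE; ring. Qed.

Lemma crossN d z : cross d (- z) = - cross d z.
Proof. by rewrite /cross !ReImE; ring. Qed.

Lemma normr_cross_le d z : `|cross d z| <= normc d * normc z.
Proof.
rewrite -(@ler_pXn2r _ 2) ?nnegrE ?mulr_ge0 ?normc_ge0 // real_normK ?num_real //.
by rewrite exprMn -proj_cross_sqr lerDr sqr_ge0.
Qed.

Context (K : set R[i]).

(** Unoriented: the secants need only be nearly parallel to the line of [d], which is not
    normalised. *)
Definition limit_direction d := forall eta : R, 0 < eta ->
  exists x y, [/\ K x, K y, x != y & `|cross d (x - y)| <= eta * normc (x - y)].

Lemma not_limit_direction d : ~ limit_direction d ->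
  exists2 eta : R, 0 < eta & forall x y, K x -> K y ->
    eta * normc (x - y) <= `|cross d (x - y)|.
Proof.
move=> /existsNP[eta /not_implyP[eta0 h]]; exists eta => // x y Kx Ky.
rewrite leNgt; apply/negP => hlt; apply: h; exists x, y; split => //.
  by apply/eqP => e; move: hlt; rewrite e subrr normc0 mulr0 ltNge normr_ge0.
exact: ltW.
Qed.

(** Exchanging [x] and [y] makes the projection nonnegative; a small cross product then forces it to
    be close to the full length. *)
Lemma limit_direction_oriented e : normc e = 1 -> limit_direction e ->
  forall eta : R, 0 < eta -> exists x y, [/\ K x, K y, x != y &
    normc (x - y - real_complex R (normc (x - y)) * e) <= eta * normc (x - y)].
Proof.
move=> e1 he eta eta0.
pose eta' := Num.min (eta / 2) (1 / 2).
have eta'0 : 0 < eta' by rewrite lt_min !divr_gt0.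
have eta'1 : eta' <= 1 / 2 by rewrite ge_min lexx orbT.
have eta'2 : eta' <= eta / 2 by rewrite ge_min lexx.
have [x [y [Kx Ky xy hxy]]] := he eta' eta'0.
wlog pos : x y Kx Ky xy hxy / 0 <= proj e (x - y).
  move=> H; have [p|p] := lerP 0 (proj e (x - y)); first exact: (H x y).
  apply: (H y x) => //; first by rewrite eq_sym.
    by rewrite -opprB crossN normrN normcN.
  by move: p; rewrite !projB; lra.
exists x, y; split => //.
have [e_ n0] : normc e ^+ 2 = 1 /\ 0 <= normc (x - y) by rewrite e1 expr1n normc_ge0.
rewrite -(@ler_pXn2r _ 2) ?nnegrE ?mulr_ge0 ?normc_ge0 ?(ltW eta0) //.
have := proj_cross_sqr e (x - y); rewrite e_ mul1r.
have -> : normc (x - y - real_complex R (normc (x - y)) * e) ^+ 2 =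
   normc (x - y) ^+ 2 * (1 + normc e ^+ 2) - 2 * normc (x - y) * proj e (x - y).
  rewrite [LHS]sqr_normc mulrDr mulr1 (sqr_normc e) projE.
  have hn := sqr_normc (x - y); set n := normc (x - y) in hn *.
  by rewrite {1}hn !ReImE /=; ring.
have hc : cross e (x - y) ^+ 2 <= (eta' * normc (x - y)) ^+ 2.
  by rewrite -[leLHS]real_normK ?num_real // ler_pXn2r ?nnegrE ?mulr_ge0 ?(ltW eta'0).
move: pos hc; rewrite e_; set n := normc (x - y) in n0 *; set P := proj _ _.
set c := cross _ _ => P0 hc hPc.
have hE : eta' ^+ 2 <= (eta / 2) ^+ 2.
  by rewrite ler_pXn2r ?nnegrE ?(ltW eta'0) // (le_trans _ eta'2) // ltW.
have hE1 : eta' ^+ 2 <= 1.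
  by rewrite expr_le1 ?(ltW eta'0) //; lra.
have hP : (1 - eta' ^+ 2) * n <= P.
  rewrite -(@ler_pXn2r _ 2) ?nnegrE ?mulr_ge0 ?subr_ge0 //.
  rewrite exprMn in hc; rewrite exprMn.
  have : (1 - eta' ^+ 2) ^+ 2 * n ^+ 2 <= (1 - eta' ^+ 2) * n ^+ 2.
    rewrite ler_wpM2r ?sqr_ge0 // expr2 ler_piMl ?subr_ge0 //.
    by rewrite gerBl sqr_ge0.
  lra.
have h1 := ler_wpM2l n0 hP.
have h2 := ler_wpM2r (sqr_ge0 n) hE.
have h3 := mulr_ge0 (sqr_ge0 eta) (sqr_ge0 n).
rewrite exprMn; lra.
Qed.

(** The ball is centred at the normalised direction of middle slope. The two bounds in [kap] keep
    the second coordinate away from 0 and the slope within [del] of the middle. *)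
Lemma interior_directions (e : R[i]) (s0 s1 : R) : normc e = 1 -> s0 < s1 ->
  (forall s, s0 < s < s1 -> limit_direction (e * Complex s 1)) ->
  exists e1 (kap : R), [/\ normc e1 = 1, 0 < kap &
    forall e', normc e' = 1 -> normc (e' - e1) <= kap -> limit_direction e'].
Proof.
move=> e1 s01 hs; pose s := (s0 + s1) / 2; pose del := (s1 - s0) / 2.
have del0 : 0 < del by rewrite divr_gt0 // subr_gt0.
pose d := Complex s 1; have d0 : 0 < normc d.
  rewrite normc_gt0 -normc_eq0 -(@eqrXn2 _ 2) ?normc_ge0 // expr0n sqr_normc /=.
  by rewrite expr1n gt_eqF // ltr_wpDl ?sqr_ge0.
pose Y0 := (normc d)^-1; have Y00 : 0 < Y0 by rewrite invr_gt0.
have as0 : 0 < 1 + `|s| by rewrite ltr_pwDl.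
pose kap := Num.min (Y0 / 2) (del * Y0 / (4 * (1 + `|s|))).
have kap0 : 0 < kap.
  rewrite lt_min; apply/andP; split; first by apply: divr_gt0.
  apply: divr_gt0; first by apply: mulr_gt0.
  by apply: mulr_gt0.
exists (e * d * real_complex R Y0), kap; split => //.
  by rewrite !normcM e1 mul1r normc_real (gtr0_norm Y00) divff // gt_eqF.
move=> e' e'1 he'.
have ee : e * conjc e = 1.
  apply: complex_eqP; rewrite !ReImE; last by ring.
  by have := sqr_normc e; rewrite e1 expr1n => ->; ring.
have [w ew] : exists w, e' = e * w by exists (conjc e * e'); rewrite mulrA ee mul1r.
have wd : normc (w - d * real_complex R Y0) <= kap.
  apply: le_trans he'; rewrite ew -mulrA -mulrBr normcM e1 mul1r.
  by [].
have w1 : normc w = 1 by rewrite -e'1 ew normcM e1 mul1r.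
have hX : `|Re w - s * Y0| <= kap.
  by apply: le_trans wd; apply: le_trans (normRe_le _); rewrite !ReImE /= mulr0 subr0.
have hY : `|Im w - Y0| <= kap.
  apply: le_trans wd; apply: le_trans (normIm_le _); rewrite !ReImE /= mul1r mulr0 add0r.
  by [].
have k1 : kap <= Y0 / 2 by rewrite ge_min lexx.
have k2 : kap * (1 + `|s|) <= del * Y0 / 4.
  rewrite -ler_pdivlMr // (le_trans (_ : kap <= del * Y0 / (4 * (1 + `|s|)))) //.
    by rewrite ge_min lexx orbT.
  by rewrite le_eqVlt; apply/orP; left; apply/eqP; field; rewrite gt_eqF.
have Ypos : Y0 / 2 <= Im w by move: hY; rewrite ler_norml => /andP[]; lra.
have Yw0 : 0 < Im w by apply: lt_le_trans Ypos; rewrite divr_gt0.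
have Y1 : Im w <= 1 by rewrite -w1; apply: le_trans (normIm_le w); exact: ler_norm.
pose s' := Re w / Im w.
have hs' : `|s' - s| < del.
  have -> : s' - s = ((Re w - s * Y0) - s * (Im w - Y0)) / Im w.
    by rewrite /s'; field; rewrite gt_eqF.
  rewrite normrM normfV (gtr0_norm Yw0) ltr_pdivrMr //.
  apply: le_lt_trans (ler_normB _ _) _; rewrite normrM.
  have := ler_wpM2l (normr_ge0 s) hY.
  have := ler_wpM2l (ltW del0) Ypos.
  have := mulr_gt0 del0 Y00.
  lra.
have : limit_direction (e * Complex s' 1).
  apply: hs; move: hs'; rewrite ltr_norml /s /del => /andP[]; move: s' => s'' h1 h2.
  by apply/andP; split; lra.
move=> hd eta eta0; have [x [y [Kx Ky xy hxy]]] := hd eta eta0.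
exists x, y; split => //; apply: le_trans hxy.
have -> : cross e' (x - y) = Im w * cross (e * Complex s' 1) (x - y).
  rewrite ew /cross !ReImE /= /s'; field.
  by rewrite gt_eqF.
by rewrite normrM (gtr0_norm Yw0) ler_piMl.
Qed.

End Directions.

(** * Nearly optimal covers when [e] is not a limit direction *)

Section NoGaps.
Context (R : realType) (K : set R[i]) (q : nat).
Context (al be : 'I_q -> R[i]) (sg : 'I_q -> bool) (r L d0 h : R).
Context (r01 : 0 < r < 1) (al_le : forall j, normc (al j) <= r).
Context (K_in : forall j z, K z -> K (sim al be sg j z))
  (K_cov : forall z, K z -> exists j w, K w /\ z = sim al be sg j w).
Context (bL : bounded_by K L) (L0 : 0 < L).
Context (hc : length_content K d0 h) (d00 : 0 < d0) (h0 : 0 < h).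
Context (e : R[i]) (cc : R) (e1 : normc e = 1) (cc0 : 0 < cc)
  (he : forall x y, K x -> K y -> cc * normc (x - y) <= `|cross e (x - y)|).

Let p z := cross e z.

Let p_le x y : K x -> K y -> `|p x - p y| <= normc (x - y).
Proof.
by move=> _ _; rewrite -crossB; apply: le_trans (normr_cross_le _ _) _; rewrite e1 mul1r.
Qed.

Definition width_le (A : set R[i]) (a : R) :=
  forall x y, K x -> K y -> A x -> A y -> `|p x - p y| <= a.

(** Members are measured by the width of their shadow under [p], comparable to the diameter on [K]
    by [he]. When a member is cut at a gap, the two widths and the gap add up to at most the whole
    width, which fails for diameters. *)
Definition width_cover (F : nat -> set R[i]) (d : nat -> R) (M : R) :=
  [/\ forall k, 0 <= d k <= cc * d0, forall k, width_le (F k) (d k),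
      forall x, K x -> exists k, F k x & forall n, \sum_(k < n) d k <= M].

Lemma width_cover_ge F d M : width_cover F d M -> cc * h <= M.
Proof.
move=> [hd hF hcov hM]; rewrite mulrC -ler_pdivlMr //.
apply: (hc (F := fun k x => K x /\ F k x) (d := fun k => d k / cc)).
- move=> k; have /andP[dk0 dk1] := hd k.
  by rewrite divr_ge0 ?(ltW cc0) //= ler_pdivrMr // mulrC.
- move=> k x y [Kx Fx] [Ky Fy]; rewrite ler_pdivlMr // mulrC.
  by apply: le_trans (he Kx Ky) _; rewrite crossB; exact: hF.
- by move=> x Kx; have [k Fk] := hcov x Kx; exists k.
- by move=> n; rewrite -mulr_suml ler_pM2r ?invr_gt0.
Qed.

Lemma width_cover_exists : exists F d M, width_cover F d M.
Proof.
case/andP: (r01) => r0 r1.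
have cd0 : 0 < cc * d0 by rewrite mulr_gt0.
have [|n hn] := @exprn_small R r (cc * d0 / L) _ (divr_gt0 cd0 L0).
  by rewrite (ltW r0) r1.
pose m := #|{: n.-tuple 'I_q}|.
pose F k : set R[i] := fun x => exists (H : (k < m)%N) z, K z /\
  x = act al be sg (enum_val (Ordinal H)) z.
exists F, (fun k => (nseq m (cc * d0))`_k), (\sum_(x <- nseq m (cc * d0)) x); split.
- move=> k; rewrite nth_nseq; case: ifP => _; first by rewrite (ltW cd0) lexx.
  by rewrite lexx (ltW cd0).
- move=> k x y Kx Ky [H [z [Kz ->]]] [H' [w [Kw ->]]].
  rewrite nth_nseq H (bool_irrelevance H' H).
  apply: le_trans (p_le _ _) _; [exact: act_in|exact: act_in|].
  apply: le_trans (act_diam al be sg bL _ Kz Kw) _.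
  rewrite -ler_pdivlMr //; apply: le_trans (ltW hn).
  have := lin_le sg al_le (enum_val (Ordinal H) : n.-tuple 'I_q).
  by rewrite size_tuple.
- move=> x Kx; have [u [z [Kz ->]]] := act_cover K_cov n Kx.
  have H : (enum_rank u < m)%N by exact: ltn_ord.
  exists (enum_rank u), H, z; split => //.
  by congr (act _ _ _ (tval _) _); rewrite -[LHS]enum_rankK; congr enum_val; exact: val_inj.
- by move=> N; apply: sum_nth_le; rewrite all_nseq (ltW cd0) orbT.
Qed.

Definition splits (xi : R) (A : set R[i]) (a : R) :=
  exists B C b c', [/\ forall x, K x -> A x -> B x \/ C x,
    width_le B b, width_le C c', 0 <= b /\ 0 <= c' & b + c' <= (1 - xi) * a].

(** In a cover with total below [1 + xi] times the infimum some member cannot be split: otherwise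
    the refined cover would have total below (1 - xi)(1 + xi) times the infimum. The infimum is
    positive because [K] has positive length. *)
Lemma unsplittable_exists (xi : R) : 0 < xi < 1 ->
  exists A a, 0 <= a /\ width_le A a /\ ~ splits xi A a.
Proof.
move=> /andP[xi0 xi1].
pose S : set R := fun M => exists F d, width_cover F d M.
have [F0 [d_ [M0 hM0]]] := width_cover_exists.
have ch0 : 0 < cc * h by rewrite mulr_gt0.
have S0 : nonempty S by exists M0, F0, d_.
have lbS : lbound S (cc * h) by move=> M [F [d /width_cover_ge]].
have hinf : has_inf S by split=> //; exists (cc * h).
have inf0 : 0 < inf S by apply: lt_le_trans ch0 _; exact: lb_le_inf.
have eps0 : 0 < xi * inf S by rewrite mulr_gt0.
have [M [F [d hcov]] hM] := inf_adherent eps0 hinf.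
case: (hcov) => hd hF hK hs.
apply: contrapT => hno.
have split k : splits xi (F k) (d k).
  apply: contrapT => hk; apply: hno; exists (F k), (d k); split => //.
  by have /andP[] := hd k.
have /choice[BC hBC] k : exists BC : (set R[i] * set R[i]) * (R * R),
   [/\ forall x, K x -> F k x -> BC.1.1 x \/ BC.1.2 x,
    width_le BC.1.1 BC.2.1, width_le BC.1.2 BC.2.2, 0 <= BC.2.1 /\ 0 <= BC.2.2 &
    BC.2.1 + BC.2.2 <= (1 - xi) * d k].
  by have [B [C [b [c' hh]]]] := split k; exists ((B, C), (b, c')).
pose G k := if odd k then (BC k./2).1.2 else (BC k./2).1.1.
pose g k := if odd k then (BC k./2).2.2 else (BC k./2).2.1.
have gpos k : 0 <= g k by rewrite /g; have [_ _ _ [? ?] _] := hBC k./2; case: odd.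
have : S ((1 - xi) * M).
  exists G, g; split.
  - move=> k; rewrite gpos /=; have [_ _ _ [b0 c0] bc] := hBC k./2.
    have /andP[dk0 dk1] := hd k./2.
    apply: le_trans dk1; apply: (@le_trans _ _ ((1 - xi) * d k./2)).
      by apply: le_trans bc; rewrite /g; case: odd; rewrite ?lerDl ?lerDr.
    by rewrite ler_piMl // gerBl ltW.
  - by move=> k; have [_ hB hC _ _] := hBC k./2; rewrite /G /g; case: odd.
  - move=> x Kx; have [k Fk] := hK x Kx; have [hx _ _ _ _] := hBC k.
    have [Bx|Cx] := hx x Kx Fk.
      by exists k.*2; rewrite /G odd_double doubleK.
    by exists k.*2.+1; rewrite /G /= odd_double /= uphalf_double.
  - move=> n; apply: (@le_trans _ _ (\sum_(k < n.*2) g k)).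
      rewrite -addnn big_split_ord /= lerDl; exact: sumr_ge0.
    have -> : \sum_(k < n.*2) g k = \sum_(k < n) ((BC k).2.1 + (BC k).2.2).
      elim: n => [|n IH]; first by rewrite !big_ord0.
      rewrite doubleS !big_ord_recr /= IH -addrA; congr (_ + (_ + _)).
        by rewrite /g odd_double doubleK.
      by rewrite /g /= odd_double /= uphalf_double.
    apply: (@le_trans _ _ (\sum_(k < n) (1 - xi) * d k)).
      by apply: ler_sum => k _; have [] := hBC k.
    by rewrite -mulr_sumr ler_wpM2l // subr_ge0 ltW.
have lb : lbound S (inf S) by apply: ge_inf; exists (cc * h).
move=> /lb; rewrite leNgt => /negP[].
have xx : 0 < 1 - xi by rewrite subr_gt0.
have := ltr_pM2l xx M (inf S + xi * inf S); rewrite hM => /idP H.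
apply: lt_le_trans H _.
have := mulr_ge0 (mulr_ge0 (ltW xi0) (ltW xi0)) (ltW inf0); lra.
Qed.

(** In an unsplittable member, for the saving [zeta / 2], a gap of relative length [zeta] in the
    shadow would give a split. The shadow also nearly fills the width [a], since replacing [a] by a
    smaller width counts as a split with an empty second part. *)
Lemma dense_window (zeta : R) : 0 < zeta < 1 ->
  exists m D, 0 < D /\ forall tau, m <= tau -> tau + zeta * D <= m + D ->
    exists2 x, K x & tau < p x < tau + zeta * D.
Proof.
move=> /andP[z0 z1].
have [|A [a [a0 [hA hns]]]] := @unsplittable_exists (zeta / 2).
  by rewrite divr_gt0 //=; lra.
pose E : set R := fun u => exists2 x, K x /\ A x & u = p x.
have xi0 : 0 <= (1 - zeta / 2) * a by rewrite mulr_ge0 //; lra.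
have E0 : nonempty E.
  apply: contrapT => hE; apply: hns.
  exists set0%classic, set0%classic, 0, 0; split => //.
  - by move=> x Kx Ax; case: hE; exists (p x), x.
  - by rewrite addr0.
have Eab u v : E u -> E v -> u <= v + a.
  move=> [x [Kx Ax] ->] [y [Ky Ay] ->]; have := hA x y Kx Ky Ax Ay.
  by rewrite ler_norml => /andP[_]; lra.
have [u0 Eu0] := E0.
have lbE : has_lbound E by exists (u0 - a) => v Ev; have := Eab _ _ Eu0 Ev; lra.
have ubE : has_ubound E by exists (u0 + a) => v Ev; exact: Eab.
pose m := inf E; pose M := sup E.
have mE u : E u -> m <= u by move=> Eu; exact: ge_inf.
have ME u : E u -> u <= M by move=> Eu; exact: ub_le_sup.
have Mma : M - m <= a.
  have : M - a <= m.
    apply: lb_le_inf => // v Ev; rewrite lerBlDr; apply: ge_sup => // u Eu.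
    exact: Eab.
  lra.
have mM : m <= M by apply: le_trans (mE _ Eu0) (ME _ Eu0).
have AmM x : K x -> A x -> m <= p x <= M.
  by move=> Kx Ax; rewrite mE ?ME //; exists x.
have D1 : (1 - zeta / 2) * a < M - m.
  rewrite ltNge; apply/negP => hD; apply: hns.
  exists A, set0%classic, (M - m), 0; split => //.
  - by left.
  - move=> x y Kx Ky Ax Ay; have /andP[h1 h2] := AmM x Kx Ax; have /andP[h3 h4] := AmM y Ky Ay.
    by rewrite ler_norml; apply/andP; split; lra.
  - by split => //; rewrite subr_ge0.
  - by rewrite addr0.
have D0 : 0 < M - m by apply: le_lt_trans D1.
exists m, (M - m); split => // tau mt tM.
apply: contrapT => hgap; apply: hns.
exists (fun x => A x /\ p x <= tau), (fun x => A x /\ tau + zeta * (M - m) <= p x),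
  (tau - m), (M - tau - zeta * (M - m)).
have hz : a / 2 <= M - m by nra.
split.
- move=> x Kx Ax; have [h1|h1] := lerP (p x) tau; first by left.
  right; split => //; rewrite leNgt; apply/negP => h2; apply: hgap.
  by exists x => //; rewrite h1 h2.
- move=> x y Kx Ky [Ax hx] [Ay hy].
  have /andP[h1 h2] := AmM x Kx Ax; have /andP[h3 h4] := AmM y Ky Ay.
  by rewrite ler_norml; apply/andP; split; lra.
- move=> x y Kx Ky [Ax hx] [Ay hy].
  have /andP[h1 h2] := AmM x Kx Ax; have /andP[h3 h4] := AmM y Ky Ay.
  by rewrite ler_norml; apply/andP; split; lra.
- by split; lra.
- have := ler_wpM2l (ltW z0) hz; lra.
Qed.

End NoGaps.

Lemma finite_min (R : realType) (f : nat -> R) n : (forall j, 0 < f j) ->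
  exists2 g : R, 0 < g & forall j, (j < n)%N -> g <= f j.
Proof.
move=> f0; elim: n => [|n [g g0 IH]]; first by exists 1.
exists (Num.min g (f n)); first by rewrite lt_min g0 f0.
move=> j; rewrite ltnS leq_eqVlt => /orP[/eqP ->|/IH h].
  by rewrite ge_min lexx orbT.
by rewrite ge_min h.
Qed.

(** * Gaps in the slopes make [K] flat *)

Section Flatness.
Context (R : realType) (K : set R[i]) (q : nat).
Context (al be : 'I_q -> R[i]) (sg : 'I_q -> bool) (r L d0 h k : R).
Context (r01 : 0 < r < 1) (al_le : forall j, normc (al j) <= r).
Context (k01 : 0 < k <= 1) (al_ge : forall j, k <= normc (al j)).
Context (K_in : forall j z, K z -> K (sim al be sg j z))
  (K_cov : forall z, K z -> exists j w, K w /\ z = sim al be sg j w).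
Context (bL : bounded_by K L) (L0 : 0 < L).
Context (hc : length_content K d0 h) (d00 : 0 < d0) (h0 : 0 < h).

Local Notation act := (act al be sg).
Local Notation lin := (lin al sg).
Local Notation parity := (parity sg).

(** The shortest prefix with ratio at most [del]: its last letter multiplies a ratio above [del] by
    at least [k]. *)
Lemma piece_of_size (del : R) x : 0 < del <= 1 -> K x ->
  exists u y, [/\ K y, x = act u y & k * del <= normc (lin u) <= del].
Proof.
move=> /andP[del0 del1] Kx; case/andP: (r01) => r0 r1; case/andP: k01 => k0 k1.
have [|n hn] := @exprn_small R r del _ del0; first by rewrite (ltW r0) r1.
have [u [y [Ky ey]]] := act_cover K_cov n Kx.
have exj : exists j, normc (lin (take j u)) <= del.
  exists n; rewrite -{1}(size_tuple u) take_size; apply: le_trans (ltW hn).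
  by have := lin_le sg al_le u; rewrite size_tuple.
case: (ex_minnP exj) => j hj jmin.
exists (take j u), (act (drop j u) y); split.
- exact: act_in.
- by rewrite -act_cat cat_take_drop.
- rewrite hj andbT; case: j hj jmin => [|j] hj jmin.
    by rewrite take0 normc1 mulr_ile1 // ltW.
  have lt : del < normc (lin (take j u)).
    by rewrite ltNge; apply/negP => /jmin; rewrite ltnn.
  have ju : (j < size u)%N.
    rewrite ltnNge; apply/negP => uj; move: lt; rewrite ltNge => /negP[].
    by rewrite take_oversize //; move: hj; rewrite take_oversize // leqW.
  have [i0 _] : exists i : 'I_q, true by case: (tval u) ju => [//|i s _]; exists i.
  rewrite (take_nth i0 ju) -cats1 lin_cat normcM normc_flip mulrC.
  apply: ler_pM; rewrite ?(ltW k0) ?(ltW del0) ?(ltW lt) //.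
  by rewrite /= normcM normc_flip normc1 mulr1.
Qed.

Context (e : R[i]) (cc : R) (e1 : normc e = 1) (cc0 : 0 < cc)
  (he : forall x y, K x -> K y -> cc * normc (x - y) <= `|cross e (x - y)|)
  (gaps : forall s0 s1 : R, s0 < s1 -> exists s (eta : R), [/\ s0 < s < s1, 0 < eta &
     forall x y, K x -> K y ->
       eta * `|cross e (x - y)| <= `|proj e (x - y) - s * cross e (x - y)|]).

Lemma crossE_frame a b : cross a b = proj e a * cross e b - cross e a * proj e b.
Proof.
have := sqr_normc e; rewrite e1 expr1n => h1.
rewrite projE (projE e b) /cross.
transitivity ((Re e ^+ 2 + Im e ^+ 2) * (Re a * Im b - Im a * Re b)); last by ring.
by rewrite -h1 mul1r.
Qed.

Lemma cross_act u x y z :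
  `|cross (act u y - act u x) (act u z - act u x)| =
  normc (lin u) ^+ 2 * `|cross (y - x) (z - x)|.
Proof.
rewrite !actB sqr_normc -[X in _ = X * _]ger0_norm ?addr_ge0 ?sqr_ge0 // -normrM.
case: (parity u) => /=.
  by rewrite -normrN /cross !ReImE; congr `|_|; ring.
by rewrite /cross !ReImE; congr `|_|; ring.
Qed.

Let p z := cross e z.

(** One forbidden slope [s_ j] is taken in each interval of length [kap]. The points of [K] in the
    lower half of a dense window all see [Y0] on the same side of every [s_ j], so they lie within
    O(kap * D) of a line. A copy of [K] of size comparable to [D] fits there and is rescaled. *)
Lemma nearly_collinear (kap : R) x y z : 0 < kap -> K x -> K y -> K z ->
  `|cross (y - x) (z - x)| <= 80 * L ^+ 2 / k * kap.
Proof.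
move=> kap0 Kx Ky Kz; case/andP: (k01) => k0 k1.
pose S := cc^-1; have S0 : 0 < S by rewrite invr_gt0.
have pS u v : K u -> K v -> normc (u - v) <= S * `|p (u - v)|.
  by move=> Ku Kv; rewrite mulrC ler_pdivlMr // mulrC; exact: he.
have pn u v : `|p (u - v)| <= normc (u - v).
  by apply: le_trans (normr_cross_le _ _) _; rewrite e1 mul1r.
have Qn u v : `|proj e (u - v)| <= normc (u - v).
  by apply: le_trans (normr_proj_le _ _) _; rewrite e1 mul1r.
have Qp u v : K u -> K v -> `|proj e (u - v)| <= S * `|p (u - v)|.
  by move=> Ku Kv; apply: le_trans (Qn u v) (pS _ _ Ku Kv).
have hS j : exists se : R * R,
   [/\ - S + j%:R * kap < se.1 < - S + j.+1%:R * kap, 0 < se.2 &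
     forall u v, K u -> K v -> se.2 * `|p (u - v)| <= `|proj e (u - v) - se.1 * p (u - v)|].
  have [|s [eta [hs eta0 hse]]] := gaps (_ : - S + j%:R * kap < - S + j.+1%:R * kap).
    by rewrite ltrD2l ltr_pM2r // ltr_nat.
  by exists (s, eta).
have /choice[se hse] := hS.
pose s_ j := (se j).1.
pose N := (Num.truncn (2 * S / kap)).+1.
have [g g0 hg] := @finite_min R (fun j => (se j).2) N (fun j => let: And3 _ h _ := hse j in h).
pose S' := S + kap.
have S'0 : 0 < S' by rewrite addr_gt0.
have NS : N%:R * kap <= 2 * S + kap.
  have : (Num.truncn (2 * S / kap))%:R <= 2 * S / kap.
    by rewrite truncn_le divr_ge0 ?mulr_ge0 // ltW.
  have -> : N%:R = (Num.truncn (2 * S / kap))%:R + 1 :> R by rewrite natr1.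
  by rewrite ler_pdivlMr // mulrDl mul1r; lra.
have s_le j : (j < N)%N -> `|s_ j| <= S'.
  move=> jN; have [/andP[h1 h2] _ _] := hse j.
  have : j.+1%:R * kap <= N%:R * kap by rewrite ler_wpM2r ?(ltW kap0) // ler_nat.
  have : 0 <= j%:R * kap by rewrite mulr_ge0 // ltW.
  by rewrite ler_norml /S' /s_ => ? ?; apply/andP; split; lra.
(* A move of width [2 * (zeta * D)] changes [proj e (Y0 - X) - s_ j * p (Y0 - X)] by at most
   [4 * S' * zeta * D], less than its least absolute value [g * D / 4]. *)
pose zeta := Num.min (1 / 8) (g / (64 * S')).
have z0 : 0 < zeta.
  rewrite lt_min; apply/andP; split; first by lra.
  by apply: divr_gt0 => //; apply: mulr_gt0.
have z8 : zeta <= 1 / 8 by rewrite ge_min lexx.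
have zg : zeta * (64 * S') <= g.
  by rewrite -ler_pdivlMr ?mulr_gt0 // ge_min lexx orbT.
have [|m [D [D0 hD]]] := dense_window r01 al_le K_in K_cov bL L0 hc d00 h0 e1 cc0 he (zeta := zeta).
  by rewrite z0; lra.
have zD0 : 0 < zeta * D by rewrite mulr_gt0.
have zD8 : zeta * D <= D / 8 by have := ler_wpM2r (ltW D0) z8; lra.
(* [Y0] lies in the top eighth of the window, so [p (Y0 - X)] is at least [D / 4] for [X] in the
   lower five eighths. *)
have [||Y0 KY0 /andP[hY1 hY2]] := hD (m + D - zeta * D); [lra|lra|].
rewrite -/(p Y0) in hY1 hY2.
have pB u v : p (u - v) = p u - p v by exact: crossB.
have QB u v : proj e (u - v) = proj e u - proj e v by exact: projB.
pose dom X := K X /\ m <= p X <= m + 5 / 8 * D.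
have Ppos X : dom X -> D / 4 <= p (Y0 - X) <= D.
  by move=> [KX /andP[h1 h2]]; rewrite pB; apply/andP; split; lra.
pose side j X := proj e (Y0 - X) < s_ j * p (Y0 - X).
have near1 j X X' : (j < N)%N -> dom X -> dom X' -> `|p (X - X')| <= 2 * (zeta * D) ->
    side j X -> side j X'.
  move=> jN dX dX' hXX; have [KX _] := dX; have [KX' _] := dX'.
  have /andP[P1 P2] := Ppos _ dX; have [_ _ hgap] := hse j.
  have P0 : 0 < p (Y0 - X) by apply: lt_le_trans P1; rewrite divr_gt0.
  have := hgap _ _ KY0 KX; rewrite -/(s_ j) (gtr0_norm P0) => hg1.
  rewrite /side => hlt.
  have hg2 : g * p (Y0 - X) <= s_ j * p (Y0 - X) - proj e (Y0 - X).
    rewrite ltr0_norm ?subr_lt0 // opprB in hg1.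
    by apply: le_trans hg1; rewrite ler_wpM2r ?(ltW P0) // hg.
  have eQ : proj e (Y0 - X') = proj e (Y0 - X) + proj e (X - X') by rewrite !QB; lra.
  have eP : p (Y0 - X') = p (Y0 - X) + p (X - X') by rewrite !pB; lra.
  have hQ : proj e (X - X') <= S' * (2 * (zeta * D)).
    apply: le_trans (ler_norm _) _; apply: le_trans (Qp _ _ KX KX') _.
    by apply: ler_pM => //; rewrite ?(ltW S0) // lerDl ltW.
  have hs : - (S' * (2 * (zeta * D))) <= s_ j * p (X - X').
    have : `|s_ j * p (X - X')| <= S' * (2 * (zeta * D)).
      by rewrite normrM; apply: ler_pM => //; exact: s_le.
    by rewrite ler_norml => /andP[].
  rewrite eQ eP mulrDr.
  have h1 := ler_wpM2r (ltW D0) zg.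
  have h2 := ler_wpM2l (ltW g0) P1.
  have h3 : 0 < S' * (zeta * D) by rewrite mulr_gt0.
  lra.
have near2 j X X' : (j < N)%N -> dom X -> dom X' -> `|p (X - X')| <= 2 * (zeta * D) ->
    side j X = side j X'.
  move=> jN dX dX' hXX; apply/idP/idP; apply: near1 => //.
  by rewrite pB distrC -pB.
(* A chain with one point of [K] in each consecutive interval of width [zeta * D] over the lower
   half; further on, [Y0] is a dummy. *)
have /choice[xs hxs] i : exists X, K X /\ (i%:R * zeta <= 1 / 2 ->
    m + i%:R * (zeta * D) < p X < m + i%:R * (zeta * D) + zeta * D).
  have [hi|hi] := lerP (i%:R * zeta) (1 / 2); last by exists Y0.
  have := ler_wpM2r (ltW D0) hi => hi'.
  have i0 : 0 <= i%:R * (zeta * D) by rewrite mulr_ge0 // ltW.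
  have [||X KX hX] := hD (m + i%:R * (zeta * D)); [lra|lra|].
  by exists X.
have dxs i : i%:R * zeta <= 1 / 2 -> dom (xs i).
  move=> hi; have [KX /(_ hi) /andP[h1 h2]] := hxs i; split => //.
  have := ler_wpM2r (ltW D0) hi => hi'.
  have i0 : 0 <= i%:R * (zeta * D) by rewrite mulr_ge0 // ltW.
  by apply/andP; split; lra.
have side_xs i j : (j < N)%N -> i%:R * zeta <= 1 / 2 -> side j (xs i) = side j (xs 0%N).
  move=> jN; elim: i => // i IH hi.
  have hi' : i%:R * zeta <= 1 / 2 by move: hi; rewrite -natr1; lra.
  rewrite -IH //; apply: near2 => //; try exact: dxs.
  have [_ /(_ hi) /andP[h1 h2]] := hxs i.+1; have [_ /(_ hi') /andP[h3 h4]] := hxs i.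
  move: h1 h2; rewrite pB -natr1 ler_norml => h1 h2.
  by apply/andP; split; lra.
have d0' : dom (xs 0%N) by apply: dxs; rewrite mul0r; lra.
have side_dom X j : (j < N)%N -> K X -> m <= p X <= m + D / 2 -> side j X = side j (xs 0%N).
  move=> jN KX /andP[h1 h2].
  pose i := Num.truncn ((p X - m) / (zeta * D)).
  have /truncn_itv /andP[i1 i2] : 0 <= (p X - m) / (zeta * D).
    by rewrite divr_ge0 ?(ltW zD0) // subr_ge0.
  rewrite ler_pdivlMr // in i1; rewrite ltr_pdivrMr // -natr1 in i2.
  have hi : i%:R * zeta <= 1 / 2.
    by rewrite -(ler_pM2r D0); rewrite -/i in i1; lra.
  rewrite -(side_xs i j) //; apply: near2 => //.
  - by split => //; apply/andP; split; lra.
  - exact: dxs.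
  - have [_ /(_ hi) /andP[h3 h4]] := hxs i; rewrite -/i in i1 i2.
    by rewrite pB ler_norml; apply/andP; split; lra.
pose sl X := proj e (Y0 - X) / p (Y0 - X).
have Pp X : dom X -> 0 < p (Y0 - X).
  by move=> /Ppos /andP[h1 _]; apply: lt_le_trans h1; rewrite divr_gt0.
have slS X : dom X -> - S <= sl X <= S.
  move=> dX; have P0 := Pp _ dX; have := Qp _ _ KY0 dX.1.
  rewrite (gtr0_norm P0) -ler_norml normrM normfV (gtr0_norm P0).
  by rewrite ler_pdivrMr.
have sideE X j : dom X -> side j X = (sl X < s_ j).
  by move=> dX; rewrite /side /sl ltr_pdivrMr ?Pp.
(* Slopes further apart than [2 * kap] would have a whole interval of length [kap], hence some
   [s_ j], between them. *)
have close X X' : dom X -> dom X' ->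
    (forall j, (j < N)%N -> side j X = side j X') -> sl X' <= sl X + 2 * kap.
  move=> dX dX' hs; rewrite leNgt; apply/negP => hlt.
  have /andP[a1 a2] := slS _ dX; have /andP[b1 b2] := slS _ dX'.
  pose j := (Num.truncn ((sl X + S) / kap)).+1.
  have /truncn_itv /andP[j1 j2] : 0 <= (sl X + S) / kap.
    by rewrite divr_ge0 ?(ltW kap0) //; lra.
  rewrite ler_pdivlMr // in j1; rewrite ltr_pdivrMr // -/j in j2.
  have jE : (j%:R : R) = (Num.truncn ((sl X + S) / kap))%:R + 1 :> R by rewrite /j -natr1.
  have jN : (j < N)%N.
    have sk : 0 <= 2 * S / kap by rewrite ltW // divr_gt0 // mulr_gt0.
    rewrite /N ltnS truncn_ge_nat //.
    by rewrite ler_pdivlMr // jE mulrDl mul1r; lra.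
  have [/andP[s1 s2] _ _] := hse j; rewrite -/(s_ j) in s1 s2.
  have := hs j jN; rewrite !sideE //.
  have -> : sl X < s_ j by lra.
  have : s_ j < sl X'.
    have jE2 : (j.+1%:R : R) = (Num.truncn ((sl X + S) / kap))%:R + 1 + 1.
      by rewrite -jE natr1.
    rewrite jE2 in s2; lra.
  by move=> /ltW; rewrite leNgt => /negbTE ->.
pose s0 := sl (xs 0%N).
pose Er X := proj e (Y0 - X) - s0 * p (Y0 - X).
have hEr X : K X -> m <= p X <= m + D / 2 -> `|Er X| <= 2 * (kap * D).
  move=> KX hX; have dX : dom X.
    by split => //; case/andP: hX => h1 h2; apply/andP; split; lra.
  have hs j : (j < N)%N -> side j X = side j (xs 0%N) by move=> jN; exact: side_dom.
  have c1 := close _ _ dX d0' hs.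
  have c2 := close _ _ d0' dX (fun j jN => esym (hs j jN)).
  have P0 := Pp _ dX; have /andP[_ P2] := Ppos _ dX.
  have -> : Er X = (sl X - s0) * p (Y0 - X).
    by rewrite /Er /sl mulrBl divfK ?gt_eqF.
  rewrite normrM (gtr0_norm P0) mulrA; apply: ler_pM => //; first exact: ltW.
  by rewrite /s0 ler_norml; apply/andP; split; lra.
have D2L : D <= 2 * L.
  have [||x1 Kx1 /andP[h1 h2]] := hD m; [lra|lra|].
  have : `|p (Y0 - x1)| <= L by apply: le_trans (pn _ _) _; exact: bL.
  by rewrite pB ler_norml => /andP[_]; rewrite -/(p x1) in h1 h2; lra.
(* The copy has diameter at most [D / 10] and contains a point of height between [m + D / 4] and
   [m + 3 / 8 * D], so it stays in the lower half of the window. *)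
pose del := D / (10 * L).
have del01 : 0 < del <= 1.
  by rewrite divr_gt0 ?mulr_gt0 //= ler_pdivrMr ?mulr_gt0 //; lra.
have delL : del * L = D / 10 by rewrite /del; field; rewrite gt_eqF.
have [||xc Kxc /andP[xc1 xc2]] := hD (m + D / 4); [lra|lra|].
rewrite -/(p xc) in xc1 xc2.
have [u [yc [Kyc exc /andP[u1 u2]]]] := piece_of_size del01 Kxc.
have ul : normc (lin u) * L <= D / 10 by rewrite -delL ler_wpM2r // ltW.
have hact v : K v -> K (act u v) /\ m <= p (act u v) <= m + D / 2.
  move=> Kv; split; first exact: act_in.
  have : `|p (act u v - xc)| <= D / 10.
    apply: le_trans (pn _ _) _; apply: le_trans ul; rewrite exc.
    exact: (act_diam al be sg bL).
  by rewrite pB ler_norml => /andP[h1 h2]; apply/andP; split; lra.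
have lu0 : 0 < normc (lin u).
  by apply: lt_le_trans u1; case/andP: del01 => ? _; rewrite mulr_gt0.
have hcr := cross_act u x y z.
set A := act u x in hcr; set B := act u y in hcr; set C := act u z in hcr.
have [KA pA] := hact x Kx; have [KB pBB] := hact y Ky; have [KC pC] := hact z Kz.
have EA := hEr _ KA pA; have EB := hEr _ KB pBB; have EC := hEr _ KC pC.
have nBA : `|p (B - A)| <= normc (lin u) * L.
  by apply: le_trans (pn _ _) _; exact: (act_diam al be sg bL).
have nCA : `|p (C - A)| <= normc (lin u) * L.
  by apply: le_trans (pn _ _) _; exact: (act_diam al be sg bL).
have ecr : cross (B - A) (C - A) = (Er A - Er B) * p (C - A) - p (B - A) * (Er A - Er C).
  rewrite crossE_frame -/(p _) -/(p _) /Er !QB !pB; ring.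
have hAB : `|Er A - Er B| <= 4 * (kap * D).
  by apply: le_trans (ler_normB _ _) _; lra.
have hAC : `|Er A - Er C| <= 4 * (kap * D).
  by apply: le_trans (ler_normB _ _) _; lra.
have kD0 : 0 < kap * D by rewrite mulr_gt0.
have big : `|cross (B - A) (C - A)| <= 8 * (kap * D) * (normc (lin u) * L).
  rewrite ecr; apply: le_trans (ler_normB _ _) _; rewrite !normrM.
  have h1 := ler_pM (normr_ge0 _) (normr_ge0 _) hAB nCA.
  have h2 := ler_pM (normr_ge0 _) (normr_ge0 _) nBA hAC.
  lra.
move: big; rewrite hcr expr2 -mulrA.
rewrite (_ : 8 * (kap * D) * (normc (lin u) * L) = normc (lin u) * (8 * (kap * D) * L)); last by ring.
rewrite ler_pM2l // => big.
(* The factor 80 is 8 from [big] times 10 from the size of the copy. *)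
have u1' : k * D <= normc (lin u) * (10 * L).
  by move: u1; rewrite /del mulrA ler_pdivrMr ?mulr_gt0.
rewrite -(ler_pM2l (mulr_gt0 k0 D0)).
apply: le_trans (ler_wpM2r (normr_ge0 _) u1') _.
rewrite [leLHS]mulrAC.
have L10 : 0 <= 10 * L by rewrite mulr_ge0 // ltW.
apply: le_trans (ler_wpM2r L10 big) _.
by rewrite le_eqVlt; apply/orP; left; apply/eqP; field; rewrite gt_eqF.
Qed.

End Flatness.

(** * Distances of a self-similar set in the complex plane *)

Section Core.
Context (R : realType) (K : set R[i]) (q : nat).
Context (al be : 'I_q -> R[i]) (sg : 'I_q -> bool) (r L d0 h : R).
Context (r01 : 0 < r < 1) (al_gt0 : forall j, 0 < normc (al j))
  (al_le : forall j, normc (al j) <= r).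
Context (K_in : forall j z, K z -> K (sim al be sg j z))
  (K_cov : forall z, K z -> exists j w, K w /\ z = sim al be sg j w).
Context (cl : clustering K) (bL : bounded_by K L) (L0 : 0 < L).
Context (hc : length_content K d0 h) (d00 : 0 < d0) (h0 : 0 < h).

(** Without an open set of limit directions, every interval of slopes contains a direction that the
    secants of [K] avoid uniformly. One such direction provides the frame [e], the others the gaps.
    Finally [nearly_collinear] is applied with [kap] proportional to the cross product itself, which
    bounds that product by its half. *)
Lemma collinear_or_directions :
  (forall x y z, K x -> K y -> K z -> cross (y - x) (z - x) = 0) \/
  exists e1 (kap : R), [/\ normc e1 = 1, 0 < kap &
    forall e, normc e = 1 -> normc (e - e1) <= kap -> limit_direction K e].
Proof.
have [yes|no] := pselect (exists e1 (kap : R), [/\ normc e1 = 1, 0 < kap &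
    forall e, normc e = 1 -> normc (e - e1) <= kap -> limit_direction K e]).
  by right.
left.
have gap e (s0 s1 : R) : normc e = 1 -> s0 < s1 -> exists s (eta : R),
    [/\ s0 < s < s1, 0 < eta & forall x y, K x -> K y ->
      eta * normc (x - y) <= `|cross (e * Complex s 1) (x - y)|].
  move=> e1 s01; apply: contrapT => hno; apply: no.
  apply: (interior_directions e1 s01) => s hs.
  apply: contrapT => /not_limit_direction[eta eta0 heta]; apply: hno.
  by exists s, eta.
have [s [eta [_ eta0 heta]]] := gap 1 0 1 (normc1 R) ltr01.
set d := 1 * Complex s 1 in heta.
have nd : 0 < normc d.
  rewrite normc_gt0; apply/eqP => /(congr1 (@complex.Im R)).
  by rewrite /d mul1r /= => /eqP; rewrite oner_eq0.
pose e := d * real_complex R (normc d)^-1.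
have e1 : normc e = 1.
  by rewrite normcM normc_real gtr0_norm ?invr_gt0 // divff // gt_eqF.
have ce z : cross e z = (normc d)^-1 * cross d z.
  by rewrite /e /cross !ReImE /=; ring.
have [k k01 al_ge] := ratio_min r01 al_gt0 al_le.
move=> x y z Kx Ky Kz; apply/eqP; rewrite -normr_eq0 eq_le normr_ge0 andbT.
have he x' y' : K x' -> K y' -> eta / normc d * normc (x' - y') <= `|cross e (x' - y')|.
  move=> Kx' Ky'; rewrite ce normrM (gtr0_norm (_ : 0 < (normc d)^-1)) ?invr_gt0 //.
  by rewrite mulrAC mulrC ler_wpM2l ?invr_ge0 ?(ltW nd) // heta.
have gaps s0 s1 : s0 < s1 -> exists s (eta : R), [/\ s0 < s < s1, 0 < eta &
     forall x y, K x -> K y ->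
       eta * `|cross e (x - y)| <= `|proj e (x - y) - s * cross e (x - y)|].
  move=> s01; have [s' [eta' [hs' eta'0 h']]] := gap e s0 s1 e1 s01.
  exists s', eta'; split => // x' y' Kx' Ky'.
  have -> : proj e (x' - y') - s' * cross e (x' - y') = - cross (e * Complex s' 1) (x' - y').
    by rewrite projE /cross !ReImE /=; ring.
  rewrite normrN; apply: le_trans (h' _ _ Kx' Ky'); rewrite ler_wpM2l ?(ltW eta'0) //.
  by apply: le_trans (normr_cross_le _ _) _; rewrite e1 mul1r.
rewrite leNgt; apply/negP => pos.
have k0 : 0 < k by case/andP: k01.
have C0 : 0 < 80 * L ^+ 2 / k by rewrite divr_gt0 // mulr_gt0 // exprn_gt0.
have := @nearly_collinear R K q al be sg r L d0 h k r01 al_le k01 al_ge K_in K_cov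
  bL L0 hc d00 h0 e _ e1 (divr_gt0 eta0 nd) he gaps
  (`|cross (y - x) (z - x)| / (2 * (80 * L ^+ 2 / k))) x y z.
move=> /(_ (divr_gt0 pos (mulr_gt0 (ltr0Sn _ _) C0)) Kx Ky Kz).
set u := `|_| in pos *; set C := 80 * _ / _ in C0 *.
rewrite (_ : C * (u / (2 * C)) = u / 2); last by field; rewrite gt_eqF.
by lra.
Qed.

Lemma two_points : exists x y, [/\ K x, K y & x != y].
Proof.
apply: contrapT => hno.
have sing x y : K x -> K y -> x = y.
  by move=> Kx Ky; apply/eqP; apply: contraT => xy; case: hno; exists x, y.
have : h <= 0.
  apply: (hc (F := fun _ => K) (d := fun _ => 0)).
  - by move=> _; rewrite lexx (ltW d00).
  - by move=> _ x y Kx Ky; rewrite (sing _ _ Kx Ky) subrr normc0.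
  - by move=> x Kx; exists 0%N.
  - by move=> n; rewrite big1.
by rewrite leNgt h0.
Qed.

(** The distance to an end [y0] of [K] is an isometry of [K] into its distance set, so covers of the
    distances pull back to covers of [K]. *)
Lemma collinear_case (t : R) : 0 < t < 1 ->
  (forall x y z, K x -> K y -> K z -> cross (y - x) (z - x) = 0) ->
  distance_content K t.
Proof.
move=> /andP[t0 t1] hcol; have [x [y [Kx Ky xy]]] := two_points.
pose e := y - x.
have e0 : 0 < normc e by rewrite normc_gt0 subr_eq0 eq_sym.
have hz z z' : K z -> K z' -> normc e * normc (z - z') = `|proj e (z - z')|.
  move=> Kz Kz'; apply/eqP; rewrite -(@eqrXn2 _ 2) ?mulr_ge0 ?normc_ge0 //.
  rewrite exprMn -proj_cross_sqr real_normK ?num_real // crossB.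
  have h1 := hcol x y z Kx Ky Kz; have h2 := hcol x y z' Kx Ky Kz'.
  rewrite -/e crossB in h1; rewrite -/e crossB in h2.
  have -> : cross e z - cross e z' = 0 by lra.
  by rewrite expr0n addr0.
pose E : set R := fun u => exists2 z, K z & u = proj e z.
have hinf : has_inf E.
  split; first by exists (proj e x), x.
  exists (proj e x - normc e * L) => _ [z Kz ->].
  have := hz z x Kz Kx; have := ler_wpM2l (ltW e0) (bL Kz Kx).
  have := ler_norm (- proj e (z - x)); rewrite normrN projB; lra.
have /choice[s hs] n : exists z, K z /\ proj e z < inf E + n.+1%:R^-1.
  have [|u [z Kz ->] hu] := @inf_adherent R E n.+1%:R^-1 _ hinf; first by rewrite invr_gt0.
  by exists z.
have [y0 Ky0 hy0] := cl (fun n => (hs n).1).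
have y0min z : K z -> proj e y0 <= proj e z.
  move=> Kz; have hinfz : inf E <= proj e z by apply: ge_inf; [case: hinf|exists z].
  apply: le_trans hinfz; rewrite leNgt; apply/negP => hlt.
  pose g := (proj e y0 - inf E) / 2.
  have g0 : 0 < g by rewrite divr_gt0 // subr_gt0.
  have ge0 : 0 < g / normc e by rewrite divr_gt0.
  have [m mk hm] := hy0 _ ge0 (Num.truncn g^-1).
  have h1 := (hs m).2.
  have h2 : m.+1%:R^-1 < g.
    rewrite invf_plt ?posrE //; apply: lt_le_trans (truncnS_gt _) _.
    by rewrite ler_nat ltnS.
  have h3 : `|proj e (s m - y0)| < g.
    by rewrite -(hz _ _ (hs m).1 Ky0) mulrC -ltr_pdivlMr.
  have := ler_norm (- proj e (s m - y0)); rewrite normrN {1}projB => h4.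
  have gE : 2 * g = proj e y0 - inf E by rewrite /g; field.
  have h5 : proj e (s m) < inf E + g by apply: lt_trans h1 _; rewrite ltrD2l.
  have h6 := le_lt_trans h4 h3.
  have key (A B C u : R) : 2 * u = B - C -> A < C + u -> - (A - B) < u -> False by lra.
  exact: key gE h5 h6.
have hn z : K z -> normc e * normc (z - y0) = proj e z - proj e y0.
  by move=> Kz; rewrite hz // projB ger0_norm // subr_ge0 y0min.
have iso z z' : K z -> K z' ->
    normc (z - z') = `|normc (z - y0) - normc (z' - y0)|.
  move=> Kz Kz'; apply: (mulfI (lt0r_neq0 e0)).
  rewrite hz // -[in RHS](gtr0_norm e0) -normrM mulrBr !hn // projB.
  by congr `|_|; ring.
(* A sum below 1 and the [t]-th power of [d0] forces all sizes below 1 and [d0]; they are then at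
   most their [t]-th powers, and [h] bounds the sum. *)
pose c := Num.min h (Num.min 1 (d0 `^ t)).
exists c; first by rewrite !lt_min h0 ltr01 powR_gt0.
move=> U d M dk hU cov hM; rewrite leNgt; apply/negP => Mc.
have {Mc} [Mh M1 Md] : [/\ M < h, M < 1 & M < d0 `^ t].
  by move: Mc; rewrite !lt_min => /and3P[].
have dM k : d k `^ t <= M.
  apply: le_trans (hM k.+1); rewrite big_ord_recr /= lerDr.
  by apply: sumr_ge0 => i _; exact: powR_ge0.
have d1 k : d k < 1.
  apply: (powR_gt_inj (dk k) ler01 t0); rewrite powR1.
  exact: le_lt_trans (dM k) M1.
have dd k : d k <= d0.
  apply: ltW; apply: (powR_gt_inj (dk k) (ltW d00) t0).
  exact: le_lt_trans (dM k) Md.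
have dt k : d k <= d k `^ t.
  have := dk k; rewrite le_eqVlt => /orP[/eqP <-|p0]; first exact: powR_ge0.
  by apply: ger1_powR; rewrite ?p0 ?(ltW (d1 k)) ?(ltW t1).
move: Mh; rewrite ltNge => /negP[].
apply: (hc (F := fun k z => K z /\ U k (normc (z - y0))) (d := d)).
- by move=> k; rewrite dk dd.
- by move=> k z z' [Kz Uz] [Kz' Uz']; rewrite iso //; exact: hU Uz Uz'.
- by move=> z Kz; have [k hk] := cov z y0 Kz Ky0; exists k.
- by move=> n; apply: le_trans (hM n); apply: ler_sum => k _.
Qed.

Lemma core_distance_content (t : R) : 0 < t < 1 -> distance_content K t.
Proof.
move=> t01; have [x [y [Kx Ky xy]]] := two_points.
have [[u0 pu0 tu0]|no] := pselect (exists2 u0, parity sg u0 = false & ~ torsion (lin al sg u0)).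
  exact: (rotation_case r01 al_gt0 al_le K_in K_cov cl bL L0 hc d00 h0 t01 pu0 tu0 Kx Ky xy).
have [hcol|[e1 [kap [e11 kap0 hdir]]]] := collinear_or_directions.
  exact: collinear_case.
apply: (torsion_case r01 al_gt0 al_le K_in K_cov cl bL L0 hc d00 h0 t01 _ Kx e11 kap0).
  by move=> u pu; apply: contrapT => tu; apply: no; exists u.
move=> e e_1 he eta eta0; exact: (limit_direction_oriented e_1 (hdir e e_1 he) eta0).
Qed.

End Core.

(** * Back to the Euclidean plane and Hausdorff dimension *)

Section PlaneCoordinates.
Context (R : realType).
Implicit Types x y : 'rV[R]_2.

Definition to_complex x : R[i] := Complex (x 0 0) (x 0 1).

Definition of_complex (z : R[i]) : 'rV[R]_2 :=
  \row_(i < 2) (if i == 0 then Re z else Im z).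

Lemma of_complexK z : to_complex (of_complex z) = z.
Proof. by case: z => a b; rewrite /to_complex !mxE /=. Qed.

Lemma to_complexK x : of_complex (to_complex x) = x.
Proof.
apply/rowP => i; rewrite !mxE /=; case: eqVneq => [->//|]; case: i => -[|[|//]] h // _.
by congr (x 0 _); exact: val_inj.
Qed.

Lemma eucl_distE x y : eucl_dist x y = normc (to_complex x - to_complex y).
Proof.
rewrite /eucl_dist 2!big_ord_recr big_ord0 /= add0r; congr (Num.sqrt (_ + _)).
  by congr ((_ - _) ^+ 2); congr (_ 0 _); exact: val_inj.
by congr ((_ - _) ^+ 2); congr (_ 0 _); exact: val_inj.
Qed.

(** After normalisation to fix 0 and 1, the distances to these points determine the real part, and
    the imaginary part up to sign. The image of the imaginary unit decides the sign for all points
    at once. *)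
Lemma similitude_form (f : R[i] -> R[i]) (r : R) : 0 < r ->
  (forall z w, normc (f z - f w) = r * normc (z - w)) ->
  exists a b s, normc a = r /\ forall z, f z = a * flip s z + b.
Proof.
move=> r0 hf; pose a := f 1 - f 0.
have na : normc a = r by rewrite /a hf subr0 normc1 mulr1.
have a0 : a != 0 by rewrite -normc_gt0 na.
pose g z := (f z - f 0) / a.
have fg z : f z = a * g z + f 0 by rewrite /g mulrC divfK // subrK.
have hg z w : normc (g z - g w) = normc (z - w).
  apply: (mulfI (lt0r_neq0 r0)); rewrite -[RHS]hf -na -normcM; congr normc.
  by rewrite (fg z) (fg w); ring.
have g0 : g 0 = 0 by rewrite /g subrr mul0r.
have g1 : g 1 = 1 by rewrite /g divff.
have sq z w : (Re (g z) - Re (g w)) ^+ 2 + (Im (g z) - Im (g w)) ^+ 2 =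
    (Re z - Re w) ^+ 2 + (Im z - Im w) ^+ 2.
  by have := congr1 (fun u => u ^+ 2) (hg z w); rewrite /= !sqr_normc !ReImE.
have gre z : Re (g z) = Re z.
  have := sq z 0; have := sq z 1; rewrite g0 g1 !ReImE; lra.
have gim z : Im (g z) ^+ 2 = Im z ^+ 2.
  have := sq z 0; rewrite g0 gre !ReImE; lra.
pose j := Complex 0 1 : R[i].
have : (Im (g j) - 1) * (Im (g j) + 1) = 0.
  have h : Im (g j) ^+ 2 = 1 by rewrite gim expr1n.
  by rewrite -subr_sqr expr1n h subrr.
have him z : (Im (g z) - Im (g j)) ^+ 2 = (Im z - 1) ^+ 2.
  by have := sq z j; rewrite !gre => /addrI.
move/eqP; rewrite mulf_eq0 => /orP[/eqP hj|/eqP hj].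
  have {}hj : Im (g j) = 1 by lra.
  exists a, (f 0), false; split => // z; rewrite fg; congr (a * _ + _).
  apply: complex_eqP; first exact: gre.
  by have := him z; have := gim z; rewrite hj /=; lra.
have {}hj : Im (g j) = -1 by lra.
exists a, (f 0), true; split => // z; rewrite fg; congr (a * _ + _).
apply: complex_eqP; rewrite ?ReJ ?ImJ; first exact: gre.
by have := him z; have := gim z; rewrite hj; lra.
Qed.

Definition complex_set (K : set 'rV[R]_2) : set R[i] := fun z => K (of_complex z).

Lemma complex_setE K x : complex_set K (to_complex x) = K x.
Proof. by rewrite /complex_set to_complexK. Qed.

Lemma compact_clustering (K : set 'rV[R]_2) : compact K -> clustering (complex_set K).
Proof.
move=> cK s hs; pose F := ((fun n => of_complex (s n)) @ \oo)%classic.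
have FF : ProperFilter F by exact: fmap_proper_filter.
have FK : F K by exists 0%N => // n _; exact: hs.
have [x [Kx clx]] := cK F FF FK.
exists (to_complex x); first by rewrite complex_setE.
move=> e e0 n.
(* The balls of the library are those of the sup norm, so each coordinate is allowed half of [e]. *)
have e2 : 0 < e / 2 by rewrite divr_gt0.
have [|y [[m nm <-] bxy]] :=
  clx [set of_complex (s m) | m in [set m | (n <= m)%N]]%classic
    (ball x (e / 2)) _ (nbhsx_ballx x _ e2).
  by exists n => // m nm; exists m.
exists m => //; rewrite normcB.
apply: le_lt_trans (normc_le_ReIm _) _.
have h0 := bxy.2 0 0; have h1 := bxy.2 0 1.
rewrite /ball /= !mxE /= in h0 h1.
by rewrite !ReImE /=; lra.
Qed.

Lemma clustering_bounded (K : set R[i]) : clustering K -> exists2 L : R, 0 < L & bounded_by K L.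
Proof.
move=> cl.
have [B hB] : exists B : R, forall z, K z -> normc z <= B.
  apply: contrapT => hno.
  have /choice[s hs] n : exists z, K z /\ n%:R < normc z.
    apply: contrapT => hn; apply: hno; exists n%:R => z Kz.
    by rewrite leNgt; apply/negP => h; apply: hn; exists z.
  have [x Kx hx] := cl s (fun n => (hs n).1).
  have [m hm hd] := hx 1 ltr01 (Num.truncn (normc x + 1)).+1.
  have h1 := (hs m).2.
  have h2 : normc x + 1 < m%:R.
    by apply: lt_le_trans (truncnS_gt _) _; rewrite ler_nat.
  have := normc_trans x (s m) 0; rewrite !subr0; lra.
exists (2 * `|B| + 1); first by rewrite ltr_wpDl ?mulr_ge0.
move=> x y Kx Ky; apply: le_trans (le_normcD x (- y)) _; rewrite normcN.
have := hB x Kx; have := hB y Ky; have := ler_norm B; lra.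
Qed.

End PlaneCoordinates.

(** * Hausdorff contents and the elementary covering statements *)

Section HausdorffBridge.
Context (R : realType) (T : Type) (dist : T -> T -> R).
Local Open Scope ereal_scope.

Lemma diam_ge0 (A : set T) : 0 <= diam dist A.
Proof. by apply: ereal_sup_ubound; left. Qed.

Lemma diam_le (A : set T) (a : R) : (0 <= a)%R ->
  (forall x y, A x -> A y -> (dist x y <= a)%R) -> diam dist A <= a%:E.
Proof.
move=> a0 hA; apply: ge_ereal_sup => _ [->|[x Ax [y Ay <-]]]; rewrite lee_fin //.
exact: hA.
Qed.

Lemma dist_le_diam (A : set T) x y : A x -> A y -> (dist x y)%:E <= diam dist A.
Proof. by move=> Ax Ay; apply: ereal_sup_ubound; right; exists x => //; exists y. Qed.

Lemma diam_set0 : diam dist set0 = 0.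
Proof.
apply/eqP; rewrite eq_le diam_ge0 andbT; apply: ge_ereal_sup => u [->//|].
by move=> [x []].
Qed.

Lemma diam_pow_ge0 s (A : set T) : 0 <= diam_pow dist s A.
Proof. by rewrite /diam_pow; case: ifP => // _; exact: poweR_ge0. Qed.

Lemma nneseries_le (u : nat -> \bar R) (M : R) : (forall k, 0 <= u k) ->
  (forall n, \sum_(k < n) u k <= M%:E) -> \sum_(0 <= k <oo) u k <= M%:E.
Proof.
move=> u0 hM; apply: lime_le; first by apply: is_cvg_nneseries => *; exact: u0.
by apply: nearW => n; rewrite big_mkord.
Qed.

Lemma content_ge0 s del (A : set T) : 0 <= hausdorff_content dist s del A.
Proof.
apply: le_ereal_inf_tmp => _ [F hF <-]; apply: nneseries_ge0 => k _ _.
exact: diam_pow_ge0.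
Qed.

End HausdorffBridge.

Section Bridge.
Context (R : realType).
Local Notation absdist := (fun x y : R => `|x - y|).

Lemma length_content_exists (K : set 'rV[R]_2) :
  (0 < hausdorff_measure (@eucl_dist R 2) 1 K)%E ->
  exists d0 h : R, [/\ 0 < d0, 0 < h & length_content (complex_set K) d0 h].
Proof.
move=> /ereal_sup_gt[_ [d0 d00 <-]] hpos.
(* The content may be infinite, and then any positive [h] will do. *)
have [h [h0 hh]] : exists h : R, 0 < h /\
    (h%:E <= hausdorff_content (@eucl_dist R 2) 1 d0 K)%E.
  move: hpos; case: hausdorff_content => [u| |] //= u0; first by exists u.
  by exists 1; split => //; rewrite leey.
exists d0, h; split => // F d M hd hF hcov hM.
pose G k : set 'rV[R]_2 := fun x => F k (to_complex x).
have dG k : (diam (@eucl_dist R 2) (G k) <= (d k)%:E)%E.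
  apply: diam_le; first by have /andP[] := hd k.
  by move=> x y Gx Gy; rewrite eucl_distE; exact: hF Gx Gy.
have cG : delta_cover (@eucl_dist R 2) d0 K G.
  split.
    move=> x Kx; have [k Fk] := hcov (to_complex x) (eq_ind_r id Kx (complex_setE K x)).
    by exists k.
  by move=> k; apply: le_trans (dG k) _; rewrite lee_fin; have /andP[] := hd k.
rewrite -lee_fin; apply: le_trans hh _.
apply: (@le_trans _ _ (\sum_(0 <= k <oo) diam_pow (@eucl_dist R 2) 1 (G k))%E).
  by apply: ereal_inf_lbound; exists G.
apply: nneseries_le => [k|n]; first exact: diam_pow_ge0.
apply: (@le_trans _ _ (\sum_(k < n) (d k)%:E)%E); last by rewrite sumEFin lee_fin.
apply: lee_sum => k _; rewrite /diam_pow; case: ifP => _.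
  by rewrite lee_fin; have /andP[] := hd k.
by rewrite poweRe1 ?diam_ge0.
Qed.

Lemma distance_set_measure_neq0 (K : set 'rV[R]_2) (s : R) :
  (forall t : R, 0 < t < 1 -> distance_content (complex_set K) t) ->
  0 <= s < 1 -> hausdorff_measure absdist s (distance_set K) <> 0%E.
Proof.
move=> hK /andP[s0 s1] hs.
(* [distance_content] is known for positive exponents only, while [s] may be 0. Raising the exponent
   only lowers the sum, since the members have diameter at most 1. *)
pose t := Num.max s (1 / 2).
have st : s <= t by rewrite le_max lexx.
have t0 : 0 < t by rewrite lt_max; apply/orP; right; lra.
have t1 : t < 1 by rewrite gt_max s1; lra.
have [c c0 hc] := hK t (introT andP (conj t0 t1)).
have : (hausdorff_content absdist s 1 (distance_set K) < c%:E)%E.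
  apply: (@le_lt_trans _ _ 0%E); last by rewrite lte_fin.
  by rewrite -hs; apply: ereal_sup_ubound; exists 1 => //=.
move=> /ereal_inf_lt[_ [F [Fcov Fd] <-] hsum].
set S := (\sum_(0 <= k <oo) _)%E in hsum.
have S0 : (0 <= S)%E by apply: nneseries_ge0 => k _ _; exact: diam_pow_ge0.
have Sfin : S \is a fin_num by rewrite ge0_fin_numE // (lt_trans hsum) // ltry.
have dfin k : diam absdist (F k) \is a fin_num.
  by rewrite ge0_fin_numE ?diam_ge0 // (le_lt_trans (Fd k)) // ltry.
pose d k := fine (diam absdist (F k)).
have dE k : diam absdist (F k) = (d k)%:E by rewrite fineK.
have d0 k : 0 <= d k by rewrite -lee_fin -dE diam_ge0.
have d1 k : d k <= 1 by rewrite -lee_fin -dE.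
have dpow k : ((d k `^ t)%:E <= diam_pow absdist s (F k))%E.
  rewrite /diam_pow; case: eqP => [F0|_].
    have -> : d k = 0 by rewrite /d F0 diam_set0.
    by rewrite powR0 // gt_eqF.
  rewrite dE poweR_EFin lee_fin.
  have := d0 k; rewrite le_eqVlt => /orP[/eqP <-|p].
    by rewrite powR0 ?powR_ge0 // gt_eqF.
  by apply: ger_powR => //; rewrite p d1.
have : c <= fine S.
  apply: (hc F d (fine S)) => //.
  - by move=> k u u' Fu Fu'; rewrite -lee_fin -dE; exact: dist_le_diam.
  - move=> z w Kz Kw; have [|k _ Fk] := Fcov (normc (z - w)); last by exists k.
    exists (of_complex z) => //; exists (of_complex w) => //.
    by rewrite eucl_distE !of_complexK.
  - move=> n; rewrite -lee_fin fineK // -sumEFin.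
    apply: le_trans (nneseries_lim_ge n _); last by move=> *; exact: diam_pow_ge0.
    by rewrite big_mkord; apply: lee_sum => k _; exact: dpow.
by rewrite leNgt -lte_fin fineK // hsum.
Qed.

(** The set is cut into [2 ^ k] intervals of length [l = L / 2 ^ k], and one more receives the end
    point [L]; the total is at most 2 L l^(s-1). *)
Lemma bounded_measure_eq0 (D : set R) (L s : R) : 0 < L -> 1 < s ->
  (forall u, D u -> 0 <= u <= L) -> hausdorff_measure absdist s D = 0%E.
Proof.
move=> L0 s1 hD; apply/eqP; rewrite eq_le; apply/andP; split; last first.
  apply: le_trans (_ : (hausdorff_content absdist s 1 D <= _)%E); first exact: content_ge0.
  by apply: ereal_sup_ubound; exists 1 => //=.
apply: ge_ereal_sup => _ [del /= del0 <-].
apply/lee_addgt0Pr => eps eps0; rewrite add0e.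
have h01 : 0 < (2^-1 : R) < 1 by apply/andP; split; lra.
have s10 : 0 < s - 1 by rewrite subr_gt0.
have [k1 hk1] := geometric_powR_small h01 L0 s10 (divr_gt0 eps0 (mulr_gt0 (ltr0Sn _ 1) L0)).
have [k2 hk2] := geometric_powR_small h01 L0 ltr01 del0.
rewrite powRr1 in hk2; last by rewrite mulr_ge0 ?exprn_ge0 // ltW.
pose k := (k1 + k2)%N; pose l := L * 2^-1 ^+ k; pose n := (2 ^ k)%N.
have l0 : 0 < l by rewrite mulr_gt0 ?exprn_gt0.
have half i j : (2^-1 : R) ^+ (i + j) <= 2^-1 ^+ i.
  by rewrite exprD ler_piMr ?exprn_ge0 ?exprn_ile1 //; lra.
have ldel : l <= del.
  by apply: le_trans hk2; rewrite ler_wpM2l ?(ltW L0) // /k addnC half.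
have leps : l `^ (s - 1) <= eps / (2 * L).
  apply: le_trans hk1; apply: ge0_ler_powR; rewrite ?nnegrE ?(ltW s10) ?(ltW l0) //.
    by rewrite mulr_ge0 ?exprn_ge0 // ltW.
  by rewrite ler_wpM2l ?(ltW L0) // half.
have nl : n%:R * l = L.
  by rewrite /l /n natrX mulrCA -exprMn divff ?expr1n ?mulr1 // pnatr_eq0.
pose F i : set R := fun u => (i < n.+1)%N /\ i%:R * l <= u <= i.+1%:R * l.
have dF i : (diam absdist (F i) <= l%:E)%E.
  apply: diam_le; first exact: ltW.
  move=> u u' [_ /andP[h1 h2]] [_ /andP[h3 h4]].
  by rewrite -natr1 mulrDl mul1r in h2 h4; rewrite ler_norml; apply/andP; split; lra.
apply: (@le_trans _ _ (\sum_(0 <= i <oo) diam_pow absdist s (F i))%E).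
  apply: ereal_inf_lbound; exists F => //; split.
    move=> u Du; have /andP[u0 uL] := hD u Du.
    exists (Num.truncn (u / l)) => //.
    have /truncn_itv : 0 <= u / l by rewrite divr_ge0 // ltW.
    rewrite ler_pdivlMr // ltr_pdivrMr // => /andP[h1 h2]; split; last by rewrite h1 ltW.
    rewrite ltnS -(ler_nat R) -(ler_pM2r l0) nl; exact: le_trans h1 uL.
  by move=> i; apply: le_trans (dF i) _; rewrite lee_fin.
apply: (@le_trans _ _ (n.+1%:R * l `^ s)%:E).
  apply: nneseries_le => [i|N]; first exact: diam_pow_ge0.
  have hi i : (diam_pow absdist s (F i) <= ((nseq n.+1 (l `^ s))`_i)%:E)%E.
    rewrite nth_nseq /diam_pow; case: eqP => [_|/eqP/set0P[u [hn _]]].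
      by rewrite lee_fin; case: ifP => // _; exact: powR_ge0.
    rewrite hn -poweR_EFin; apply: gt0_ler_poweR => //.
    - by apply: ltW; apply: lt_trans s1.
    - by rewrite in_itv /= diam_ge0 leey.
    - by rewrite in_itv /= lee_fin (ltW l0) leey.
  apply: (@le_trans _ _ (\sum_(i < N) ((nseq n.+1 (l `^ s))`_i)%:E)%E).
    by apply: lee_sum => i _; exact: hi.
  rewrite sumEFin lee_fin; apply: le_trans (sum_nth_le N _) _.
    by rewrite all_nseq powR_ge0 orbT.
  by rewrite big_nseq iter_addr_0 mulr_natl.
rewrite lee_fin.
have -> : l `^ s = l * l `^ (s - 1).
  rewrite -{2}[l]powRr1 ?(ltW l0) // -powRD; first by rewrite addrC subrK.
  by rewrite (gt_eqF l0) implybT.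
have lL : l <= L by rewrite /l ler_piMr ?(ltW L0) // exprn_ile1 //; lra.
rewrite mulrA -natr1 mulrDl mul1r nl.
apply: (@le_trans _ _ (2 * L * l `^ (s - 1))).
  by rewrite ler_wpM2r ?powR_ge0 //; lra.
by rewrite mulrC -ler_pdivlMr ?mulr_gt0.
Qed.

End Bridge.

Lemma self_similar_complex (R : realType) (K : set 'rV[R]_2) :
  self_similar K -> exists (q : nat) (al be : 'I_q -> R[i]) (sg : 'I_q -> bool) (r : R),
  [/\ 0 < r < 1, forall j, 0 < normc (al j) <= r,
      forall j z, complex_set K z -> complex_set K (sim al be sg j z) &
      forall z, complex_set K z ->
        exists j w, complex_set K w /\ z = sim al be sg j w].
Proof.
move=> [_ _ [q [psi [hsim eqK]]]].
have /choice[abs habs] j : exists abs : R[i] * R[i] * bool,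
    0 < normc abs.1.1 < 1 /\
    forall z, to_complex (psi j (of_complex z)) = abs.1.1 * flip abs.2 z + abs.1.2.
  have [r [/andP[r0 r1] hr]] := hsim j.
  have [|a [b [s [na hf]]]] := @similitude_form R (fun z => to_complex (psi j (of_complex z))) r r0.
    by move=> z w; rewrite -eucl_distE hr eucl_distE !of_complexK.
  by exists (a, b, s); rewrite /= na r0 r1.
(* A uniform ratio without a maximum: [rr] is at most each [1 - normc (abs j).1.1], and halving it
   keeps [1 - rr / 2] positive even for an empty product. *)
pose rr := \prod_j (1 - normc (abs j).1.1).
have rr01 j : 0 <= 1 - normc (abs j).1.1 <= 1.
  have [/andP[h1 h2] _] := habs j.
  by rewrite subr_ge0 (ltW h2) gerBl normc_ge0.
have rr0 : 0 < rr by apply: prodr_gt0 => j _; have [/andP[_ h] _] := habs j; rewrite subr_gt0.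
have rr1 : rr <= 1 by apply: Num.Theory.prodr_ile1 => j _; exact: rr01.
have rrj j : rr <= 1 - normc (abs j).1.1.
  rewrite /rr (bigD1 j) //= ler_piMr //; first by have /andP[] := rr01 j.
  by apply: Num.Theory.prodr_ile1 => i _; exact: rr01.
have simE j x : sim (fun j => (abs j).1.1) (fun j => (abs j).1.2) (fun j => (abs j).2) j
    (to_complex x) = to_complex (psi j x).
  by have [_ h] := habs j; rewrite /sim -h to_complexK.
exists q, (fun j => (abs j).1.1), (fun j => (abs j).1.2), (fun j => (abs j).2), (1 - rr / 2); split.
- by apply/andP; split; lra.
- by move=> j; have [/andP[-> _] _] := habs j; have := rrj j; move=> /= ?; lra.
- move=> j z Kz; rewrite -(of_complexK z) simE complex_setE eqK.
  by exists j => //; exists (of_complex z).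
- move=> z; rewrite -(of_complexK z) complex_setE {1}eqK => -[j _ [x Kx <-]].
  exists j, (to_complex x); split; first by rewrite complex_setE.
  by rewrite simE.
Qed.

Theorem theorem1p2 (R : realType) (K : set 'rV[R]_2)
    (hK : self_similar K)
    (hpos : (0 < hausdorff_measure (@eucl_dist R 2%N) 1%R K)%E) :
  hausdorff_dim (fun x y : R => `|x - y|) (distance_set K) = 1%E.
Proof.
have [q [al [be [sg [r [r01 al_r K_in K_cov]]]]]] := self_similar_complex hK.
have [_ cK _] := hK; have cl := compact_clustering cK.
have [L L0 bL] := clustering_bounded cl.
have [d0 [h [d00 h0 hc]]] := length_content_exists hpos.
have core t : 0 < t < 1 -> distance_content (complex_set K) t.
  apply: (core_distance_content r01 _ _ K_in K_cov cl bL L0 hc d00 h0).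
    by move=> j; have /andP[] := al_r j.
  by move=> j; have /andP[] := al_r j.
apply/eqP; rewrite eq_le; apply/andP; split.
  apply/lee_addgt0Pr => eps eps0; apply: ereal_inf_lbound.
  exists (1 + eps) => //=; split; first by rewrite addr_ge0 // ltW.
  apply: (bounded_measure_eq0 L0); first by rewrite ltrDl.
  move=> _ [x Kx [y Ky <-]]; rewrite eucl_distE; apply/andP; split.
    exact: normc_ge0.
  by apply: bL; rewrite complex_setE.
apply: le_ereal_inf_tmp => _ [s [s0 hs] <-]; rewrite lee_fin leNgt; apply/negP => s1.
by apply: (distance_set_measure_neq0 core _ hs); rewrite s0.
Qed.
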